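(* Let $n\in\{2,3\}$, let $\lambda,\mu$ be Lamé constants with $\mu>0$, $n\lambda+2\mu>0$, let $\delta\in(0,1]$ if $n=2$ and $\delta\in(0,1/2]$ if $n=3$, and let $\mathcal M_{max},\varepsilon_{max}>0$; these are the a-priori constants. There is a constant $C>0$ depending only on the a-priori constants such that the following holds. Let $\omega>0$, let $\Omega\subset\mathbb R^n$ be a bounded Lipschitz domain with connected complement, let $(\Omega;\lambda,\mu,V)$ be an inhomogeneous medium scatterer with $\mathrm{supp}(V)\subset\Omega$ and $\|V\|_{\widetilde C^\delta(\overline\Omega)}\le\mathcal M_{max}$, put $\varepsilon=d(\Omega)\,\omega$ ($d(\Omega)$ the diameter of $\Omega$) and assume $\varepsilon\le\varepsilon_{max}$. Let $\mathbf u^i\in L^2_{loc}(\mathbb R^n)^n$ be an incident wave. If $$\sup_{\mathbf p\in\partial\Omega}\frac{|V(\mathbf p)\mathbf u^i(\mathbf p)|}{\|V\|_{\widetilde C^\delta}\|\mathbf u^i\|_{\widetilde C^\delta}}>C\varepsilon^\delta\bigl(1+(1+\Upsilon(\varepsilon_{max},\mathcal M_{max}))(1+\varepsilon)\varepsilon^{n/2}\bigr),$$ then $(\Omega;\lambda,\mu,V)$ must be radiating, i.e. the far-field pattern $\mathbf u^\infty$ generated by $\mathbf u^i$ is not identically zero.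
   Context: $\mathcal L\mathbf u=\mu\Delta\mathbf u+(\lambda+\mu)\nabla(\nabla\cdot\mathbf u)$; $\kappa_p=\omega/\sqrt{\lambda+2\mu}$, $\kappa_s=\omega/\sqrt\mu$. Medium scattering: $V\in L^\infty(\mathbb R^n)$ is a scalar function with $\mathrm{supp}(V)\subset\Omega$ (boundary values of $V$ are those of its continuous extension from $\Omega$ to $\overline\Omega$). An incident wave is an entire complex-valued solution of $\mathcal L\mathbf u^i+\omega^2\mathbf u^i=\mathbf 0$ in $\mathbb R^n$. The total field $\mathbf u^t=\mathbf u^i+\mathbf u\in H^1_{loc}(\mathbb R^n)^n$ is the unique solution of $\mathcal L\mathbf u^t+\omega^2(1+V)\mathbf u^t=\mathbf 0$ in $\mathbb R^n$ with $\mathbf u$ outgoing, meaning that outside $\overline\Omega$, $\mathbf u=\mathbf u_p+\mathbf u_s$ with $\mathbf u_p=-\kappa_p^{-2}\nabla(\nabla\cdot\mathbf u)$ and $\mathbf u_s=\kappa_s^{-2}\nabla\times\nabla\times\mathbf u$ if $n=3$, $\mathbf u_s=\kappa_s^{-2}\,\mathbf{curl}\,\mathrm{curl}\,\mathbf u$ if $n=2$ ($\mathrm{curl}\,\mathbf u=\partial_1u_2-\partial_2u_1$, $\mathbf{curl}\,u=(\partial_2u,-\partial_1u)^\top$), and $|\mathbf x|^{(n-1)/2}(\partial_{|\mathbf x|}\mathbf u_\iota-\mathrm i\kappa_\iota\mathbf u_\iota)\to\mathbf 0$ as $|\mathbf x|\to\infty$, $\iota=p,s$. The far-field pattern is $\mathbf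 u^\infty=u_p^\infty\hat{\mathbf x}+\mathbf u_s^\infty$, where $\mathbf u=\frac{e^{\mathrm i\kappa_p|\mathbf x|}}{|\mathbf x|^{(n-1)/2}}u_p^\infty(\hat{\mathbf x})\hat{\mathbf x}+\frac{e^{\mathrm i\kappa_s|\mathbf x|}}{|\mathbf x|^{(n-1)/2}}\mathbf u_s^\infty(\hat{\mathbf x})+O(|\mathbf x|^{-(n+1)/2})$, $\mathbf u_s^\infty\cdot\hat{\mathbf x}=0$, $\hat{\mathbf x}=\mathbf x/|\mathbf x|$. Norm: $\|g\|_{\widetilde C^\delta(\Omega)}=\|g\|_{L^\infty(\Omega)}+\omega^{-\delta}[g]_{\delta,\Omega}$, where $[g]_{\delta,\Omega}$ is the Hölder seminorm $\sup_{\mathbf x\neq\mathbf y\in\Omega}|g(\mathbf x)-g(\mathbf y)|/|\mathbf x-\mathbf y|^\delta$ (maximum over components if $g$ is vector-valued); unspecified norms are over $\Omega$. $\Upsilon(\varepsilon,m)=\dfrac{\varepsilon m}{s-\varepsilon m}$, where $s=s_{n,\lambda,\mu}>0$ is a constant depending only on $n,\lambda,\mu$ such that, whenever $\varepsilon\|V\|_{L^\infty}<s$ with $\varepsilon=d(\Omega)\omega$, every incident wave satisfies $\|\mathbf u\|_{L^2(\Omega)}\le\Upsilon(\varepsilon,\|V\|_{L^\infty})\|\mathbf u^i\|_{L^2(\Omega)}$ and $\|\mathbf u^t\|_{L^2(\Omega)}\le\frac{s}{s-\varepsilon\|V\|_{L^\infty}}\|\mathbf u^i\|_{L^2(\Om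ega)}$.
   Formalization: The formal theorem additionally assumes ε_max·M_max < s, with s the constant in Υ; otherwise Υ(ε_max, M_max) is undefined or negative, and the claim as printed can fail because the right-hand side may become negative. *)

(* Defs.v *)
From HB Require Import structures.
From mathcomp Require Import all_boot all_order all_algebra.
From mathcomp Require Import all_classical all_reals all_analysis.
From mathcomp Require Import complex.
Set Implicit Arguments. Unset Strict Implicit. Unset Printing Implicit Defensive.
Import Order.TTheory GRing.Theory Num.Theory numFieldNormedType.Exports.
Local Open Scope classical_set_scope.
Local Open Scope ring_scope.

(* Lebesgue measure on R^n = 'rV[R]_n: the sigma-algebra is generated by the
   coordinates, and the measure is obtained by iterating the product with the
   Lebesgue measure of R. *)

Section measurable_rV.
Variables (R : realType) (n : nat).

Let coors : 'I_n -> 'rV[R]_n -> measurableTypeR R := fun i v => v ord0 i.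

Let rV_set0 : g_sigma_preimage coors set0.
Proof. exact: sigma_algebra0. Qed.

Let rV_setC A : g_sigma_preimage coors A -> g_sigma_preimage coors (~` A).
Proof. exact: sigma_algebraC. Qed.

Let rV_bigcup (F : (set _)^nat) : (forall i, g_sigma_preimage coors (F i)) ->
  g_sigma_preimage coors (\bigcup_i (F i)).
Proof. exact: sigma_algebra_bigcup. Qed.

HB.instance Definition _ := @isMeasurable.Build
  default_measure_display
  'rV[R]_n (g_sigma_preimage coors) rV_set0 rV_setC rV_bigcup.
End measurable_rV.

Lemma measurable_fun_coord (R : realType) n (i : 'I_n) :
  measurable_fun [set: 'rV[R]_n] (fun v => v ord0 i).
Proof.
move=> _ Y mY; rewrite setTI; apply: sub_sigma_algebra => /=.
rewrite -bigcup_seq/=; exists i => /=; first by rewrite mem_index_enum.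
by exists Y => //; rewrite setTI.
Qed.

Lemma measurable_fun_rVP (R : realType) d (T : measurableType d) n
    (f : T -> 'rV[R]_n) :
  (forall i, measurable_fun [set: T] (fun x => f x ord0 i)) ->
  measurable_fun [set: T] f.
Proof.
move=> mf.
have H : g_sigma_preimage (fun i x => f x ord0 i : measurableTypeR R) `<=` (@measurable _ T).
  apply: smallest_sub; first exact: sigma_algebra_measurable.
  case: n f mf => [|n] f mf; first by rewrite big_ord0.
  rewrite -bigcup_mkord_ord; apply: bigcup_sub => i Ii.
  by move=> A [B mB <-]; exact: mf.
move=> _ A mA; apply: H.
have := g_sigma_preimage_comp
  (fun i (v : 'rV[R]_n) => v ord0 i : measurableTypeR R) f.
by rewrite /comp => ->; exists A.
Qed.

Section lebesgue_rV.
Variable R : realType.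

Definition rV_cons n (p : measurableTypeR R * 'rV[R]_n) : 'rV[R]_n.+1 :=
  row_mx p.1%:M p.2.

Definition rV_uncons n (v : 'rV[R]_n.+1) : measurableTypeR R * 'rV[R]_n :=
  (v ord0 ord0, @rsubmx R 1 1 n v).

Lemma rV_consK n : cancel (@rV_cons n) (@rV_uncons n).
Proof.
move=> [a v]; rewrite /rV_uncons /rV_cons /=; congr (_, _).
  rewrite mxE; case: splitP => // j _; by rewrite mxE !ord1 mulr1n.
exact: row_mxKr.
Qed.

Lemma measurable_rV_cons n : measurable_fun setT (@rV_cons n).
Proof.
apply: measurable_fun_rVP => i.
have -> : (fun p => rV_cons p ord0 i) =
    (fun p => match fintype.split (i : 'I_(1 + n)) with
              | inl _ => p.1 | inr j => p.2 ord0 j end).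
  apply/funext => p; rewrite mxE; case: (fintype.split _) => // j.
  by rewrite mxE !ord1 mulr1n.
case: (fintype.split _) => j; first exact: measurable_fst.
apply: (measurableT_comp (f := fun v : 'rV[R]_n => v ord0 j)) => //.
exact: measurable_fun_coord.
Qed.

Lemma measurable_rV_uncons n : measurable_fun setT (@rV_uncons n).
Proof.
apply: measurable_fun_pair; first exact: measurable_fun_coord.
apply: measurable_fun_rVP => i.
rewrite (_ : (fun _ => _) = (fun v : 'rV[R]_n.+1 => v ord0 (rshift 1 i))).
  exact: measurable_fun_coord.
by apply/funext => v; rewrite mxE.
Qed.

Section step.
Variables (n : nat) (m : {sigma_finite_measure set 'rV[R]_n -> \bar R}).

Definition lebesgue_rV_step : set 'rV[R]_n.+1 -> \bar R :=
  pushforward (@lebesgue_measure R \x m)%E (@rV_cons n).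

Let mf := @measurable_rV_cons n.

Let step0 : lebesgue_rV_step set0 = 0%E.
Proof. by rewrite /lebesgue_rV_step /pushforward preimage_set0 measure0. Qed.

Let step_ge0 A : (0 <= lebesgue_rV_step A)%E.
Proof. exact: measure_ge0. Qed.

Let step_sigma_additive : semi_sigma_additive lebesgue_rV_step.
Proof.
move=> F mF tF mUF; rewrite /lebesgue_rV_step /pushforward preimage_bigcup.
apply: measure_semi_sigma_additive.
- by move=> k; rewrite -[X in measurable X]setTI; exact: mf.
- apply/trivIsetP => /= i j _ _ ij; rewrite -preimage_setI.
  by move/trivIsetP : tF => /(_ _ _ _ _ ij) ->//; rewrite preimage_set0.
- by rewrite -preimage_bigcup -[X in measurable X]setTI; exact: mf.
Qed.

HB.instance Definition _ := isMeasure.Build _ _ _ lebesgue_rV_step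
  step0 step_ge0 step_sigma_additive.

Let lebesgue_rV_step_sigma_finite : sigma_finite setT lebesgue_rV_step.
Proof.
have /sigma_finiteP[F [TF ndF Foo]] := sigma_finiteT (@lebesgue_measure R).
have /sigma_finiteP[G [TG ndG Goo]] := sigma_finiteT m.
exists (fun k => @rV_uncons n @^-1` (F k `*` G k)).
  apply/seteqP; split=> // v _.
  have [i _ Fi] : (\bigcup_k F k) (rV_uncons v).1 by rewrite -TF.
  have [j _ Gj] : (\bigcup_k G k) (rV_uncons v).2 by rewrite -TG.
  exists (maxn i j) => //; split.
    by move: Fi; exact/subsetPset/ndF/leq_maxl.
  by move: Gj; exact/subsetPset/ndG/leq_maxr.
move=> k; have [mF Fk] := Foo k; have [mG Gk] := Goo k; split.
  rewrite -[X in measurable X]setTI; apply: measurable_rV_uncons => //.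
  exact: measurableX.
rewrite /lebesgue_rV_step /pushforward -comp_preimage.
rewrite (_ : _ @^-1` _ = F k `*` G k).
  by rewrite product_measure1E// lte_mul_pinfty// ge0_fin_numE.
by apply/seteqP; split=> p; rewrite /preimage [_ \o _]/comp /mkset rV_consK.
Qed.

HB.instance Definition _ := Measure_isSigmaFinite.Build _ _ _ lebesgue_rV_step
  lebesgue_rV_step_sigma_finite.
End step.

Fixpoint lebesgue_rV n : {sigma_finite_measure set 'rV[R]_n -> \bar R} :=
  if n is n'.+1 then lebesgue_rV_step (lebesgue_rV n') else \d_(0 : 'rV[R]_0).

End lebesgue_rV.

Local Open Scope complex_scope.
Local Notation Re := complex.Re.
Local Notation Im := complex.Im.

Notation cfun R n := ('rV[R]_n -> R[i]).
Notation cfield R n := ('rV[R]_n -> 'rV[R[i]]_n).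

(* Euclidean norms; the norm of the normed module 'rV[R]_n is the max norm. *)
Section euclid.
Variables (R : realType) (n : nat).

Definition enorm (x : 'rV[R]_n) : R := Num.sqrt (\sum_i x ord0 i ^+ 2).

Definition edot (x y : 'rV[R]_n) : R := \sum_i x ord0 i * y ord0 i.

Definition cabs (z : R[i]) : R := Num.sqrt (Re z ^+ 2 + Im z ^+ 2).

Definition cnorm (v : 'rV[R[i]]_n) : R := Num.sqrt (\sum_i cabs (v ord0 i) ^+ 2).

(* bilinear, not sesquilinear *)
Definition cdot (v w : 'rV[R[i]]_n) : R[i] := \sum_i v ord0 i * w ord0 i.

Definition toC (x : 'rV[R]_n) : 'rV[R[i]]_n := map_mx (fun a : R => a%:C) x.

Definition diam (A : set 'rV[R]_n) : R :=
  sup [set enorm (p.1 - p.2) | p in A `*` A].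

Definition boundary (A : set 'rV[R]_n) : set 'rV[R]_n :=
  closure A `\` interior A.

End euclid.

Section calculus.
Variables (R : realType) (n : nat).
Implicit Types (f : cfun R n) (u : cfield R n) (U : set 'rV[R]_n).

Definition derivableC f (x v : 'rV[R]_n) : Prop :=
  derivable (fun y => Re (f y)) x v /\ derivable (fun y => Im (f y)) x v.

Definition dirderiv (v : 'rV[R]_n) f (x : 'rV[R]_n) : R[i] :=
  'D_v (fun y => Re (f y)) x +i* 'D_v (fun y => Im (f y)) x.

Definition partial (i : 'I_n) f : cfun R n := dirderiv (delta_mx ord0 i) f.

Definition contC_at f (x : 'rV[R]_n) : Prop :=
  {for x, continuous (fun y => Re (f y))} /\
  {for x, continuous (fun y => Im (f y))}.

(* C^k on the set U, which has to be open *)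
Fixpoint Ck (k : nat) U f : Prop :=
  if k is k'.+1 then
    forall i, (forall x, U x -> derivableC f x (delta_mx ord0 i)) /\
              Ck k' U (partial i f)
  else forall x, U x -> contC_at f x.

Definition smooth_on U f : Prop := forall k, Ck k U f.

Definition coord u (i : 'I_n) : cfun R n := fun x => u x ord0 i.

Definition grad f : cfield R n := fun x => \row_i partial i f x.

Definition divergence u : cfun R n := fun x => \sum_i partial i (coord u i) x.

Definition laplacian f : cfun R n := fun x => \sum_i partial i (partial i f) x.

Definition navier (lambda mu : R) u : cfield R n := fun x =>
  mu%:C *: (\row_j laplacian (coord u j) x) +
  (lambda + mu)%:C *: grad (divergence u) x.

(* derivative of u in the direction x / |x| *)
Definition radial_deriv u : cfield R n := fun x =>
  \row_j dirderiv ((enorm x)^-1 *: x) (coord u j) x.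

End calculus.

Section curl.
Variable R : realType.

Definition curl2 (u : cfield R 2) : cfun R 2 := fun x =>
  partial ord0 (coord u ord_max) x - partial ord_max (coord u ord0) x.

Definition vcurl2 (f : cfun R 2) : cfield R 2 := fun x =>
  \row_j (if j == ord0 then partial ord_max f x else - partial ord0 f x).

(* indices modulo 3 *)
Definition curl3 (u : cfield R 3) : cfield R 3 := fun x =>
  \row_j (partial (j + 1) (coord u (j + 2%:R)) x -
          partial (j + 2%:R) (coord u (j + 1)) x).

(* the value for n different from 2 and 3 is irrelevant *)
Definition curlcurl (n : nat) : cfield R n -> cfield R n :=
  match n return cfield R n -> cfield R n with
  | 2 => fun u => vcurl2 (curl2 u)
  | 3 => fun u => curl3 (curl3 u)
  | _ => fun u => u
  end.

End curl.

Section function_spaces.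
Variables (R : realType) (n : nat).
Implicit Types (f g : cfun R n) (u : cfield R n) (A : set 'rV[R]_n).

Definition cintegral f : R[i] :=
  (\int[lebesgue_rV R n]_x Re (f x)) +i* (\int[lebesgue_rV R n]_x Im (f x)).

Definition measurable_cfun f : Prop :=
  measurable_fun setT (fun x => Re (f x)) /\
  measurable_fun setT (fun x => Im (f x)).

Definition L2loc f : Prop := measurable_cfun f /\
  forall r : R, (\int[lebesgue_rV R n]_(x in [set x | (enorm x <= r)%R])
                   ((cabs (f x)) ^+ 2)%:E < +oo)%E.

Definition test_fun f : Prop := smooth_on setT f /\
  exists r : R, forall x, r < enorm x -> f x = 0.

Definition weak_partial (i : 'I_n) f g : Prop :=
  forall phi, test_fun phi ->
    cintegral (fun x => f x * partial i phi x) =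
    - cintegral (fun x => g x * phi x).

Definition H1loc f : Prop := L2loc f /\
  forall i, exists g, L2loc g /\ weak_partial i f g.

Definition Linf_norm A (h : 'rV[R]_n -> R) : \bar R :=
  'N[lebesgue_rV R n]_+oo[ (fun x => (h x)%:E) \_ A ].

Definition L2_norm A u : \bar R :=
  'N[lebesgue_rV R n]_2%:E[ (fun x => (cnorm (u x))%:E) \_ A ].

Definition holder_semi (delta : R) A f : \bar R :=
  ereal_sup [set ((cabs (f p.1 - f p.2)) / (enorm (p.1 - p.2) `^ delta))%:E |
             p in [set p | A p.1 /\ A p.2 /\ p.1 <> p.2]].

Definition Ctilde_norm (omega delta : R) A f : \bar R :=
  (Linf_norm A (fun x => cabs (f x)) +
   (omega `^ (- delta))%:E * holder_semi delta A f)%E.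

Definition Ctilde_norm_field (omega delta : R) A u : \bar R :=
  (Linf_norm A (fun x => cnorm (u x)) +
   (omega `^ (- delta))%:E *
     \big[maxe/0]_i holder_semi delta A (coord u i))%E.

(* value at the boundary point p of the continuous extension of f from A *)
Definition bdry_value A f (p : 'rV[R]_n) : R[i] :=
  lim (Re (f x) @[x --> within A (nbhs p)]) +i*
  lim (Im (f x) @[x --> within A (nbhs p)]).

End function_spaces.

(* Near each boundary point Om is, for some unit vector nu, the strict epigraph
   in direction nu of a Lipschitz function on the hyperplane orthogonal to nu. *)
Definition lipschitz_boundary (R : realType) (n : nat) (Om : set 'rV[R]_n) :=
  forall p, boundary Om p ->
  exists (nu : 'rV[R]_n) (phi : 'rV[R]_n -> R) (K : R),
    [/\ enorm nu = 1,
        forall x y, `|phi x - phi y| <= K * enorm (x - y) &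
        \forall x \near p,
          Om x <-> phi (x - edot x nu *: nu) < edot x nu].

Definition lipschitz_domain (R : realType) (n : nat) (Om : set 'rV[R]_n) :=
  [/\ Om !=set0, open Om, connected Om, bounded_set Om & lipschitz_boundary Om].

Section scattering.
Variables (R : realType) (n : nat).
Implicit Types (u : cfield R n) (V q : cfun R n) (Om : set 'rV[R]_n).

(* L u + omega^2 q u = 0 in R^n in the sense of distributions; the operator L
   is symmetric for the bilinear pairing *)
Definition navier_solution (lambda mu omega : R) q u : Prop :=
  forall Phi : cfield R n, (forall j, test_fun (coord Phi j)) ->
    cintegral (fun x => cdot (u x) (navier lambda mu Phi x) +
                        (omega ^+ 2)%:C * q x * cdot (u x) (Phi x)) = 0.

(* Solutions in L^2_loc are smooth up to modification on a null set: the
   continuous representative is the one whose point values are used. *)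
Definition incident_wave (lambda mu omega : R) u : Prop :=
  (forall j, L2loc (coord u j) /\ forall x, contC_at (coord u j) x) /\
  navier_solution lambda mu omega (fun=> 1) u.

(* V vanishes off Om; the values of V on the (null) boundary are immaterial,
   boundary values being taken from inside, see bdry_value *)
Definition medium Om V : Prop :=
  [/\ measurable_cfun V,
      (Linf_norm setT (fun x => cabs (V x)) < +oo)%E &
      forall x, ~ Om x -> V x = 0].

Definition kappa_p (lambda mu omega : R) : R :=
  omega / Num.sqrt (lambda + 2 * mu).

Definition kappa_s (mu omega : R) : R := omega / Num.sqrt mu.

Definition pressure_part (lambda mu omega : R) u : cfield R n := fun x =>
  (- (kappa_p lambda mu omega) ^- 2)%:C *: grad (divergence u) x.

Definition shear_part (mu omega : R) u : cfield R n := fun x =>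
  ((kappa_s mu omega) ^- 2)%:C *: curlcurl u x.

Definition sommerfeld (kappa : R) u : Prop :=
  forall e : R, 0 < e -> exists r : R, forall x, r < enorm x ->
    enorm x `^ ((n%:R - 1) / 2) *
    cnorm (radial_deriv u x - (0 +i* kappa) *: u x) < e.

(* By interior regularity a scattered field is smooth off the closure of Om,
   after modification on a null set. *)
Definition outgoing (lambda mu omega : R) Om u : Prop :=
  [/\ forall j, smooth_on (~` closure Om) (coord u j),
      forall x, ~ closure Om x ->
        u x = pressure_part lambda mu omega u x + shear_part mu omega u x,
      sommerfeld (kappa_p lambda mu omega) (pressure_part lambda mu omega u) &
      sommerfeld (kappa_s mu omega) (shear_part mu omega u)].

Definition scattered ui ut : cfield R n := fun x => ut x - ui x.

Definition total_field (lambda mu omega : R) Om V ui ut : Prop :=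
  [/\ forall j, H1loc (coord ut j),
      navier_solution lambda mu omega (fun x => 1 + V x) ut &
      outgoing lambda mu omega Om (scattered ui ut)].

Definition spherical_wave (kappa : R) (x : 'rV[R]_n) : R[i] :=
  (enorm x `^ (- ((n%:R - 1) / 2)))%:C *
  (cos (kappa * enorm x) +i* sin (kappa * enorm x)).

(* uinf is only meaningful on the unit sphere *)
Definition far_field_pattern (lambda mu omega : R) u uinf : Prop :=
  exists (up : cfun R n) (us : cfield R n),
    (forall x, enorm x = 1 ->
       cdot (us x) (toC x) = 0 /\ uinf x = up x *: toC x + us x) /\
    exists K r : R, forall x, r < enorm x ->
      let xhat := (enorm x)^-1 *: x in
      cnorm (u x -
        ((spherical_wave (kappa_p lambda mu omega) x * up xhat) *: toC xhat +
         spherical_wave (kappa_s mu omega) x *: us xhat))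
      <= K * enorm x `^ (- ((n%:R + 1) / 2)).

End scattering.

Definition Upsilon (R : realType) (s eps m : R) : R := eps * m / (s - eps * m).

(* the characteristic property of the constant s = s_{n,lambda,mu} *)
Definition stability_constant (R : realType) (n : nat) (lambda mu s : R) :=
  0 < s /\
  forall (omega : R) (Om : set 'rV[R]_n) (V : cfun R n) (ui ut : cfield R n),
    0 < omega -> lipschitz_domain Om -> connected (~` Om) -> medium Om V ->
    incident_wave lambda mu omega ui ->
    total_field lambda mu omega Om V ui ut ->
    let eps := diam Om * omega in
    let m := fine (Linf_norm setT (fun x => cabs (V x))) in
    eps * m < s ->
    (L2_norm Om (scattered ui ut) <= (Upsilon s eps m)%:E * L2_norm Om ui)%E /\
    (L2_norm Om ut <= (s / (s - eps * m))%:E * L2_norm Om ui)%E.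

(* radiating for the incident wave ui *)
Definition radiating (R : realType) (n : nat) (lambda mu omega : R)
    (Om : set 'rV[R]_n) (V : cfun R n) (ui : cfield R n) : Prop :=
  forall ut uinf : cfield R n,
    total_field lambda mu omega Om V ui ut ->
    far_field_pattern lambda mu omega (scattered ui ut) uinf ->
    exists x, enorm x = 1 /\ uinf x <> 0.

(* Main.v *)
Require Import Defs.
From HB Require Import structures.
From mathcomp Require Import all_boot all_order all_algebra.
From mathcomp Require Import all_classical all_reals all_analysis.
From mathcomp Require Import complex measurable_realfun ess_sup_inf.
From mathcomp Require Import ring lra.
Set Implicit Arguments.
Unset Strict Implicit.
Unset Printing Implicit Defensive.
Import Order.TTheory GRing.Theory Num.Theory numFieldNormedType.Exports.
Local Open Scope classical_set_scope.
Local Open Scope ring_scope.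

(* If the far-field pattern vanishes, the scattered field u = ut - ui is
   O(|x|^(-(n+1)/2)).  Neither Rellich's lemma nor unique continuation is needed:
   test both equations with chi(x/N) w, where chi is a smooth cutoff and w an
   entire pressure wave decaying like |x|^(2-n).  Only the commutator with chi
   survives in the part containing u, and it contributes O(N^(-1/2)); hence
   the integral of V ut.w over Om is zero.

   For w take w_j(x) = (d_j d_k phi)(kappa_p (x - p)), where phi(y) = S(|y|^2) is
   the radial solution of Delta phi = - phi; then w(p) = - e_k / n and w differs
   from w(p) by O(eps^2) on Om.  Replacing ut by ui in the orthogonality relation
   costs the L^2 norm of u, which is O(eps) by the stability estimate; freezing
   V, ui and w at p costs O(eps^delta) by the Hoelder bounds.  Dividing by |Om|
   bounds |V(p) ui(p)| by a multiple of eps^delta ||V|| ||ui||. *)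

(** * Smooth functions with explicit partial derivatives *)

(** Power count behind N^(-1/2): a derivative of the cutoff gives N^(-1), [w] and its gradient
    N^(2-n), the scattered field at most N^(-3/2), and the volume N^n. For n = 2 mere boundedness of
    [w] suffices, so an energy identity can replace Bessel asymptotics.

    A Hessian is used because the gradient of a radial function vanishes at its centre; column k of
    the Hessian is nonzero there and isolates component k of V(p) ui(p). Being a gradient field,
    that column satisfies L w = (lambda + 2 mu) Delta w, which fixes the wave number kappa_p. It is
    also real, so real and imaginary parts can be treated separately.

    The stability estimate controls the scattered field only in mean square over Om. Therefore the
    value at p is compared with an average over Om, where the measure of Om cancels. The weight
    omega^(-delta) in the norms is exactly what turns Hoelder increments d^delta into eps^delta.

    Cutoffs and waves both lie in one inductively generated class closed under differentiation, so
    smoothness and the symmetry of second derivatives are proved once, by induction. *)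

HB.lock Definition pd {R : realType} {n : nat} (i : 'I_n) (f : 'rV[R]_n -> R) :
  'rV[R]_n -> R := 'D_(delta_mx ord0 i) f.

Section elementary.
Context {R : realType} {n : nat}.
Implicit Types f g : 'rV[R]_n -> R.
Local Notation pd := (@pd R n).

Lemma pdE (i : 'I_n) f x : pd i f x = 'D_(delta_mx ord0 i) f x.
Proof. by rewrite pd.unlock. Qed.

(* In [elementary_comp], [h] lists the outer function and its successive
   derivatives, so that the class is closed under partial derivatives. *)
Inductive elementary : ('rV[R]_n -> R) -> Prop :=
| elementary_cst c : elementary (fun=> c)
| elementary_coord i : elementary (fun x => x ord0 i)
| elementaryD f g : elementary f -> elementary g ->
    elementary (fun x => f x + g x)
| elementaryM f g : elementary f -> elementary g ->
    elementary (fun x => f x * g x)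
| elementary_comp (h : nat -> R -> R) f : elementary f ->
    (forall m x, is_derive (f x) 1 (h m) (h m.+1 (f x))) ->
    elementary (fun x => h 0%N (f x)).

Lemma pd_cst i c : pd i (fun=> c) = fun=> 0.
Proof. by apply/funext => x; rewrite pdE derive_cst. Qed.

Lemma elementary_differentiable f x : elementary f -> differentiable f x.
Proof.
elim => [c|i|{}f g _ df _ dg|{}f g _ df _ dg|h {}f _ df dh].
- exact: differentiable_cst.
- exact: differentiable_coord.
- exact: differentiableD.
- exact: differentiableM.
- apply: differentiable_comp => //.
  by apply/derivable1_diffP; have [] := dh 0%N x.
Qed.

Lemma elementary_continuous f : elementary f -> continuous f.
Proof.
by move=> ef x; apply: differentiable_continuous; exact: elementary_differentiable.
Qed.

Lemma elementary_derivable f x v : elementary f -> derivable f x v.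
Proof. by move=> ef; apply/diff_derivable/elementary_differentiable. Qed.

Lemma pd_coord i j : pd i (fun x => x ord0 j) = fun=> (i == j)%:R.
Proof.
apply/funext => x; rewrite pdE deriveE; last exact: differentiable_coord.
have f_lin : linear (fun y : 'rV[R]_n => y ord0 j : R) by move=> ? ? ?; rewrite !mxE.
pose fM := GRing.isLinear.Build _ _ _ _ _ f_lin.
pose f : {linear _ -> _} := HB.pack (fun y : 'rV[R]_n => y ord0 j : R) fM.
rewrite -[X in 'd X _]/(f : _ -> _) diff_lin /=; last exact: coord_continuous.
by rewrite mxE eqxx eq_sym.
Qed.

Lemma pdD i f g : elementary f -> elementary g ->
  pd i (fun x => f x + g x) = fun x => pd i f x + pd i g x.
Proof.
move=> ef eg; apply/funext => x.
by rewrite !pdE (deriveD (f := f) (g := g)); last 2 first; try exact: elementary_derivable.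
Qed.

Lemma pdM i f g : elementary f -> elementary g ->
  pd i (fun x => f x * g x) = fun x => f x * pd i g x + g x * pd i f x.
Proof.
move=> ef eg; apply/funext => x.
by rewrite !pdE (deriveM (f := f) (g := g)); last 2 first; try exact: elementary_derivable.
Qed.

Lemma pd_comp i (h h' : R -> R) f : elementary f ->
    (forall x, is_derive (f x) 1 h (h' (f x))) ->
  pd i (fun x => h (f x)) = fun x => h' (f x) * pd i f x.
Proof.
move=> ef dh; apply/funext => x.
have df := elementary_differentiable x ef.
have dhx : differentiable h (f x) by apply/derivable1_diffP; have [] := dh x.
rewrite pdE deriveE; last exact: differentiable_comp.
rewrite (diff_comp df dhx) /= -(deriveE _ df) -pdE.
have dh1 : derivable h (f x) 1 by have [] := dh x.
have [_ <-] := dh x; rewrite -derive1E.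
by rewrite (congr1 (fun F : R -> R => F _) (deriv1E dh1)) /= mulrC.
Qed.

Lemma elementary_pd i f : elementary f -> elementary (pd i f).
Proof.
elim => [c|j|{}f g ef df eg dg|{}f g ef df eg dg|h {}f ef df dh].
- rewrite pd_cst; exact: elementary_cst.
- rewrite pd_coord; exact: elementary_cst.
- by rewrite pdD//; exact: elementaryD.
- by rewrite pdM//; apply: elementaryD; exact: elementaryM.
- rewrite (pd_comp _ ef (dh 0%N)); apply: elementaryM => //.
  by apply: (elementary_comp (h := fun m => h m.+1)).
Qed.

(** No limit argument for mixed derivatives occurs: the sum, product and chain rules compute both
    orders for each constructor, and the resulting terms agree. *)
Lemma pdC i j f : elementary f -> pd i (pd j f) = pd j (pd i f).
Proof.
elim => [c|k|{}f g ef df eg dg|{}f g ef df eg dg|h {}f ef df dh].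
- by rewrite !pd_cst.
- by rewrite !pd_coord !pd_cst.
- rewrite (pdD j ef eg) (pdD i ef eg).
  rewrite (pdD i (elementary_pd j ef) (elementary_pd j eg)).
  by rewrite (pdD j (elementary_pd i ef) (elementary_pd i eg)) df dg.
- have [fi fj] := (elementary_pd i ef, elementary_pd j ef).
  have [gi gj] := (elementary_pd i eg, elementary_pd j eg).
  rewrite (pdM j ef eg) (pdM i ef eg).
  rewrite (pdD i (elementaryM ef gj) (elementaryM eg fj)).
  rewrite (pdD j (elementaryM ef gi) (elementaryM eg fi)).
  rewrite (pdM i ef gj) (pdM i eg fj) (pdM j ef gi) (pdM j eg fi) df dg.
  apply/funext => x; move: (pd j (pd i f) x) (pd j (pd i g) x) => a b.
  by move: (pd j f x) (pd i f x) (pd j g x) (pd i g x) => *; ring.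
- have [fi fj] := (elementary_pd i ef, elementary_pd j ef).
  have eh : elementary (fun x => h 1%N (f x)).
    by apply: (elementary_comp (h := fun m => h m.+1)).
  rewrite (pd_comp j ef (dh 0%N)) (pd_comp i ef (dh 0%N)).
  rewrite (pdM i eh fj) (pdM j eh fi).
  rewrite (pd_comp i ef (dh 1%N)) (pd_comp j ef (dh 1%N)) df.
  apply/funext => x; move: (pd j (pd i f) x) => a.
  by move: (pd j f x) (pd i f x) => *; ring.
Qed.

Lemma elementary_affine f (a : R) (b : 'rV[R]_n) :
  elementary f -> elementary (fun x => f (a *: (x - b))).
Proof.
elim => [c|j|{}f g ef df eg dg|{}f g ef df eg dg|h {}f ef df dh].
- exact: elementary_cst.
- under eq_fun do rewrite !mxE.
  apply: elementaryM; first exact: elementary_cst.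
  by apply: elementaryD; [exact: elementary_coord|exact: elementary_cst].
- exact: elementaryD.
- exact: elementaryM.
- exact: (elementary_comp (h := h)).
Qed.

Lemma pd_affine i f (a : R) (b : 'rV[R]_n) : elementary f ->
  pd i (fun x => f (a *: (x - b))) = fun x => a * pd i f (a *: (x - b)).
Proof.
elim => [c|j|{}f g ef df eg dg|{}f g ef df eg dg|h {}f ef df dh].
- by rewrite !pd_cst; apply/funext => x; rewrite mulr0.
- under eq_fun do rewrite !mxE.
  rewrite pdM; [|exact: elementary_cst|]; last first.
    by apply: elementaryD; [exact: elementary_coord|exact: elementary_cst].
  rewrite pdD; [|exact: elementary_coord|exact: elementary_cst].
  by rewrite !pd_cst !pd_coord; apply/funext => x; rewrite addr0 mulr0 addr0.
- have [fa ga] := (elementary_affine a b ef, elementary_affine a b eg).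
  by rewrite (pdD i fa ga) (pdD i ef eg) df dg; apply/funext => x; rewrite mulrDr.
- have [fa ga] := (elementary_affine a b ef, elementary_affine a b eg).
  by rewrite (pdM i fa ga) (pdM i ef eg) df dg; apply/funext => x; ring.
- have dh0 x := dh 0%N (a *: (x - b)).
  rewrite (pd_comp _ (elementary_affine a b ef) dh0) (pd_comp _ ef (dh 0%N)) df.
  by apply/funext => x; ring.
Qed.

Lemma elementaryZ c f : elementary f -> elementary (fun x => c * f x).
Proof. by move=> ef; apply: elementaryM => //; exact: elementary_cst. Qed.

Lemma pdZ i c f : elementary f -> pd i (fun x => c * f x) = fun x => c * pd i f x.
Proof.
move=> ef; rewrite pdM//; last exact: elementary_cst.
by rewrite pd_cst; apply/funext => x; rewrite mulr0 addr0.
Qed.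

Lemma elementary_sum (I : Type) (r : seq I) (F : I -> 'rV[R]_n -> R) :
  (forall i, elementary (F i)) -> elementary (fun x => \sum_(i <- r) F i x).
Proof.
move=> eF; elim: r => [|i r ih].
  by under eq_fun do rewrite big_nil; exact: elementary_cst.
by under eq_fun do rewrite big_cons; exact: elementaryD.
Qed.

Lemma pd_sum i (I : Type) (r : seq I) (F : I -> 'rV[R]_n -> R) :
  (forall i, elementary (F i)) ->
  pd i (fun x => \sum_(j <- r) F j x) = fun x => \sum_(j <- r) pd i (F j) x.
Proof.
move=> eF; elim: r => [|j r ih].
  by under eq_fun do rewrite big_nil; under [RHS]eq_fun do rewrite big_nil; exact: pd_cst.
under eq_fun do rewrite big_cons; under [RHS]eq_fun do rewrite big_cons.
by rewrite pdD// ?ih//; exact: elementary_sum.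
Qed.

Lemma partial_real (i : 'I_n) f :
  partial i (fun x => (f x)%:C%C) = (fun x => (pd i f x)%:C%C) :> ('rV[R]_n -> R[i]).
Proof. by apply/funext => x; rewrite pdE /partial /dirderiv /= derive_cst. Qed.

Lemma pd_local f (i : 'I_n) (U : set 'rV[R]_n) (c : R) : open U ->
  (forall x, U x -> f x = c) -> forall x, U x -> pd i f x = 0.
Proof.
move=> oU fc x Ux; rewrite pdE.
rewrite -(@near_eq_derive _ _ _ (cst c)) ?derive_cst//.
by near=> y; rewrite fc//; near: y; exact: open_nbhs_nbhs.
Unshelve. all: by end_near. Qed.

End elementary.

(** * A smooth cutoff function *)

Section cutoff.
Context {R : realType}.
Implicit Types (p : {poly R}) (s t : R).

(** Write e^s as (e^(s/k))^k and use e^(s/k) >= s/k; for k = 0 the convention 0^0 = 1 makes the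
    bound meaningful. *)
Lemma exprn_le_expR k s : 0 <= s -> s ^+ k <= k%:R ^+ k * expR s.
Proof.
case: k => [|k] s0.
  by rewrite !expr0 mul1r (le_trans _ (expR_ge1Dx _))// lerDl.
have -> : expR s = expR (s / k.+1%:R) ^+ k.+1.
  by rewrite -expRM_natl mulrC divfK.
rewrite -exprMn lerXn2r// ?nnegrE ?mulr_ge0 ?expR_ge0//.
rewrite -ler_pdivrMl// mulrC (le_trans _ (expR_ge1Dx _))// lerDr//.
Qed.

Lemma horner_le_expR p : exists2 C : R, 0 <= C &
  forall s, 0 <= s -> `|p.[s]| <= C * expR s.
Proof.
exists (\sum_(i < size p) `|p`_i| * i%:R ^+ i).
  by apply: sumr_ge0 => i _; rewrite mulr_ge0// exprn_ge0.
move=> s s0; rewrite horner_coef (le_trans (ler_norm_sum _ _ _))// mulr_suml.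
apply: ler_sum => i _; rewrite normrM normrX (ger0_norm s0) -mulrA.
by rewrite ler_wpM2l// exprn_le_expR.
Qed.

(** The flat functions p(1/t) e^(-1/t), taken for all polynomials at once so that the family is
    closed under differentiation. *)
Definition flat p t : R := if 0 < t then p.[t^-1] * expR (- t^-1) else 0.

(** Differentiating p(1/t) e^(-1/t) produces the factor t^(-2) from the inner function 1/t and the
    difference p - p' from the two factors. *)
Definition flat_diff p : {poly R} := 'X^2 * (p - p^`()).

Lemma flat_derive p t : is_derive t 1 (flat p) (flat (flat_diff p) t).
Proof.
have [t0|t0|->] := ltgtP t 0.
- rewrite (_ : flat (flat_diff p) t = 0); last by rewrite /flat ltNge (ltW t0).
  apply: (@near_eq_is_derive _ _ _ (cst 0)).
  near=> z; rewrite /flat /= ltNge ltW//=.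
  by near: z; exact: lt_nbhsl.
- have di : is_derive t 1 (fun y : R => y^-1) (- t ^- 2 *: 1).
    by apply: (@is_deriveV _ id) (is_derive_id t 1); rewrite gt_eqF.
  have dp := is_derive1_comp (is_derive_poly p t^-1) di.
  have de := @is_derive1_comp _ expR (- (fun y : R => y^-1)) _ _ _
    (is_derive_expR (- t^-1)) (is_deriveN di).
  have dM : is_derive t 1 ((horner p \o (fun t => t^-1)) * (expR \o (fun t => - t^-1)))
      (flat (flat_diff p) t).
    apply: (is_derive_eq (is_deriveM dp de)).
    rewrite /flat t0 /flat_diff hornerM hornerXn !hornerE /= /GRing.scale /=.
    rewrite exprVn; move: (expR _) (p.[_]) (p^`().[_]) (t ^- 2) => E a b i.
    by ring.
  apply: near_eq_is_derive dM.
  near=> z; rewrite /flat ifT//.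
  by near: z; exact: lt_nbhsr.
- rewrite (_ : flat (flat_diff p) 0 = 0); last by rewrite /flat ltxx.
  suff h : h^-1 *: (flat p (h *: 1 + 0) - flat p 0) @[h --> 0^'] --> (0 : R).
    by apply: DeriveDef; [exact: cvgP h|exact: cvg_lim h].
  (* The difference quotient at 0 is h^(-1) p(1/h) e^(-1/h) = h (X^2 p)(1/h) e^(-1/h); the
     exponential bound for X^2 p leaves a free factor h. *)
  have [C C0 hC] := horner_le_expR ('X^2 * p).
  apply/cvgr0Pnorm_lt => e e0.
  near=> h.
  have hn0 : h != 0 by near: h; exact: nbhs_dnbhs_neq.
  have he : `|h| < e / (C + 1).
    near: h; apply: dnbhs0_lt; rewrite divr_gt0// ltr_wpDl//.
  rewrite /flat ltxx subr0 addr0 /GRing.scale /= mulr1.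
  case: ifPn => [h0|_]; last by rewrite mulr0 normr0.
  apply: le_lt_trans (_ : C * h < e).
    have := hC h^-1; rewrite invr_ge0 (ltW h0) => /(_ isT).
    rewrite hornerM hornerXn => hb.
    rewrite expRN [X in `|X|](_ : _ = h * (h^-1 ^+ 2 * p.[h^-1] / expR h^-1)); last first.
      by rewrite expr2; field; rewrite hn0 gt_eqF// expR_gt0.
    rewrite normrM (gtr0_norm h0) mulrC ler_wpM2r ?(ltW h0)//.
    by rewrite normrM normfV (gtr0_norm (expR_gt0 _)) ler_pdivrMr ?expR_gt0.
  move: he; rewrite (gtr0_norm h0) ltr_pdivlMr ?ltr_wpDl// => he.
  by apply: le_lt_trans he; rewrite mulrC ler_pM2l// lerDl.
Unshelve. all: by end_near.
Qed.

Definition flat0 : R -> R := flat 1.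

Lemma flat0_gt0 t : 0 < t -> 0 < flat0 t.
Proof. by move=> t0; rewrite /flat0 /flat t0 hornerC mul1r expR_gt0. Qed.

Lemma flat0_ge0 t : 0 <= flat0 t.
Proof. by rewrite /flat0 /flat; case: ifP => // _; rewrite hornerC mul1r expR_ge0. Qed.

Lemma flat0_eq0 t : t <= 0 -> flat0 t = 0.
Proof. by rewrite /flat0 /flat leNgt => /negbTE ->. Qed.

Lemma elementary_flat0 n (f : 'rV[R]_n -> R) :
  elementary f -> elementary (fun x => flat0 (f x)).
Proof.
move=> ef; apply: (elementary_comp (h := fun m => flat (iter m flat_diff 1))) => //.
by move=> m x; exact: flat_derive.
Qed.

(** The witness lists the successive derivatives of 1/s. They need to exist only at the values taken
    by [f], which are nonzero. *)
Lemma elementary_inv n (f : 'rV[R]_n -> R) :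
  elementary f -> (forall x, f x != 0) -> elementary (fun x => (f x)^-1).
Proof.
move=> ef f0.
have -> : (fun x => (f x)^-1) = (fun x => (fun m s => (-1) ^+ m * m`!%:R * s ^- m.+1) 0%N (f x)).
  by apply/funext => x; rewrite !mul1r.
apply: (elementary_comp (h := fun m s => (-1) ^+ m * m`!%:R * s ^- m.+1)) => // m x.
have fx := f0 x; move: (f x) fx => s s0.
have di : is_derive s 1 (fun y : R => y^-1) (- s ^- 2 *: 1).
  exact: (@is_deriveV _ id) (is_derive_id s 1).
have -> : (fun s : R => (-1) ^+ m * m`!%:R * s ^- m.+1) =
    ((-1) ^+ m * m`!%:R) *: ((fun y : R => y^-1) ^+ m.+1).
  by apply/funext => y; rewrite /GRing.scale/= exprfctE -exprVn.
apply: (is_derive_eq (is_deriveZ _ (is_deriveX m.+1 di))).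
rewrite /GRing.scale /= factS natrM mulr1 -!exprVn.
move: s^-1 => i; rewrite !exprS expr0; ring.
Qed.

(** Being a function of |x|^2, it has no singularity at the origin. Since q < 4 or q > 1, the
    denominator never vanishes. The differences are spelled with [+] and [-1 *] to match the
    constructors of [elementary]. *)
Definition cutoff n (x : 'rV[R]_n) : R :=
  let q := \sum_i x ord0 i * x ord0 i in
  flat0 (4 + -1 * q) / (flat0 (4 + -1 * q) + flat0 (q + -1)).

Lemma elementary_sqnorm n : elementary (fun x : 'rV[R]_n => \sum_i x ord0 i * x ord0 i).
Proof.
by apply: elementary_sum => i; apply: elementaryM; exact: elementary_coord.
Qed.

Lemma elementary_cutoff n : elementary (@cutoff n).
Proof.
have eq := elementary_sqnorm n.
have e4 : elementary (fun x : 'rV[R]_n => flat0 (4 + -1 * (\sum_i x ord0 i * x ord0 i))).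
  apply: elementary_flat0; apply: elementaryD; first exact: elementary_cst.
  exact: elementaryZ.
have e1 : elementary (fun x : 'rV[R]_n => flat0 ((\sum_i x ord0 i * x ord0 i) + -1)).
  by apply: elementary_flat0; apply: elementaryD => //; exact: elementary_cst.
apply: elementaryM => //; apply: elementary_inv; first exact: elementaryD.
move=> x; move: (\sum_i _) => q; rewrite gt_eqF//.
have [q2|q2] := ltP q 2.
  by rewrite ltr_wpDr ?flat0_ge0// flat0_gt0//; lra.
by rewrite ltr_wpDl ?flat0_ge0// flat0_gt0//; lra.
Qed.

Lemma enorm_sqr n (x : 'rV[R]_n) : enorm x ^+ 2 = \sum_i x ord0 i * x ord0 i.
Proof.
rewrite /enorm sqr_sqrtr; last by apply: sumr_ge0 => i _; exact: sqr_ge0.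
by apply: eq_bigr => i _; rewrite expr2.
Qed.

Lemma enorm_ge0 n (x : 'rV[R]_n) : 0 <= enorm x.
Proof. exact: sqrtr_ge0. Qed.

Lemma cutoff_in n (x : 'rV[R]_n) : enorm x <= 1 -> cutoff x = 1.
Proof.
move=> x1; have : enorm x ^+ 2 <= 1 by rewrite expr_le1// enorm_ge0.
rewrite enorm_sqr /cutoff; move: (\sum_i _) => q q1.
rewrite (flat0_eq0 (t := q + -1)); last by lra.
by rewrite addr0 divff// gt_eqF// flat0_gt0//; lra.
Qed.

Lemma cutoff_out n (x : 'rV[R]_n) : 2 <= enorm x -> cutoff x = 0.
Proof.
move=> x2; have : 2 ^+ 2 <= enorm x ^+ 2 by apply: lerXn2r => //; rewrite nnegrE ?enorm_ge0.
rewrite enorm_sqr /cutoff; move: (\sum_i _) => q q1.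
by rewrite flat0_eq0 ?mul0r//; lra.
Qed.

End cutoff.

(** * The radial solution of the Helmholtz equation *)

Section radial_series.
Context {R : realType}.
Implicit Types (c : R^nat) (t x : R) (n m k : nat).

(** Domination by the exponential series survives termwise differentiation, as (k+1)/(k+1)! = 1/k!.
    Hence one condition gives convergence and the bound e^|x| for all derivatives. *)
Definition fact_bounded c := forall k, `|c k| <= k`!%:R^-1.

Lemma fact_bounded_diffs c : fact_bounded c -> fact_bounded (pseries_diffs c).
Proof.
move=> bc k; rewrite /pseries_diffs normrM normr_nat.
rewrite -(congr1 (fun f : R^nat => f k) (pseries_diffs_inv_fact R)).
by rewrite /pseries_diffs ler_wpM2l.
Qed.

Lemma fact_bounded_iter c m : fact_bounded c ->
  fact_bounded (iter m (@pseries_diffs R) c).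
Proof. by move=> bc; elim: m => //= m; exact: fact_bounded_diffs. Qed.

Lemma fact_bounded_normed_cvg c x : fact_bounded c ->
  cvgn [normed (pseries c x)].
Proof.
move=> bc; rewrite /normed_series_of /=.
apply: (series_le_cvg _ _ _ (is_cvg_series_exp_coeff `|x|)) => k /=.
- exact: normr_ge0.
- by rewrite /exp_coeff /=; apply: divr_ge0 => //; exact: exprn_ge0.
- by rewrite normrM normrX /exp_coeff /= mulrC ler_wpM2l// exprn_ge0.
Qed.

Lemma fact_bounded_cvg c x : fact_bounded c -> cvgn (pseries c x).
Proof. by move=> bc; apply/normed_cvg/fact_bounded_normed_cvg. Qed.

Lemma fact_bounded_le_expR c x : fact_bounded c ->
  `|limn (pseries c x)| <= expR `|x|.
Proof.
move=> bc; have nc := @fact_bounded_normed_cvg c x bc.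
apply: (le_trans (@lim_series_norm R R^o (fun i => c i * x ^+ i) nc)).
apply: lim_series_le; first exact: fact_bounded_normed_cvg.
  exact: is_cvg_series_exp_coeff.
move=> k /=; rewrite normrM normrX /exp_coeff /= mulrC.
by rewrite ler_wpM2l// exprn_ge0.
Qed.

Lemma fact_bounded_derive c x : fact_bounded c ->
  is_derive x 1 (fun x => limn (pseries c x)) (limn (pseries (pseries_diffs c) x)).
Proof.
move=> bc; have bdc := fact_bounded_diffs bc.
apply: (@pseries_snd_diffs _ _ (`|x| + 1)); try exact: fact_bounded_cvg.
  exact/fact_bounded_cvg/fact_bounded_diffs.
by rewrite [ltRHS]ger0_norm ?ltrDl// addr_ge0.
Qed.

(** The recurrence expresses Helmholtz's equation in the variable q = |y|^2. The series is J_0(sqrt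
    q) for n = 2 and sin(sqrt q) / sqrt q for n = 3. *)
Fixpoint radial_coef n k : R :=
  if k is k'.+1 then - radial_coef n k' / (k'.+1%:R * (4 * k'%:R + 2 * n%:R))
  else 1.

Definition radial n m t : R :=
  limn (pseries (iter m (@pseries_diffs R) (radial_coef n)) t).

Lemma radial_coef_bounded n : (0 < n)%N -> fact_bounded (radial_coef n).
Proof.
move=> n0; elim => [|k ih] /=; first by rewrite fact0 invr1 normr1.
rewrite normrM normrN factS natrM [leRHS]invfM mulrC.
have d1 : 1 <= 4 * k%:R + 2 * n%:R :> R.
  by rewrite -!natrM -natrD ler1n; move: n0; case: (n) => // p; rewrite mulnS addnC.
apply: ler_pM => //.
rewrite normfV ger0_norm ?mulr_ge0// ?(le_trans _ d1)//.
by rewrite lef_pV2 ?posrE ?mulr_gt0 ?(lt_le_trans _ d1)// ler_peMr.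
Qed.

Lemma radial_derive n m t : (0 < n)%N ->
  is_derive t 1 (radial n m) (radial n m.+1 t).
Proof.
by move=> n0; apply: fact_bounded_derive; apply/fact_bounded_iter/radial_coef_bounded.
Qed.

Lemma radial_le_expR n m t : (0 < n)%N -> `|radial n m t| <= expR `|t|.
Proof.
by move=> n0; apply: fact_bounded_le_expR; apply/fact_bounded_iter/radial_coef_bounded.
Qed.

Lemma radial_at0 n m : radial n m 0 = iter m (@pseries_diffs R) (radial_coef n) 0%N.
Proof.
rewrite /radial; set c := iter _ _ _.
apply/cvg_lim => //; rewrite -cvg_shiftS /=; apply: cvg_near_cst; apply: nearW => k.
rewrite /pseries /series /= big_nat_recl//= expr0 mulr1 big1 ?addr0// => i _.
by rewrite expr0n mulr0.
Qed.

Lemma radial00 n : radial n 0 0 = 1.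
Proof. by rewrite radial_at0. Qed.

Lemma radial10 n : radial n 1 0 = - (2 * n%:R)^-1.
Proof. by rewrite radial_at0 /= /pseries_diffs /= mulr0 add0r !mul1r mulN1r. Qed.

(* With q = |y|^2 this is the radial form of the Helmholtz equation: the
   function y |-> S(|y|^2) on R^n has Laplacian 4 q S'' + 2 n S'. *)
Lemma radial_ode n t : (0 < n)%N ->
  4 * (t * radial n 2 t) + 2 * n%:R * radial n 1 t + radial n 0 t = 0.
Proof.
move=> n0; have b0 := radial_coef_bounded n0.
set a := radial_coef n in b0 *.
have b1 := fact_bounded_diffs b0; have b2 := fact_bounded_diffs b1.
have h0 := fact_bounded_cvg (x := t) b0; have h1 := fact_bounded_cvg (x := t) b1.
(* This form of S'' carries the powers t^(i-1) with a factor i, so after multiplication by t all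
   three series share the power t^i and cancel index by index. The predecessor at i = 0 is harmless
   because of the factor i. *)
have h2 := pseries_diffs_equiv (fact_bounded_cvg (x := t) b2).
have : (fun k => 4 * (t * series (fun i => i%:R * pseries_diffs a i * t ^+ i.-1) k)
   + 2 * n%:R * pseries (pseries_diffs a) t k + pseries a t k) @ \oo -->
   4 * (t * radial n 2 t) + 2 * n%:R * radial n 1 t + radial n 0 t.
  apply: cvgD => //; apply: cvgD; last exact: cvgMr.
  by apply: cvgMr; exact: cvgMr.
move/(cvg_lim (@Rhausdorff R)) => <-; apply/cvg_lim => //.
apply: cvg_near_cst; apply: nearW => k.
rewrite /pseries /series /= !mulr_sumr -!big_split big1//= => i _.
rewrite /pseries_diffs /=.
have d0 : i.+1%:R * (4 * i%:R + 2 * n%:R) != 0 :> R.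
  by rewrite mulf_neq0// -!natrM -natrD pnatr_eq0 addn_eq0 negb_and !muln_eq0 -!lt0n n0 orbT.
have e : (4 * i%:R + 2 * n%:R) * (i.+1%:R * a i.+1) + a i = 0.
  rewrite /a /=; move: (4 * i%:R + _) (i.+1%:R) (radial_coef n i) d0 => D k' A.
  by rewrite mulf_eq0 negb_or => /andP[k0 D0]; field; rewrite D0 k0.
transitivity (((4 * i%:R + 2 * n%:R) * (i.+1%:R * a i.+1) + a i) * t ^+ i); last first.
  by rewrite e mul0r.
case: i {d0 e} => [|i]; rewrite ?exprS /=; ring.
Qed.

(** The derivative of [radial_ode]; it expresses S''' by lower derivatives, as needed for the
    gradient of the wave. *)
Lemma radial_ode1 n t : (0 < n)%N ->
  4 * (t * radial n 3 t) + (4 + 2 * n%:R) * radial n 2 t + radial n 1 t = 0.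
Proof.
move=> n0; have d m := radial_derive m t n0.
have e : (fun x => 4 * (x * radial n 2 x) + 2 * n%:R * radial n 1 x + radial n 0 x) =
    cst 0 by apply/funext => x; exact: radial_ode.
have h : is_derive t 1 (fun x => 4 * (x * radial n 2 x) + 2 * n%:R * radial n 1 x +
    radial n 0 x) (4 * (t * radial n 3 t) + (4 + 2 * n%:R) * radial n 2 t + radial n 1 t).
  have -> : (fun x => 4 * (x * radial n 2 x) + 2 * n%:R * radial n 1 x + radial n 0 x) =
      4 *: (id * radial n 2) + (2 * n%:R) *: radial n 1 + radial n 0.
    by apply/funext.
  have h2 := is_deriveZ 4 (is_deriveM (is_derive_id t 1) (d 2%N)).
  have h1 := is_deriveZ (2 * n%:R) (d 1%N).
  apply: (is_derive_eq (is_deriveD (is_deriveD h2 h1) (d 0%N))).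
  rewrite /GRing.scale /=.
  by move: (radial n 1 t) (radial n 2 t) (radial n 3 t) => *; ring.
by have [_ <-] := h; rewrite e derive_cst.
Qed.

Lemma derive_le0_le (f f' : R -> R) t : 0 <= t ->
  (forall x, 0 <= x -> is_derive x 1 f (f' x) /\ f' x <= 0) -> f t <= f 0.
Proof.
move=> t0 df; rewrite -subr_le0.
have [| |c ct ->] := @MVT_segment R f f' 0 t t0.
- by move=> x; rewrite in_itv /= => /andP[/ltW/df[]].
- apply: derivable_within_continuous => x; rewrite in_itv /= => /andP[/df[[]]] //.
- by rewrite subr0 mulr_le0_ge0//; have := ct; rewrite in_itv /= => /andP[/df[]].
Qed.

(* phi^2 + phi'^2 is nonincreasing in r, where phi(r) = S(r^2). *)
Lemma radial2_energy t : 0 <= t -> radial 2 0 t ^+ 2 + 4 * (t * radial 2 1 t ^+ 2) <= 1.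
Proof.
move=> t0.
pose f x : R := radial 2 0 x ^+ 2 + 4 * (x * radial 2 1 x ^+ 2).
pose f' x : R := - (4 * radial 2 1 x ^+ 2).
suff key : forall x, 0 <= x -> is_derive x 1 f (f' x) /\ f' x <= 0.
  have := derive_le0_le t0 key.
  by rewrite /f radial00 mul0r mulr0 addr0 expr1n.
move=> x x0; have d m := radial_derive (n := 2) m x isT; split; last first.
  by rewrite /f' oppr_le0 mulr_ge0// sqr_ge0.
have -> : f = (radial 2 0 * radial 2 0 + 4 *: (id * (radial 2 1 * radial 2 1))).
  by apply/funext => y; rewrite /f !expr2.
have hs m := is_deriveM (d m) (d m).
apply: (is_derive_eq (is_deriveD (hs 0%N)
  (is_deriveZ 4 (is_deriveM (is_derive_id x 1) (hs 1%N))))).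
rewrite /f' !fctE /GRing.scale /=.
have := radial_ode (n := 2) x isT.
move: (radial 2 0 x) (radial 2 1 x) (radial 2 2 x) => a b c e.
rewrite [X in X = _](_ : _ = 2 * b * (4 * (x * c) + 2 * 2 * b + a) - 4 * b ^+ 2).
  by rewrite e mulr0 add0r.
by ring.
Qed.

(* (r phi)^2 + ((r phi)')^2 is constant, since (r phi)'' = - r phi. *)
Lemma radial3_energy t : 0 <= t ->
  t * radial 3 0 t ^+ 2 + (radial 3 0 t + 2 * (t * radial 3 1 t)) ^+ 2 <= 1.
Proof.
move=> t0.
pose f x : R := x * radial 3 0 x ^+ 2 + (radial 3 0 x + 2 * (x * radial 3 1 x)) ^+ 2.
suff key : forall x, 0 <= x -> is_derive x 1 f 0 /\ (0 : R) <= 0.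
  have := @derive_le0_le f (fun=> 0) t t0 key.
  by rewrite /f radial00 !mul0r mulr0 addr0 expr1n add0r.
move=> x x0; have d m := radial_derive (n := 3) m x isT; split => //.
have -> : f = (id * (radial 3 0 * radial 3 0) +
   (radial 3 0 + 2 *: (id * radial 3 1)) * (radial 3 0 + 2 *: (id * radial 3 1))).
  by apply/funext => y; rewrite /f !expr2.
have ha := is_deriveD (d 0%N) (is_deriveZ 2 (is_deriveM (is_derive_id x 1) (d 1%N))).
apply: (is_derive_eq (is_deriveD
  (is_deriveM (is_derive_id x 1) (is_deriveM (d 0%N) (d 0%N))) (is_deriveM ha ha))).
rewrite !fctE /GRing.scale /= /GRing.scale /=.
have := radial_ode (n := 3) x isT.
move: (radial 3 0 x) (radial 3 1 x) (radial 3 2 x) => a b c e.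
rewrite [X in X = _](_ : _ = (a + 2 * (x * b)) * (4 * (x * c) + 2 * 3 * b + a)).
  by rewrite e mulr0.
by ring.
Qed.

(** The energies bound S and S'; then [radial_ode] and [radial_ode1] are solved for their leading
    terms. The weights r^2 and r^3 are those with which S'' and S''' enter the second and third
    derivatives of S(|y|^2). The constant 100 is merely generous. *)
Lemma radial_decay n : n = 2%N \/ n = 3%N ->
  exists2 C : R, 0 < C & forall r, 1 <= r ->
  [/\ `|radial n 1 (r ^+ 2)| <= C / r ^+ (n - 2),
      r ^+ 2 * `|radial n 2 (r ^+ 2)| <= C / r ^+ (n - 2) &
      r ^+ 3 * `|radial n 3 (r ^+ 2)| <= C / r ^+ (n - 2)].
Proof.
move=> n23; exists 100 => // r r1.
have r0 : 0 < r by exact: lt_le_trans r1.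
have n0 : (0 < n)%N by case: n23 => ->.
have o0 := radial_ode (r ^+ 2) n0; have o1 := radial_ode1 (r ^+ 2) n0.
have t0 : 0 <= r ^+ 2 by exact: sqr_ge0.
pose B := (r ^+ (n - 2))^-1.
have B0 : 0 < B by rewrite invr_gt0 exprn_gt0.
have rB : r^-1 <= B.
  by rewrite /B; case: n23 => ->; rewrite ?expr0 ?expr1 ?invr1// invf_le1.
have sq1 (x : R) : x ^+ 2 <= 1 -> `|x| <= 1.
  by rewrite -real_normK ?num_real// expr_le1.
have [h0 h1] : `|radial n 0 (r ^+ 2)| <= B /\ r * `|radial n 1 (r ^+ 2)| <= 2 * B.
  rewrite /B; case: n23 => ->.
  - have := radial2_energy t0; rewrite expr0 invr1 mulr1.
    move: (radial 2 0 _) (radial 2 1 _) => a b e.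
    have b0 : 0 <= r ^+ 2 * b ^+ 2 by rewrite mulr_ge0 ?sqr_ge0.
    have a0 : 0 <= a ^+ 2 by rewrite sqr_ge0.
    have ha : `|a| <= 1 by apply: sq1; lra.
    have : `|r * b| <= 1 by apply: sq1; rewrite exprMn; lra.
    by rewrite normrM (gtr0_norm r0); split=> //; lra.
  - have := radial3_energy t0; rewrite expr1.
    move: (radial 3 0 _) (radial 3 1 _) => a b e.
    have b0 : 0 <= (a + 2 * (r ^+ 2 * b)) ^+ 2 by rewrite sqr_ge0.
    have a0 : 0 <= r ^+ 2 * a ^+ 2 by rewrite mulr_ge0 ?sqr_ge0.
    have : `|r * a| <= 1 by apply: sq1; rewrite exprMn; lra.
    rewrite normrM (gtr0_norm r0) => ha.
    have hc : `|a + 2 * (r ^+ 2 * b)| <= 1 by apply: sq1; lra.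
    split; first by rewrite -div1r ler_pdivlMr// mulrC.
    rewrite -(ler_pM2l r0) mulrA -expr2 mulrCA divff ?gt_eqF// mulr1.
    have a1 : `|a| <= 1 by apply: le_trans ha; rewrite ler_peMl.
    have e1 : 2 * (r ^+ 2 * b) = (a + 2 * (r ^+ 2 * b)) - a by rewrite addrAC subrr add0r.
    have : `|2 * (r ^+ 2 * b)| <= 2.
      by rewrite e1 (le_trans (ler_normB _ _))//; lra.
    by rewrite normrM [X in _ * X]normrM (ger0_norm (sqr_ge0 r)) ger0_norm//; lra.
rewrite /= -!/B.
move: (radial n 0 _) (radial n 1 _) (radial n 2 _) (radial n 3 _) o0 o1 h0 h1.
move=> a b c d o0 o1 h0 h1.
have hb : `|b| <= 2 * B by apply: le_trans h1; rewrite ler_peMl.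
have n3 : n%:R <= 3 :> R by rewrite ler_nat; case: n23 => ->.
have hc : r ^+ 2 * `|c| <= 4 * B.
  have e : r ^+ 2 * c = - ((2 * n%:R * b + a) / 4) by lra.
  rewrite -(ger0_norm t0) -normrM e normrN normrM (ger0_norm (_ : 0 <= 4^-1))//.
  rewrite ler_pdivrMr// (le_trans (ler_normD _ _))// !normrM !normr_nat.
  have : n%:R * `|b| <= 3 * (2 * B) by apply: ler_pM.
  by lra.
have hrc : r * `|c| <= 4 * B.
  by apply: le_trans hc; rewrite ler_wpM2r// expr2 ler_peMl// ltW.
split; [lra|lra|].
have e : r ^+ 3 * d = - ((4 + 2 * n%:R) * (r * c) + r * b) / 4.
  rewrite exprS; have : r * (4 * (r ^+ 2 * d) + (4 + 2 * n%:R) * c + b) = 0.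
    by rewrite o1 mulr0.
  by lra.
have r30 : 0 <= r ^+ 3 by rewrite exprn_ge0// ltW.
rewrite -(ger0_norm r30) -normrM e normrM normrN (ger0_norm (_ : 0 <= 4^-1))//.
rewrite ler_pdivrMr// (le_trans (ler_normD _ _))// !normrM (gtr0_norm r0).
rewrite ger0_norm ?addr_ge0 ?mulr_ge0//.
have : (4 + 2 * n%:R) * (r * `|c|) <= 10 * (4 * B).
  by apply: ler_pM => //; rewrite ?mulr_ge0 ?addr_ge0 ?mulr_ge0 ?(ltW r0)//; lra.
by lra.
Qed.

End radial_series.

(** * Boxes and open sets for the Lebesgue measure *)

Section lebesgue_rV_boxes.
Context {R : realType}.

Definition box n (c : 'rV[R]_n) (r : R) : set 'rV[R]_n :=
  [set x | forall i, `|c ord0 i - x ord0 i| <= r].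

Lemma open_box n (U : set 'rV[R]_n) x : open U -> U x ->
  exists2 e : R, 0 < e & forall y : 'rV[R]_n, (forall i, `|x ord0 i - y ord0 i| < e) -> U y.
Proof.
rewrite openE => oU /oU /nbhs_ballP[e /= e0 xeU]; exists e => // y xy.
by apply: xeU; split => // i j; rewrite ord1; exact: xy.
Qed.

Lemma measurable_box n (c : 'rV[R]_n) r : measurable (box c r).
Proof.
rewrite (_ : box c r = \bigcap_(i in [set: 'I_n])
   ((fun x : 'rV[R]_n => x ord0 i : measurableTypeR R) @^-1` [set a | `|c ord0 i - a| <= r])).
  apply: fin_bigcap_measurable; first exact: finite_finset.
  move=> i _; rewrite -[X in measurable X]setTI; apply: measurable_fun_coord => //.
  rewrite (_ : mkset _ = `[c ord0 i - r, c ord0 i + r]%classic).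
    exact: measurable_itv.
  by apply/seteqP; split=> a /=; rewrite in_itv /= distrC ler_distl.
by apply/seteqP; split => [x h i _|x h i]; [exact: h|exact: (h i I)].
Qed.

Lemma lebesgue_rV_box n (c : 'rV[R]_n) r : 0 <= r ->
  lebesgue_rV R n (box c r) = ((2 * r) ^+ n)%:E.
Proof.
move=> r0; elim: n c => [|n ih] c /=.
  rewrite diracE mem_set//; by move=> [].
rewrite /lebesgue_rV_step /pushforward.
rewrite (_ : _ @^-1` _ = `[c ord0 ord0 - r, c ord0 ord0 + r]%classic `*`
   box (\row_i c ord0 (lift ord0 i)) r).
  rewrite product_measure1E//; last exact: measurable_box.
  rewrite ih [X in (X * _)%E](_ : _ = (2 * r)%:E); first by rewrite -EFinM exprS.
  apply: eq_trans (lebesgue_measure_itv _) _; rewrite /= lte_fin.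
  (* For r = 0 the interval is a single point and the measure formula takes its zero branch. *)
  case: ltP => h; last by rewrite (_ : 2 * r = 0)//; move: h r0; clear; lra.
  by rewrite -EFinB; congr (_%:E); ring.
apply/seteqP; split=> [[a v] h|[a v] /= [ha hv] i].
- split=> /=.
    have := h ord0; rewrite /rV_cons mxE; case: splitP => // j _.
    by rewrite mxE !ord1 mulr1n in_itv /= distrC ler_distl.
  move=> i; have := h (lift ord0 i); rewrite /rV_cons !mxE.
  case: splitP => j /= e; first by move: (ltn_ord j); rewrite -e.
  by move: e; rewrite /bump /= !add1n => -[/val_inj ->].
- rewrite /rV_cons mxE; case: splitP => j /= e.
    rewrite mxE !ord1 mulr1n (_ : i = ord0); last first.
      by apply/val_inj; apply: (eq_trans e); rewrite ord1.
    by move: ha; rewrite in_itv /= distrC ler_distl.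
  have := hv j; rewrite !mxE (_ : lift ord0 j = i)//.
  by apply/val_inj; rewrite /= /bump /= add1n e.
Qed.

(** The sigma-algebra is generated by coordinates, so open sets must be recovered from it: an open
    set is the union of the boxes with rational centre and radius 1/(k+1) that it contains,
    enumerated by [unpickle]. *)
Lemma open_measurable_rV n (U : set 'rV[R]_n) : open U -> measurable U.
Proof.
move=> oU.
pose B (p : 'rV[rat]_n * nat) : set 'rV[R]_n := box (map_mx ratr p.1) p.2.+1%:R^-1.
pose F k : set 'rV[R]_n := if unpickle k is Some p then
  (if `[< B p `<=` U >] then B p else set0) else set0.
rewrite (_ : U = \bigcup_k F k).
  apply: bigcupT_measurable => k; rewrite /F; case: (unpickle k) => // p.
  by case: ifP => // _; exact: measurable_box.
apply/seteqP; split=> x.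
- move=> Ux; have [e e0 he] := open_box oU Ux.
  (* Two radii have to fit into e: one from x to the rational centre, one from the centre to a point
     of the box. *)
  have [k ke] : exists k, k.+1%:R^-1 + k.+1%:R^-1 < e.
    exists (Num.truncn (2 / e)).
    have h : 2 / e < (Num.truncn (2 / e)).+1%:R by exact: truncnS_gt.
    have K0 : 0 < (Num.truncn (2 / e)).+1%:R :> R by [].
    have h2 : 2 * (Num.truncn (2 / e)).+1%:R^-1 < e.
      by rewrite ltr_pdivrMr// mulrC -ltr_pdivrMr.
    by move: h2; set a := _^-1; lra.
  have /choice[q hq] : forall i : 'I_n, exists q : rat, `|x ord0 i - ratr q| < k.+1%:R^-1.
    move=> i; have k0 : (0 : R) < k.+1%:R^-1 by rewrite invr_gt0.
    have /rat_in_itvoo[q] : x ord0 i - k.+1%:R^-1 < x ord0 i + k.+1%:R^-1.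
      by rewrite ltrBlDr -addrA ltrDl addr_gt0.
    by rewrite in_itv /= => hq; exists q; rewrite distrC ltr_distl.
  pose p : 'rV[rat]_n * nat := (\row_i q i, k).
  have hp y : B p y -> U y.
    move=> By; apply: he => i; rewrite (le_lt_trans (ler_distD (ratr (q i)) _ _))//.
    rewrite (lt_trans _ ke)// ltr_leD//.
    by have := By i; rewrite !mxE.
  exists (pickle p) => //; rewrite /F pickleK.
  case: asboolP => // _ i; rewrite !mxE distrC; exact: ltW.
- by move=> [k _]; rewrite /F; case: (unpickle k) => // p; case: asboolP => // + Bp; apply.
Qed.

Lemma continuous_measurable_rV n (f : 'rV[R]_n -> R) :
  continuous f -> measurable_fun setT f.
Proof.
move=> /continuousP cf; apply: (measurability _ (RGenOpens.measurableE R)).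
move=> _ [_ [a [b ->] <-]]; rewrite setTI; apply: open_measurable_rV.
exact/cf/interval_open.
Qed.

Lemma lebesgue_rV_open_gt0 n (U : set 'rV[R]_n) : open U -> U !=set0 ->
  (0 < lebesgue_rV R n U)%E.
Proof.
move=> oU [x Ux]; have [e e0 he] := open_box oU Ux.
apply: (@lt_le_trans _ _ (lebesgue_rV R n (box x (e / 2)))).
  by rewrite lebesgue_rV_box ?lte_fin ?exprn_gt0 ?mulr_gt0 ?divr_gt0// ltW// divr_gt0.
apply: le_measure; rewrite ?inE; [exact: measurable_box|exact: open_measurable_rV|].
move=> y xy; apply: he => i; apply: le_lt_trans (xy i) _.
by rewrite ltr_pdivrMr// ltr_pMr// ltr1n.
Qed.

End lebesgue_rV_boxes.

(** * Integral estimates *)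

Section integral_bounds.
Context d (T : measurableType d) (R : realType) (mu : {measure set T -> \bar R}).
Implicit Types (A : set T) (f g : T -> R).

Lemma integrable_ae_le A f g : measurable A -> measurable_fun A f ->
  measurable_fun A g -> (forall x, A x -> 0 <= g x) ->
  {ae mu, forall x, A x -> `|f x| <= g x} ->
  (\int[mu]_(x in A) (g x)%:E < +oo)%E -> mu.-integrable A (EFin \o f).
Proof.
move=> mA mf mg g0 fg goo; apply/integrableP; split; first exact/measurable_EFinP.
apply: le_lt_trans goo; apply: ae_ge0_le_integral => //.
- by apply/measurable_EFinP; exact: measurableT_comp.
- exact/measurable_EFinP.
Qed.

Lemma Rintegral_support A f : measurable A -> (forall x, ~ A x -> f x = 0) ->
  \int[mu]_x f x = \int[mu]_(x in A) f x.
Proof.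
move=> mA f0; rewrite [RHS]Rintegral_mkcond; congr (Rintegral _ _ _).
apply/funext => x; rewrite patchE; case: ifPn => // /negP xA.
by apply: f0 => Ax; apply: xA; exact: mem_set.
Qed.

Lemma integrable_cst_finite A (c : R) : measurable A -> (mu A < +oo)%E ->
  mu.-integrable A (EFin \o fun=> c).
Proof.
move=> mA Aoo; apply/integrableP; split; first exact/measurable_EFinP.
by rewrite /= integral_cst// lte_mul_pinfty.
Qed.

Lemma norm_Rintegral_le A f b : measurable A -> (mu A < +oo)%E ->
  mu.-integrable setT (EFin \o f) -> (forall x, ~ A x -> f x = 0) ->
  (forall x, A x -> `|f x| <= b) -> `|\int[mu]_x f x| <= b * fine (mu A).
Proof.
move=> mA Aoo intf f0 fb; rewrite (Rintegral_support mA f0).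
have intfA : mu.-integrable A (EFin \o f) by apply: integrableS intf.
rewrite (le_trans (le_normr_Rintegral mA intfA))// -Rintegral_cst//.
apply: le_Rintegral => //.
- by apply/integrable_norm.
- exact: integrable_cst_finite.
Qed.

(** As [f] has mean zero on [A], the constant [c] is the mean of c - f. Here the measure of [A]
    cancels. The weight [p] will be the squared scattered field, for which only a bound on the mean
    is available. *)
Lemma mean_value_le A (f p : T -> R) (c a b P : R) : measurable A ->
  (0 < mu A)%E -> (mu A < +oo)%E -> mu.-integrable A (EFin \o f) ->
  \int[mu]_(x in A) f x = 0 -> measurable_fun A p -> (forall x, 0 <= p x) ->
  0 <= a -> 0 <= b -> (\int[mu]_(x in A) (p x)%:E <= P%:E * mu A)%E ->
  {ae mu, forall x, A x -> `|c - f x| <= a + b * p x} ->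
  `|c| <= a + b * P.
Proof.
move=> mA A0 Aoo intf f0 mp p0 a0 b0 pP cf.
have Afin : mu A \is a fin_num by rewrite ge0_fin_numE// ltW.
have mf : measurable_fun A f by apply/measurable_EFinP; exact: measurable_int intf.
have m0 : 0 < fine (mu A) by rewrite fine_gt0// A0 Aoo.
have intc : mu.-integrable A (EFin \o fun=> c).
  exact: integrable_cst_finite.
have intcf : mu.-integrable A (EFin \o (fun x => c - f x)).
  by apply: eq_integrable (integrableB mA intc intf).
rewrite -(ler_pM2r m0).
have -> : `|c| * fine (mu A) = `|\int[mu]_(x in A) (c - f x)|.
  by rewrite RintegralB// f0 subr0 Rintegral_cst// normrM (gtr0_norm m0).
apply: (le_trans (le_normr_Rintegral mA intcf)).
rewrite -lee_fin fineK; last first.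
  by apply: integrable_fin_num => //; apply/integrable_norm.
apply: (@le_trans _ _ (\int[mu]_(x in A) (a%:E + b%:E * (p x)%:E))%E).
  apply: ae_ge0_le_integral => //.
  - apply/measurable_EFinP; apply: measurableT_comp => //.
    exact: measurable_funB.
  - by move=> x _; rewrite lee_fin addr_ge0// mulr_ge0.
  - apply: emeasurable_funD => //; apply: emeasurable_funM => //.
    exact/measurable_EFinP.
rewrite ge0_integralD//; last 2 first.
- by move=> x _; rewrite lee_fin mulr_ge0.
- by apply: emeasurable_funM => //; exact/measurable_EFinP.
have -> : (\int[mu]_(x in A) (b%:E * (p x)%:E) = b%:E * \int[mu]_(x in A) (p x)%:E)%E.
  apply: ge0_integralZl_EFin => // [x _|]; first by rewrite lee_fin.
  exact/measurable_EFinP.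
rewrite integral_cst// mulrDl EFinD EFinM fineK// leeD2l// -mulrA EFinM.
by rewrite lee_wpmul2l ?lee_fin// EFinM fineK.
Qed.

End integral_bounds.

Local Open Scope complex_scope.
Local Notation coord := Defs.coord.
Local Notation Re := complex.Re.
Local Notation Im := complex.Im.
Local Notation cfun R n := ('rV[R]_n -> R[i]).
Local Notation cfield R n := ('rV[R]_n -> 'rV[R[i]]_n).

(** * Complex modulus and Euclidean norms *)

Section cabs.
Context {R : realType}.
Implicit Types z w : R[i].

Lemma normcE z : `|z| = (cabs z)%:C.
Proof. by case: z. Qed.

Lemma cabs_ge0 z : 0 <= cabs z. Proof. exact: sqrtr_ge0. Qed.

Lemma cabs0 : cabs (0 : R[i]) = 0.
Proof. by rewrite /cabs /= expr0n addr0 sqrtr0. Qed.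

Lemma cabsM z w : cabs (z * w) = cabs z * cabs w.
Proof. by have := normrM z w; rewrite !normcE -rmorphM => -[]. Qed.

Lemma cabsN z : cabs (- z) = cabs z.
Proof. by have := normrN z; rewrite !normcE => -[]. Qed.

Lemma cabsD z w : cabs (z + w) <= cabs z + cabs w.
Proof. by have := ler_normD z w; rewrite !normcE -rmorphD lecR. Qed.

Lemma cabsB z w : cabs (z - w) <= cabs z + cabs w.
Proof. by have := ler_normB z w; rewrite !normcE -rmorphD lecR. Qed.

Lemma cabs_sum (I : Type) (r : seq I) (F : I -> R[i]) :
  cabs (\sum_(i <- r) F i) <= \sum_(i <- r) cabs (F i).
Proof.
elim: r => [|i r ih]; first by rewrite !big_nil cabs0.
by rewrite !big_cons (le_trans (cabsD _ _))// lerD2l.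
Qed.

Lemma cabs_real (a : R) : cabs a%:C = `|a|.
Proof. by rewrite /cabs /= expr0n addr0 sqrtr_sqr. Qed.

Lemma Re_le_cabs z : `|Re z| <= cabs z.
Proof. by rewrite -sqrtr_sqr /cabs ler_wsqrtr// lerDl sqr_ge0. Qed.

Lemma Im_le_cabs z : `|Im z| <= cabs z.
Proof. by rewrite -sqrtr_sqr /cabs ler_wsqrtr// lerDr sqr_ge0. Qed.

Lemma cabs_le_ReIm z : cabs z <= `|Re z| + `|Im z|.
Proof.
have h : 0 <= `|Re z| + `|Im z| by rewrite addr_ge0.
rewrite -(ger0_norm h) -sqrtr_sqr /cabs ler_wsqrtr//.
rewrite sqrrD !real_normK ?num_real//.
by rewrite addrAC lerDl mulrn_wge0// mulr_ge0.
Qed.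

Lemma cabs_sqr z : cabs z ^+ 2 = Re z ^+ 2 + Im z ^+ 2.
Proof. by rewrite sqr_sqrtr// addr_ge0// sqr_ge0. Qed.

End cabs.

Section euclid.
Context {R : realType} {n : nat}.
Implicit Types (x y : 'rV[R]_n) (v : 'rV[R[i]]_n).

Lemma coord_le_enorm x i : `|x ord0 i| <= enorm x.
Proof.
rewrite -sqrtr_sqr ler_wsqrtr// (bigD1 i)//= lerDl.
by apply: sumr_ge0 => j _; rewrite sqr_ge0.
Qed.

Lemma enorm_opp x : enorm (- x) = enorm x.
Proof. by congr Num.sqrt; apply: eq_bigr => i _; rewrite mxE sqrrN. Qed.

(** This squared substitute for the triangle inequality comes from 2ab <= a^2 + b^2 in each
    coordinate. Applied to two vectors of length r/2 it still gives the sharp bound r. *)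
Lemma enorm_sqrD x y : enorm (x + y) ^+ 2 <= 2 * enorm x ^+ 2 + 2 * enorm y ^+ 2.
Proof.
rewrite !enorm_sqr !mulr_sumr -big_split /= ler_sum// => i _; rewrite mxE.
have := sqr_ge0 (x ord0 i - y ord0 i); lra.
Qed.

Lemma enorm_le M x : 0 <= M -> (forall i, `|x ord0 i| <= M) ->
  enorm x <= Num.sqrt (n%:R * M ^+ 2).
Proof.
move=> M0 xM; rewrite ler_wsqrtr//.
have -> : n%:R * M ^+ 2 = \sum_(i < n) M ^+ 2 by rewrite sumr_const card_ord mulr_natl.
by apply: ler_sum => i _; rewrite -real_normK ?num_real// lerXn2r// nnegrE.
Qed.

Lemma enorm_continuous : continuous (@enorm R n).
Proof.
have -> : @enorm R n = Num.sqrt \o (fun x => \sum_i x ord0 i * x ord0 i).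
  by apply/funext => x; congr Num.sqrt; apply: eq_bigr => i _; rewrite expr2.
move=> x; apply: continuous_comp; last exact: sqrt_continuous.
exact/elementary_continuous/elementary_sqnorm.
Qed.

Lemma cnorm_ge0 v : 0 <= cnorm v. Proof. exact: sqrtr_ge0. Qed.

Lemma cnorm_sqr v : cnorm v ^+ 2 = \sum_i cabs (v ord0 i) ^+ 2.
Proof. by rewrite sqr_sqrtr//; apply: sumr_ge0 => i _; rewrite sqr_ge0. Qed.

Lemma coord_le_cnorm v i : cabs (v ord0 i) <= cnorm v.
Proof.
rewrite -[leLHS]ger0_norm ?cabs_ge0// -sqrtr_sqr ler_wsqrtr// (bigD1 i)//= lerDl.
by apply: sumr_ge0 => j _; rewrite sqr_ge0.
Qed.

Lemma cnorm_le M v : 0 <= M -> (forall i, cabs (v ord0 i) <= M) -> cnorm v <= n%:R * M.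
Proof.
move=> M0 vM; have h : 0 <= n%:R * M by rewrite mulr_ge0.
rewrite -(ger0_norm h) -sqrtr_sqr ler_wsqrtr//.
apply: (@le_trans _ _ (n%:R * M ^+ 2)).
  have -> : n%:R * M ^+ 2 = \sum_(i < n) M ^+ 2 by rewrite sumr_const card_ord mulr_natl.
  by apply: ler_sum => i _; rewrite lerXn2r ?nnegrE ?cabs_ge0.
rewrite exprMn ler_wpM2r ?sqr_ge0// -natrX ler_nat.
by case: (n) => // k; rewrite expnS expn1 leq_pmulr.
Qed.

Definition closed_ball0 (r : R) : set 'rV[R]_n := [set x | enorm x <= r].

Lemma measurable_closed_ball0 r : measurable (closed_ball0 r).
Proof.
rewrite (_ : closed_ball0 r = ~` [set x | r < enorm x]).
  apply: measurableC; apply: open_measurable_rV.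
  have -> : [set x | r < enorm x] = @enorm R n @^-1` `]r, +oo[%classic.
    by apply/seteqP; split=> x /=; rewrite in_itv /= andbT.
  by apply: open_comp => [x _|]; [exact: enorm_continuous|exact: interval_open].
by apply/seteqP; split=> x /=; [move=> /le_gtF ->|move=> /negP; rewrite -leNgt].
Qed.

Lemma lebesgue_closed_ball0 r : 0 <= r ->
  (lebesgue_rV R n (closed_ball0 r) <= ((2 * r) ^+ n)%:E)%E.
Proof.
move=> r0; rewrite -(lebesgue_rV_box (0 : 'rV[R]_n) r0); apply: le_measure; rewrite ?inE.
- exact: measurable_closed_ball0.
- exact: measurable_box.
- by move=> x xr i; rewrite mxE sub0r normrN (le_trans (coord_le_enorm _ _)).
Qed.

End euclid.

(** * Integrals of complex-valued functions *)

Section cintegral.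
Context {R : realType} {n : nat}.
Local Notation mu := (lebesgue_rV R n).
Implicit Types (f g b : cfun R n).

Definition cintegrable f := mu.-integrable setT (EFin \o (fun x => Re (f x))) /\
  mu.-integrable setT (EFin \o (fun x => Im (f x))).

Lemma cintegrableD f g : cintegrable f -> cintegrable g ->
  cintegrable (fun x => f x + g x).
Proof.
move=> [fr fi] [gr gi]; split.
- apply: eq_integrable (integrableD measurableT fr gr) => // x _ /=.
  by case: (f x) => ? ?; case: (g x).
- apply: eq_integrable (integrableD measurableT fi gi) => // x _ /=.
  by case: (f x) => ? ?; case: (g x).
Qed.

Lemma cintegralD f g : cintegrable f -> cintegrable g ->
  cintegral (fun x => f x + g x) = cintegral f + cintegral g.
Proof.
move=> [fr fi] [gr gi]; rewrite /cintegral; apply/eqP; rewrite eq_complex /=.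
rewrite -!RintegralD//; apply/andP; split; apply/eqP; congr (Rintegral _ _ _);
  by apply/funext => x; case: (f x) => ? ?; case: (g x).
Qed.

Lemma cintegrableZ (a : R) f : cintegrable f -> cintegrable (fun x => a%:C * f x).
Proof.
move=> [fr fi]; split.
- apply: eq_integrable (integrableZl measurableT a fr) => // x _ /=.
  by case: (f x) => ? ? /=; rewrite mul0r subr0.
- apply: eq_integrable (integrableZl measurableT a fi) => // x _ /=.
  by case: (f x) => ? ? /=; rewrite mul0r addr0.
Qed.

Lemma cintegralZ (a : R) f : cintegrable f ->
  cintegral (fun x => a%:C * f x) = a%:C * cintegral f.
Proof.
move=> [fr fi]; rewrite /cintegral; apply/eqP; rewrite eq_complex /=.
rewrite !mul0r subr0 addr0 -!RintegralZl//; apply/andP; split; apply/eqP;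
  congr (Rintegral _ _ _); apply/funext => x; case: (f x) => ? ? /=;
  by rewrite mul0r ?subr0 ?addr0.
Qed.

Lemma cintegrable_sum (I : Type) (r : seq I) (F : I -> cfun R n) :
  (forall i, cintegrable (F i)) -> cintegrable (fun x => \sum_(i <- r) F i x).
Proof.
move=> iF; elim: r => [|i r ih].
  have -> : (fun x => \sum_(i <- [::]) F i x) = fun=> 0.
    by apply/funext => x; rewrite big_nil.
  by split; exact: integrable0.
have -> : (fun x => \sum_(j <- i :: r) F j x) = fun x => F i x + \sum_(j <- r) F j x.
  by apply/funext => x; rewrite big_cons.
exact: cintegrableD.
Qed.

Lemma measurable_cfunM f g : measurable_cfun f -> measurable_cfun g ->
  measurable_cfun (fun x => f x * g x).
Proof.
move=> [fr fi] [gr gi]; split.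
- apply: (eq_measurable_fun (fun x => Re (f x) * Re (g x) - Im (f x) * Im (g x))).
    by move=> x _; case: (f x) => ? ?; case: (g x).
  by apply: measurable_funB; apply: measurable_funM.
- apply: (eq_measurable_fun (fun x => Re (f x) * Im (g x) + Im (f x) * Re (g x))).
    by move=> x _; case: (f x) => ? ?; case: (g x).
  by apply: measurable_funD; apply: measurable_funM.
Qed.

Lemma measurable_cfunB f g : measurable_cfun f -> measurable_cfun g ->
  measurable_cfun (fun x => f x - g x).
Proof.
move=> [fr fi] [gr gi]; split.
- apply: (eq_measurable_fun (fun x => Re (f x) - Re (g x))).
    by move=> x _; case: (f x) => ? ?; case: (g x).
  exact: measurable_funB.
- apply: (eq_measurable_fun (fun x => Im (f x) - Im (g x))).
    by move=> x _; case: (f x) => ? ?; case: (g x).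
  exact: measurable_funB.
Qed.

Lemma measurable_cfun_real (h : 'rV[R]_n -> R) : continuous h ->
  measurable_cfun (fun x => (h x)%:C).
Proof.
by move=> ch; split; [exact: continuous_measurable_rV|exact: measurable_cst].
Qed.

Lemma measurable_cabs_sqr f : measurable_cfun f ->
  measurable_fun setT (fun x => cabs (f x) ^+ 2).
Proof.
move=> [fr fi]; apply: (eq_measurable_fun (fun x => Re (f x) ^+ 2 + Im (f x) ^+ 2)).
  by move=> x _; rewrite cabs_sqr.
by apply: measurable_funD; apply: measurable_funX.
Qed.

Lemma lebesgue_closed_ball0_lty r : (mu (@closed_ball0 R n r) < +oo)%E.
Proof.
have [r0|r0] := leP 0 r; first exact: le_lt_trans (lebesgue_closed_ball0 _) (ltry _).
rewrite (_ : closed_ball0 r = set0) ?measure0//.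
apply/seteqP; split=> // x /= xr; have := enorm_ge0 x.
by rewrite leNgt (le_lt_trans xr r0).
Qed.

(** The inequality |f| <= 1 + |f|^2 turns local square integrability into integrability on the ball
    outside which [b] vanishes. *)
Lemma cintegrable_L2loc (f b : cfun R n) (M r : R) : L2loc f -> measurable_cfun b ->
  0 <= M -> {ae mu, forall x, cabs (b x) <= M} ->
  (forall x, r < enorm x -> b x = 0) -> cintegrable (fun x => b x * f x).
Proof.
move=> [mf f2] mb M0 bM b0.
have mB := @measurable_closed_ball0 R n r.
have [mr mi] := measurable_cfunM mb mf; have mc := measurable_cabs_sqr mf.
have mg : measurable_fun setT (fun x => M * (1 + cabs (f x) ^+ 2)).
  apply: measurable_funM => //; exact: measurable_funD.
have key (h : R[i] -> R) : measurable_fun setT (fun x => h (b x * f x)) ->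
    h 0 = 0 -> (forall z, `|h z| <= cabs z) ->
    mu.-integrable setT (EFin \o (fun x => h (b x * f x))).
  move=> mh h0 hle.
  have -> : EFin \o (fun x => h (b x * f x)) =
      (EFin \o (fun x => h (b x * f x))) \_ (@closed_ball0 R n r).
    apply/funext => x; rewrite patchE; case: ifPn => // /negP xB.
    rewrite /= b0 ?mul0r ?h0// ltNge; apply/negP => xr; apply: xB; exact: mem_set.
  apply/(integrable_mkcond _ mB).
  apply: (integrable_ae_le mB (measurable_funTS mh) (measurable_funTS mg)).
  - by move=> x _; rewrite mulr_ge0// addr_ge0// sqr_ge0.
  - apply: filterS bM => x bx _; rewrite (le_trans (hle _))// cabsM.
    apply: ler_pM; rewrite ?cabs_ge0//.
    have := sqr_ge0 (cabs (f x) - 1); have := cabs_ge0 (f x); move: (cabs (f x)) => c.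
    nra.
  - rewrite (_ : \int[mu]_(x in _) _ = M%:E * \int[mu]_(x in @closed_ball0 R n r)
        (1%:E + (cabs (f x) ^+ 2)%:E))%E; last first.
      rewrite -ge0_integralZl_EFin//.
      + by move=> x _; rewrite -EFinD lee_fin addr_ge0// sqr_ge0.
      + apply: emeasurable_funD => //; apply/measurable_EFinP.
        exact: measurable_funTS mc.
    rewrite ge0_integralD//; last 2 first.
    + by move=> x _; rewrite lee_fin sqr_ge0.
    + by apply/measurable_EFinP; exact: measurable_funTS mc.
    rewrite lte_mul_pinfty ?lee_fin// lte_add_pinfty//; last exact: f2.
    by rewrite integral_cst// mul1e lebesgue_closed_ball0_lty.
split; apply: key => //; [exact: Re_le_cabs|exact: Im_le_cabs].
Qed.

End cintegral.

(** * Essential supremum and mean-square norms *)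

Section norms.
Context {R : realType} {n : nat}.
Local Notation mu := (lebesgue_rV R n).
Implicit Types (A : set 'rV[R]_n) (h : 'rV[R]_n -> R) (u v : cfield R n).

Lemma lebesgue_rV_setT_gt0 : (0 < mu setT)%E.
Proof. by apply: lebesgue_rV_open_gt0; [exact: openT|exists 0]. Qed.

Lemma Linf_norm_ge0 A h : (0 <= Linf_norm A h)%E.
Proof. exact: Lnorm_ge0. Qed.

Lemma ae_le_Linf A h : (Linf_norm A h < +oo)%E ->
  {ae mu, forall x, A x -> `|h x| <= fine (Linf_norm A h)}.
Proof.
move=> hoo; have fin : Linf_norm A h \is a fin_num by rewrite ge0_fin_numE ?Linf_norm_ge0.
have : \forall x \ae mu,
    (`| (EFin \o h \_ A) x | <= Linf_norm A h)%E.
  (* The norm of exponent +oo is defined by cases on whether the whole space has positive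
     measure. *)
  rewrite /Linf_norm unlock lebesgue_rV_setT_gt0.
  have -> : EFin \o h \_ A = (fun x => (h x)%:E) \_ A.
    by apply/funext => x; rewrite /= !patchE; case: ifP.
  exact: (ess_sup_ge mu (abse \o _)).
apply: filterS => x + Ax.
by rewrite /= patchE mem_set// -[X in (_ <= X)%E](fineK fin) lee_fin.
Qed.

Lemma measurable_cnorm_sqr u : (forall i, measurable_cfun (coord u i)) ->
  measurable_fun setT (fun x => cnorm (u x) ^+ 2).
Proof.
move=> mu_; apply: (eq_measurable_fun (fun x => \sum_i cabs (u x ord0 i) ^+ 2)).
  by move=> x _; rewrite cnorm_sqr.
by apply: measurable_sum => i; exact: (measurable_cabs_sqr (mu_ i)).
Qed.

Lemma L2_norm_sqr A u :
  ((L2_norm A u) `^ 2 = \int[mu]_(x in A) (cnorm (u x) ^+ 2)%:E)%E.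
Proof.
rewrite /L2_norm powR_Lnorm// [RHS]integral_mkcond; apply: eq_integral => x _.
rewrite !patchE; case: ifPn => _; last first.
  by rewrite /point /=  normr0 powR0.
by rewrite gee0_abs ?lee_fin ?cnorm_ge0// poweR_EFin powR_mulrn ?cnorm_ge0.
Qed.

(** Puts the stability estimate into the form that [mean_value_le] expects: an essential bound on
    the incident field becomes a mean-square bound with the measure of [A] as a factor. *)
Lemma L2_norm_le_sqr A u v (c M : R) : measurable A -> (0 <= c)%R -> (0 <= M)%R ->
  measurable_fun A (fun x => cnorm (v x) ^+ 2) ->
  (L2_norm A u <= c%:E * L2_norm A v)%E ->
  {ae mu, forall x, A x -> cnorm (v x) <= M} ->
  (\int[mu]_(x in A) (cnorm (u x) ^+ 2)%:E <= ((c * M) ^+ 2)%:E * mu A)%E.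
Proof.
move=> mA c0 M0 mv uv vM; rewrite -L2_norm_sqr.
have L0 w : (0 <= L2_norm A w)%E by exact: Lnorm_ge0.
apply: (@le_trans _ _ ((c%:E * L2_norm A v) `^ 2)%E).
  by apply: gt0_ler_poweR => //; rewrite in_itv /= ?leey ?L0 ?mule_ge0 ?L0 ?lee_fin.
rewrite poweRM ?lee_fin// L2_norm_sqr poweR_EFin powR_mulrn// exprMn (EFinM (c ^+ 2)) -muleA.
rewrite lee_wpmul2l ?lee_fin ?sqr_ge0//.
apply: (@le_trans _ _ (\int[mu]_(x in A) (M ^+ 2)%:E)%E); last by rewrite integral_cst.
apply: ae_ge0_le_integral => //.
- by move=> x _; rewrite lee_fin sqr_ge0.
- exact/measurable_EFinP.
- by move=> x _; rewrite lee_fin sqr_ge0.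
- by apply: filterS vM => x + Ax => /(_ Ax) ?; rewrite lee_fin lerXn2r// nnegrE cnorm_ge0.
Qed.

End norms.

(** * Navier operator on real fields *)

Section real_fields.
Context {R : realType} {n : nat}.
Implicit Types (f chi : 'rV[R]_n -> R) (F : 'I_n -> 'rV[R]_n -> R).

Lemma elementary_smooth f (U : set 'rV[R]_n) : elementary f ->
  smooth_on U (fun x => (f x)%:C).
Proof.
move=> + k; elim: k f => [|k ih] f ef /=.
  move=> x _; split; first exact: elementary_continuous.
  exact: cst_continuous.
move=> i; split.
  by move=> x _; split; [exact: elementary_derivable|exact: derivable_cst].
by rewrite partial_real; exact/ih/elementary_pd.
Qed.

Definition real_field F : cfield R n := fun x => \row_j (F j x)%:C.

Lemma coord_real_field F j : coord (real_field F) j = (fun x => (F j x)%:C).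
Proof. by apply/funext => x; rewrite /coord /Defs.coord mxE. Qed.

Definition rnavier (lambda mu : R) F (j : 'I_n) (x : 'rV[R]_n) : R :=
  mu * \sum_i pd i (pd i (F j)) x +
  (lambda + mu) * pd j (fun y => \sum_i pd i (F i) y) x.

Lemma real_complex_sum (I : Type) (r : seq I) (G : I -> R) :
  (\sum_(i <- r) (G i)%:C) = (\sum_(i <- r) G i)%:C :> R[i].
Proof. by rewrite rmorph_sum. Qed.

Lemma navier_real_field lambda mu F :
  navier lambda mu (real_field F) = real_field (rnavier lambda mu F).
Proof.
apply/funext => x; apply/rowP => j; rewrite /navier !mxE.
have -> : divergence (real_field F) = fun y => (\sum_i pd i (F i) y)%:C.
  apply/funext => y; rewrite /divergence -real_complex_sum.
  by apply: eq_bigr => i _; rewrite coord_real_field partial_real.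
rewrite coord_real_field partial_real /laplacian.
under eq_bigr do rewrite !partial_real.
by rewrite real_complex_sum -!rmorphM -rmorphD.
Qed.

(* The terms of [rnavier (chi F) - chi (rnavier F)]: each of them contains a
   derivative of chi. *)
Definition commutator (lambda mu : R) chi F (j : 'I_n) (x : 'rV[R]_n) : R :=
  mu * \sum_i (pd i (pd i chi) x * F j x + 2 * (pd i chi x * pd i (F j) x)) +
  (lambda + mu) * \sum_i (pd j (pd i chi) x * F i x + pd i chi x * pd j (F i) x +
    pd j chi x * pd i (F i) x).

Lemma rnavierM lambda mu chi F (j : 'I_n) x :
  elementary chi -> (forall i, elementary (F i)) ->
  rnavier lambda mu (fun i y => chi y * F i y) j x =
  chi x * rnavier lambda mu F j x + commutator lambda mu chi F j x.
Proof.
move=> ec eF; rewrite /rnavier /commutator.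
have ep i := elementary_pd i ec; have epF i k := elementary_pd i (eF k).
have e1 i k : elementary (fun y => chi y * pd i (F k) y) by exact: elementaryM.
have e2 i k : elementary (fun y => F k y * pd i chi y) by exact: elementaryM.
have -> : (fun y => \sum_i pd i (fun y => chi y * F i y) y) =
    (fun y => \sum_i (chi y * pd i (F i) y + F i y * pd i chi y)).
  by apply/funext => y; apply: eq_bigr => i _; rewrite (pdM i ec (eF i)).
rewrite (pd_sum j (index_enum _) (fun i => epF i i)).
rewrite (pd_sum j (index_enum _) (fun i => elementaryD (e1 i i) (e2 i i))).
have S1 i : pd i (pd i (fun y => chi y * F j y)) x = chi x * pd i (pd i (F j)) x +
    (pd i (pd i chi) x * F j x + 2 * (pd i chi x * pd i (F j) x)).
  rewrite (pdM i ec (eF j)) (pdD i (e1 i j) (e2 i j)).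
  rewrite (pdM i ec (epF i j)) (pdM i (eF j) (ep i)).
  move: (pd i (pd i (F j)) x) (pd i (pd i chi) x) => a b.
  by move: (chi x) (F j x) (pd i (F j) x) (pd i chi x) => *; ring.
have S2 i : pd j (fun y => chi y * pd i (F i) y + F i y * pd i chi y) x =
    chi x * pd j (pd i (F i)) x + (pd j (pd i chi) x * F i x +
      pd i chi x * pd j (F i) x + pd j chi x * pd i (F i) x).
  rewrite (pdD j (e1 i i) (e2 i i)) (pdM j ec (epF i i)) (pdM j (eF i) (ep i)).
  move: (pd j (pd i (F i)) x) (pd j (pd i chi) x) => a b.
  by move: (chi x) (F i x) (pd j (F i) x) (pd i (F i) x) (pd i chi x) (pd j chi x) => *; ring.
have alg (a b c T1 T2 U1 U2 : R) :
  c * (a * T1 + b * T2) + (a * U1 + b * U2) = a * (c * T1 + U1) + b * (c * T2 + U2).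
  by ring.
rewrite alg; congr (_ * _ + _ * _);
  rewrite mulr_sumr -big_split /=; apply: eq_bigr => i _; [exact: S1|exact: S2].
Qed.

(** Each summand of either sum consists of three products of a derivative of chi with F or a first
    derivative of F, the cross term of the Laplacian counting twice. *)
Lemma commutator_bound lambda mu chi F j x (a b : R) :
  0 <= b ->
  (forall i, `|pd i chi x| <= a) -> (forall i k, `|pd i (pd k chi) x| <= a) ->
  (forall i, `|F i x| <= b) -> (forall i k, `|pd i (F k) x| <= b) ->
  `|commutator lambda mu chi F j x| <=
    (`|mu| + `|lambda + mu|) * (n%:R * (3 * (a * b))).
Proof.
move=> b0 c1 c2 F1 F2; rewrite /commutator.
have ab u v : `|u| <= a -> `|v| <= b -> `|u * v| <= a * b.
  by move=> ua vb; rewrite normrM ler_pM.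
have sum_le (G : 'I_n -> R) : (forall i, `|G i| <= 3 * (a * b)) ->
    `|\sum_i G i| <= n%:R * (3 * (a * b)).
  move=> Gb; rewrite (le_trans (ler_norm_sum _ _ _))//.
  have -> : n%:R * (3 * (a * b)) = \sum_(i < n) (3 * (a * b)).
    by rewrite sumr_const card_ord mulr_natl.
  exact: ler_sum.
rewrite (le_trans (ler_normD _ _))// [leRHS]mulrDl lerD// normrM ler_wpM2l// sum_le// => i.
- have h1 := ab _ _ (c2 i i) (F1 j); have h2 := ab _ _ (c1 i) (F2 i j).
  rewrite (le_trans (ler_normD _ _))// [X in _ + X]normrM normr_nat; lra.
- have h1 := ab _ _ (c2 j i) (F1 i); have h2 := ab _ _ (c1 i) (F2 j i).
  have h3 := ab _ _ (c1 j) (F2 i i).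
  rewrite (le_trans (ler_normD _ _))//.
  have := ler_normD (pd j (pd i chi) x * F i x) (pd i chi x * pd j (F i) x).
  lra.
Qed.

End real_fields.

(** * Cutoffs at radius N and the support of the commutator *)

Section scaled_cutoff.
Context {R : realType} {n : nat}.
Implicit Types (x : 'rV[R]_n) (f : 'rV[R]_n -> R).

Lemma enormZ (a : R) x : enorm (a *: x) = `|a| * enorm x.
Proof.
rewrite -sqrtr_sqr -sqrtrM ?sqr_ge0//; congr Num.sqrt; rewrite mulr_sumr.
by apply: eq_bigr => i _; rewrite mxE exprMn.
Qed.

Lemma compact_support_bounded f (r : R) : continuous f ->
  (forall x, r < enorm x -> f x = 0) -> exists2 A, 0 <= A & forall x, `|f x| <= A.
Proof.
move=> cf f0.
have cK : compact [set x : 'rV[R]_n | forall i, `[- r, r]%classic (x ord0 i)].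
  by apply: (@rV_compact _ _ (fun=> `[- r, r]%classic)) => _; exact: segment_compact.
have [r0|r0] := ltP r 0.
  by exists 0 => // x; rewrite f0 ?normr0// (lt_le_trans r0)// enorm_ge0.
have [||c _ cmax] := @EVT_max_rV R n (fun x => `|f x|) _ _ cK.
- by exists 0 => i /=; rewrite mxE in_itv /= oppr_le0 r0.
- apply: continuous_subspaceT => x; apply: continuous_comp; first exact: cf.
  exact: norm_continuous.
exists `|f c| => // x; have [xr|xr] := leP (enorm x) r; last first.
  by rewrite f0// normr0.
apply: cmax; rewrite inE => i /=; rewrite in_itv /= -ler_norml.
exact: le_trans (coord_le_enorm _ _) xr.
Qed.

Lemma open_enorm_lt (N : R) : open [set x : 'rV[R]_n | enorm x < N].
Proof.
have -> : [set x | enorm x < N] = @enorm R n @^-1` `]-oo, N[%classic.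
  by apply/seteqP; split=> x /=; rewrite in_itv.
by apply: open_comp => [x _|]; [exact: enorm_continuous|exact: interval_open].
Qed.

Lemma open_enorm_gt (N : R) : open [set x : 'rV[R]_n | N < enorm x].
Proof.
have -> : [set x | N < enorm x] = @enorm R n @^-1` `]N, +oo[%classic.
  by apply/seteqP; split=> x /=; rewrite in_itv /= andbT.
by apply: open_comp => [x _|]; [exact: enorm_continuous|exact: interval_open].
Qed.

Lemma cutoff_derivatives_bounded : exists2 A : R, 0 <= A & forall x (i k : 'I_n),
  `|pd i (@cutoff R n) x| <= A /\ `|pd i (pd k (@cutoff R n)) x| <= A.
Proof.
have ec := @elementary_cutoff R n.
have o2 := @open_enorm_gt 2.
have c0 x : 2 < enorm x -> cutoff x = 0 by move=> /ltW; exact: cutoff_out.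
have p0 i x : 2 < enorm x -> pd i (@cutoff R n) x = 0 by exact: pd_local o2 c0 x.
have pp0 i k x : 2 < enorm x -> pd i (pd k (@cutoff R n)) x = 0.
  exact: pd_local o2 (p0 k) x.
have h (ik : 'I_n * 'I_n) : exists A : R, 0 <= A /\ forall x,
   `|pd ik.1 (@cutoff R n) x| <= A /\ `|pd ik.1 (pd ik.2 (@cutoff R n)) x| <= A.
  have [A A0 hA] := compact_support_bounded
    (elementary_continuous (elementary_pd ik.1 ec)) (p0 ik.1).
  have [B B0 hB] := compact_support_bounded
    (elementary_continuous (elementary_pd ik.1 (elementary_pd ik.2 ec))) (pp0 ik.1 ik.2).
  exists (A + B); split; first exact: addr_ge0.
  by move=> x; rewrite (le_trans (hA x)) ?lerDl// (le_trans (hB x)) ?lerDr.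
have [A hA] := choice h.
exists (\sum_ik A ik); first by apply: sumr_ge0 => ik _; have [] := hA ik.
have leA ik : A ik <= \sum_ik A ik.
  rewrite (bigD1 ik)//= lerDl; apply: sumr_ge0 => jk _; by have [] := hA jk.
by move=> x i k; have [_ /(_ x)[h1 h2]] := hA (i, k); split; apply: le_trans (leA (i, k)).
Qed.

(** The shift by 0 gives the exact shape of [elementary_affine] and [pd_affine]. *)
Definition cutoff_at (N : R) x : R := cutoff (N^-1 *: (x - 0)).

Lemma elementary_cutoff_at N : elementary (cutoff_at N).
Proof. exact/elementary_affine/elementary_cutoff. Qed.

Lemma enorm_scale N x : 0 < N -> enorm (N^-1 *: (x - 0)) = enorm x / N.
Proof. by move=> N0; rewrite enormZ subr0 ger0_norm ?invr_ge0 ?(ltW N0)// mulrC. Qed.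

Lemma cutoff_at_in N x : 0 < N -> enorm x <= N -> cutoff_at N x = 1.
Proof.
by move=> N0 xN; rewrite /cutoff_at cutoff_in// enorm_scale// ler_pdivrMr// mul1r.
Qed.

Lemma cutoff_at_out N x : 0 < N -> 2 * N <= enorm x -> cutoff_at N x = 0.
Proof.
by move=> N0 xN; rewrite /cutoff_at cutoff_out// enorm_scale// ler_pdivlMr.
Qed.

Lemma pd_cutoff_at N i : pd i (cutoff_at N) =
  fun x => N^-1 * pd i (@cutoff R n) (N^-1 *: (x - 0)).
Proof. exact/pd_affine/elementary_cutoff. Qed.

Lemma pd2_cutoff_at N i k : pd i (pd k (cutoff_at N)) =
  fun x => N^-1 * (N^-1 * pd i (pd k (@cutoff R n)) (N^-1 *: (x - 0))).
Proof.
have ek := elementary_pd k (@elementary_cutoff R n).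
rewrite pd_cutoff_at (pdZ i N^-1 (elementary_affine N^-1 0 ek)).
by rewrite (pd_affine i N^-1 0 ek).
Qed.

(** Scaling gives 1/N for first and 1/N^2 for second derivatives; N >= 1 allows the common bound. *)
Lemma cutoff_at_derivatives_bounded : exists2 A : R, 0 <= A &
  forall N x (i k : 'I_n), 1 <= N ->
  `|pd i (cutoff_at N) x| <= A / N /\ `|pd i (pd k (cutoff_at N)) x| <= A / N.
Proof.
have [A A0 hA] := cutoff_derivatives_bounded; exists A => // N x i k N1.
have N0 : 0 < N by exact: lt_le_trans N1.
have [h1 h2] := hA (N^-1 *: (x - 0)) i k.
have nN : `|N^-1| = N^-1 by rewrite ger0_norm// invr_ge0 ltW.
rewrite pd_cutoff_at pd2_cutoff_at !normrM nN [A / N]mulrC; split.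
  by rewrite ler_wpM2l// invr_ge0 ltW.
rewrite ler_wpM2l ?invr_ge0 ?(ltW N0)// (le_trans _ h2)//.
by rewrite ler_piMl// invf_le1.
Qed.

(** Strict inequalities provide an open neighbourhood on which the cutoff is constant, so its
    derivatives vanish at the point itself. *)
Lemma commutator_cutoff0 lambda mu F (j : 'I_n) N x : 0 < N ->
  enorm x < N \/ 2 * N < enorm x -> commutator lambda mu (cutoff_at N) F j x = 0.
Proof.
move=> N0 xN.
suff [h1 h2] : (forall i, pd i (cutoff_at N) x = 0) /\
    (forall i k, pd i (pd k (cutoff_at N)) x = 0).
  rewrite /commutator !big1 ?mulr0 ?addr0// => i _; rewrite !h1 h2; ring.
have key (U : set 'rV[R]_n) c : open U -> U x -> (forall y, U y -> cutoff_at N y = c) ->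
    (forall i, pd i (cutoff_at N) x = 0) /\
    (forall i k, pd i (pd k (cutoff_at N)) x = 0).
  move=> oU Ux Uc; split=> [i|i k]; first exact: pd_local oU Uc x Ux.
  have h0 y : U y -> pd k (cutoff_at N) y = 0 by exact: pd_local oU Uc y.
  exact: pd_local oU h0 x Ux.
case: xN => xN.
- by apply: (key _ 1 (@open_enorm_lt N)) => // y /ltW; exact: cutoff_at_in.
- by apply: (key _ 0 (@open_enorm_gt (2 * N))) => // y /ltW; exact: cutoff_at_out.
Qed.

End scaled_cutoff.

(** * Bounds for the limit of large cutoff radius *)

Section orthogonality.
Context {R : realType} {n : nat}.
Local Notation mu := (lebesgue_rV R n).
Implicit Types (F h : 'I_n -> 'rV[R]_n -> R) (f : cfield R n) (V : cfun R n).

Lemma cdot_real_field f h x :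
  cdot (f x) (real_field h x) = \sum_j (h j x)%:C * f x ord0 j.
Proof. by apply: eq_bigr => j _; rewrite mxE mulrC. Qed.

Lemma cintegrable_cdot f h (r : R) : (forall j, L2loc (coord f j)) ->
  (forall j, continuous (h j)) -> (forall j x, r < enorm x -> h j x = 0) ->
  cintegrable (fun x => cdot (f x) (real_field h x)).
Proof.
move=> f2 ch h0.
have -> : (fun x => cdot (f x) (real_field h x)) =
    fun x => \sum_j (h j x)%:C * coord f j x.
  by apply/funext => x; rewrite cdot_real_field.
apply: cintegrable_sum => j.
have [A A0 hA] := compact_support_bounded (ch j) (h0 j).
apply: (cintegrable_L2loc (M := A) (r := r) (f2 j)) => //.
- exact: measurable_cfun_real.
- by apply: nearW => x; rewrite cabs_real.
- by move=> x /(h0 j) ->.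
Qed.

Lemma norm_cintegral_le b (r : R) (g : cfun R n) : 0 <= r -> cintegrable g ->
  (forall x, r < enorm x -> g x = 0) -> (forall x, cabs (g x) <= b) ->
  cabs (cintegral g) <= 2 * (b * (2 * r) ^+ n).
Proof.
move=> r0 [gr gi] g0 gb.
have b0 : 0 <= b by apply: le_trans (gb 0); exact: cabs_ge0.
have mB := @measurable_closed_ball0 R n r.
have Boo := @lebesgue_closed_ball0_lty R n r.
have Ble : fine (mu (@closed_ball0 R n r)) <= (2 * r) ^+ n.
  rewrite -lee_fin fineK; first exact: lebesgue_closed_ball0.
  by rewrite ge0_fin_numE.
have out x : ~ @closed_ball0 R n r x -> g x = 0.
  by move=> /negP; rewrite /closed_ball0 /= -ltNge; exact: g0.
have key (p : R[i] -> R) : p 0 = 0 -> (forall z, `|p z| <= cabs z) ->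
    mu.-integrable setT (EFin \o (fun x => p (g x))) ->
    `|\int[mu]_x p (g x)| <= b * (2 * r) ^+ n.
  move=> p0 pc ig; apply: (@le_trans _ _ (b * fine (mu (@closed_ball0 R n r)))).
    apply: norm_Rintegral_le => // x; first by move=> /out ->.
    by move=> _; exact: le_trans (pc _) (gb x).
  by rewrite ler_wpM2l.
rewrite (le_trans (cabs_le_ReIm _))// mulr_natl mulr2n lerD//.
- by apply: key => //; exact: Re_le_cabs.
- by apply: key => //; exact: Im_le_cabs.
Qed.

Lemma eq0_of_le_div_sqrt (a C N0 : R) :
  (forall N, N0 <= N -> 1 <= N -> `|a| <= C / Num.sqrt N) -> a = 0.
Proof.
move=> h; apply/eqP; rewrite -normr_eq0 eq_le normr_ge0 andbT leNgt.
apply/negP => a0.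
(* The hypothesis is tested at N = s^2, whose root is s; the last entry makes C / s smaller than
   |a|. *)
pose s := Num.max 1 (Num.max N0 ((`|C| + 1) / `|a|)).
have s1 : 1 <= s by rewrite le_max lexx.
have sN : N0 <= s by rewrite /s !le_max lexx orbT.
have sC : (`|C| + 1) / `|a| <= s by rewrite /s !le_max lexx !orbT.
have ss : s <= s ^+ 2 by rewrite expr2 ler_peMl// (le_trans _ s1).
have := h (s ^+ 2) (le_trans sN ss) (le_trans s1 ss).
rewrite sqrtr_sqr (@ger0_norm _ s) ?(le_trans _ s1)//.
rewrite ler_pdivlMr ?(lt_le_trans _ s1)// leNgt => /negP; apply.
move: sC; rewrite ler_pdivrMr// mulrC; apply: lt_le_trans.
by rewrite (le_lt_trans (ler_norm C))// ltrDl.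
Qed.

(** For n >= 2 the exponent (n+1)/2 is at least 3/2, which treats both dimensions at once. *)
Lemma powR_decay_le (N a : R) : n = 2%N \/ n = 3%N -> 1 <= N -> N <= a ->
  a `^ (- ((n%:R + 1) / 2)) <= N^-1 / Num.sqrt N.
Proof.
move=> n23 N1 Na; have a1 : 1 <= a by exact: le_trans Na.
have N0 : 0 < N by exact: lt_le_trans N1.
have a0 : 0 < a by exact: lt_le_trans Na.
have n2 : 2 <= n%:R :> R by rewrite ler_nat; case: n23 => ->.
apply: (@le_trans _ _ (a `^ (- (1 + 2^-1)))).
  by apply: ler_powR => //; lra.
rewrite powRN powRD; last by rewrite (gt_eqF a0) implybT.
rewrite powRr1 ?(ltW a0)// powR12_sqrt ?(ltW a0)// -invfM.
rewrite lef_pV2 ?posrE ?mulr_gt0 ?sqrtr_gt0//.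
by apply: ler_pM => //; rewrite ?sqrtr_ge0 ?(ltW N0)// ler_wsqrtr.
Qed.

End orthogonality.

(** * Orthogonality to entire solutions *)

Section orthogonality.
Context {R : realType} {n : nat}.
Implicit Types (F h : 'I_n -> 'rV[R]_n -> R) (f : cfield R n) (V : cfun R n).

Lemma medium_ae_bound Om V : medium Om V ->
  {ae lebesgue_rV R n, forall x,
    cabs (V x) <= fine (Linf_norm setT (fun x => cabs (V x)))}.
Proof.
move=> [_ Voo _]; apply: filterS (ae_le_Linf Voo) => x /(_ I).
by rewrite ger0_norm// cabs_ge0.
Qed.

(** An elementary [F] may grow, but [V] vanishes off a ball; inserting a cutoff equal to 1 on that
    ball changes nothing and makes the factor of [f] bounded with bounded support. *)
Lemma cintegrable_medium Om V f F (r : R) : medium Om V ->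
  (forall x, Om x -> enorm x <= r) -> (forall j, L2loc (coord f j)) ->
  (forall j, elementary (F j)) ->
  cintegrable (fun x => V x * cdot (f x) (real_field F x)).
Proof.
move=> mV Omr f2 eF; have [VM _ V0] := mV.
have -> : (fun x => V x * cdot (f x) (real_field F x)) =
    fun x => \sum_j (V x * (cutoff_at (Num.max r 1) x * F j x)%:C) * coord f j x.
  apply/funext => x; rewrite cdot_real_field mulr_sumr; apply: eq_bigr => j _.
  have [xO|xO] := pselect (Om x); last by rewrite V0// !mul0r.
  rewrite cutoff_at_in ?mul1r ?mulrA//; first by rewrite lt_max ltr01 orbT.
  by rewrite le_max Omr.
have N0 : 0 < Num.max r 1 by rewrite lt_max ltr01 orbT.
apply: cintegrable_sum => j.
have eh : elementary (fun x => cutoff_at (Num.max r 1) x * F j x).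
  by apply: elementaryM => //; exact: elementary_cutoff_at.
have h0 x : 2 * Num.max r 1 < enorm x -> cutoff_at (Num.max r 1) x * F j x = 0.
  by move=> xN; rewrite cutoff_at_out ?mul0r// ltW.
have [A A0 hA] := compact_support_bounded (elementary_continuous eh) h0.
pose m := fine (Linf_norm setT (fun x => cabs (V x))).
have m0 : 0 <= m by rewrite fine_ge0// Linf_norm_ge0.
apply: (cintegrable_L2loc (M := m * A) (r := 2 * Num.max r 1) (f2 j)).
- apply: measurable_cfunM => //; apply: measurable_cfun_real.
  exact: elementary_continuous.
- exact: mulr_ge0.
- apply: filterS (medium_ae_bound mV) => x Vx.
  by rewrite cabsM cabs_real ler_pM// cabs_ge0.
- by move=> x /h0 ->; rewrite mulr0.
Qed.

(* Testing both equations with [cutoff_at N] times [F] leaves only commutator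
   terms, supported where N <= |x| <= 2 N; the decay of the field [f - g] and of
   [F] makes their total contribution at most a multiple of N^(-1/2). *)
Lemma orthogonality (lambda mu omega K r1 B r2 r0 : R) Om V (ui ut : cfield R n) F :
  n = 2%N \/ n = 3%N -> 0 < omega -> medium Om V ->
  (forall x, Om x -> enorm x <= r0) ->
  (forall j, L2loc (coord ui j)) -> (forall j, L2loc (coord ut j)) ->
  navier_solution lambda mu omega (fun=> 1) ui ->
  navier_solution lambda mu omega (fun x => 1 + V x) ut ->
  (forall x, r1 < enorm x ->
    cnorm (ut x - ui x) <= K * enorm x `^ (- ((n%:R + 1) / 2))) ->
  (forall j, elementary (F j)) ->
  (forall j x, rnavier lambda mu F j x = - omega ^+ 2 * F j x) ->
  (forall x, r2 <= enorm x -> forall i k, `|F k x| <= B / enorm x ^+ (n - 2) /\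
    `|pd i (F k) x| <= B / enorm x ^+ (n - 2)) ->
  cintegral (fun x => V x * cdot (ut x) (real_field F x)) = 0.
Proof.
move=> n23 omega0 mV Omr ui2 ut2 nui nut udec eF Feq Fdec.
have [_ _ V0] := mV; have eqW (x y : R) : x = y -> x <= y by move=> ->.
set G := fun x => V x * _.
have iG : cintegrable G by exact: cintegrable_medium mV Omr ut2 eF.
have [A A0 hA] := @cutoff_at_derivatives_bounded R n.
pose comm N := commutator lambda mu (cutoff_at N) F.
pose H N := fun x => cdot (ut x - ui x) (real_field (comm N) x).
have n2 : (1 < n)%N by case: n23 => ->.
have comm_cont N j : continuous (comm N j).
  apply: elementary_continuous; have ec := @elementary_cutoff_at R n N.
  have ep i := elementary_pd i ec; have ep2 i k := elementary_pd k (ep i).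
  have eF1 i k := elementary_pd i (eF k).
  rewrite /comm /commutator; apply: elementaryD; apply: elementaryZ;
    apply: elementary_sum => i.
  - by apply: elementaryD; [exact: elementaryM|apply: elementaryZ; exact: elementaryM].
  - by apply: elementaryD; [apply: elementaryD|]; exact: elementaryM.
have comm0 N j x : 0 < N -> 2 * N < enorm x -> comm N j x = 0.
  by move=> N0 xN; apply: commutator_cutoff0 => //; right.
have eqH N : 0 < N -> r0 <= N -> (omega ^+ 2)%:C * cintegral G = - cintegral (H N).
  move=> N0 rN.
  pose chiF j x := cutoff_at N x * F j x.
  have echiF j : elementary (chiF j).
    by apply: elementaryM => //; exact: elementary_cutoff_at.
  have test j : test_fun (coord (real_field chiF) j).
    rewrite coord_real_field; split; first exact: elementary_smooth.
    exists (2 * N) => x xN; rewrite /chiF cutoff_at_out ?mul0r//; exact: ltW.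
  have navE : navier lambda mu (real_field chiF) = fun x =>
      real_field (comm N) x - (omega ^+ 2)%:C *: real_field chiF x.
    rewrite navier_real_field; apply/funext => x; apply/rowP => j; rewrite !mxE.
    rewrite rnavierM//; last exact: elementary_cutoff_at.
    rewrite Feq -rmorphM -rmorphB; congr (_ %:C); rewrite /chiF /comm; ring.
  have cdotE f x : cdot (f x) (navier lambda mu (real_field chiF) x) =
      cdot (f x) (real_field (comm N) x) -
      (omega ^+ 2)%:C * cdot (f x) (real_field chiF x).
    rewrite navE /cdot mulr_sumr -sumrB; apply: eq_bigr => j _.
    rewrite !mxE; ring.
  have icomm f : (forall j, L2loc (coord f j)) ->
      cintegrable (fun x => cdot (f x) (real_field (comm N) x)).
    move=> f2; apply: (cintegrable_cdot (r := 2 * N)) => // j x; exact: comm0.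
  have eut := nut _ test; have eui := nui _ test.
  have {}eut : cintegral (fun x => cdot (ut x) (real_field (comm N) x)) +
      (omega ^+ 2)%:C * cintegral G = 0.
    rewrite -cintegralZ// -cintegralD//; [|exact: icomm|exact: cintegrableZ].
    rewrite -eut; congr cintegral; apply/funext => x; rewrite cdotE /G.
    (* On Om the cutoff is 1 because N >= r0, and off Om the factor V is 0: the medium term does not
       depend on N. *)
    have -> : V x * cdot (ut x) (real_field F x) = V x * cdot (ut x) (real_field chiF x).
      have [xO|xO] := pselect (Om x); last by rewrite V0// !mul0r.
      congr (_ * _); rewrite !cdot_real_field; apply: eq_bigr => j _.
      by rewrite /chiF cutoff_at_in ?mul1r// (le_trans _ rN)// Omr.
    by ring.
  have {}eui : cintegral (fun x => cdot (ui x) (real_field (comm N) x)) = 0.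
    rewrite -eui; congr cintegral; apply/funext => x; rewrite cdotE; ring.
  have -> : H N = fun x => cdot (ut x) (real_field (comm N) x) +
      (-1)%:C * cdot (ui x) (real_field (comm N) x).
    apply/funext => x; rewrite /H /cdot mulr_sumr -big_split /=.
    by apply: eq_bigr => j _; rewrite !mxE rmorphN1; ring.
  rewrite cintegralD; [|exact: icomm|by apply: cintegrableZ; exact: icomm].
  rewrite cintegralZ; last exact: icomm.
  rewrite eui mulr0 addr0; apply/eqP; rewrite -addr_eq0 addrC; exact/eqP.
pose C1 := (`|mu| + `|lambda + mu|) * (n%:R * (3 * (A * `|B|))).
have C10 : 0 <= C1 by rewrite !mulr_ge0 ?addr_ge0.
(* N^(-1) comes from the cutoff, N^(2-n) from F and its derivatives, N^(-3/2) from the scattered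
   field. Below |x| = N the commutator vanishes. *)
have Hb N x : 1 <= N -> r1 < N -> r2 <= N ->
    cabs (H N x) <= n%:R * ((C1 * (N^-1 * (N ^+ (n - 2))^-1)) * (`|K| * (N^-1 / Num.sqrt N))).
  move=> N1 r1N r2N; have N0 : 0 < N by exact: lt_le_trans N1.
  have Np0 : 0 < N ^+ (n - 2) by exact: exprn_gt0.
  have bN0 : 0 <= C1 * (N^-1 * (N ^+ (n - 2))^-1).
    by rewrite !mulr_ge0 ?invr_ge0 ?(ltW N0) ?(ltW Np0).
  have KN0 : 0 <= `|K| * (N^-1 / Num.sqrt N).
    by rewrite !mulr_ge0 ?invr_ge0 ?sqrtr_ge0 ?(ltW N0).
  rewrite /H (cdot_real_field (fun x => ut x - ui x)) (le_trans (cabs_sum _ _))//.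
  have -> : n%:R * ((C1 * (N^-1 * (N ^+ (n - 2))^-1)) * (`|K| * (N^-1 / Num.sqrt N))) =
      \sum_(j < n) ((C1 * (N^-1 * (N ^+ (n - 2))^-1)) * (`|K| * (N^-1 / Num.sqrt N))).
    by rewrite sumr_const card_ord mulr_natl.
  apply: ler_sum => j _; rewrite cabsM cabs_real.
  have [xN|Nx] := ltP (enorm x) N.
    have -> : comm N j x = 0 by apply: commutator_cutoff0 => //; left.
    by rewrite normr0 mul0r mulr_ge0.
  have x0 : 0 < enorm x by exact: lt_le_trans Nx.
  apply: ler_pM; rewrite ?cabs_ge0//.
  - have Fb : `|B| / enorm x ^+ (n - 2) <= `|B| / N ^+ (n - 2).
      rewrite ler_wpM2l// lef_pV2 ?posrE ?exprn_gt0// lerXn2r ?nnegrE//.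
      exact: ltW.
      exact: ltW.
    have Bb : B / enorm x ^+ (n - 2) <= `|B| / enorm x ^+ (n - 2).
      by rewrite ler_wpM2r ?ler_norm// invr_ge0 exprn_ge0// ltW.
    have Fd := Fdec x (le_trans r2N Nx).
    have := @commutator_bound R n lambda mu (cutoff_at N) F j x (A / N) (`|B| / N ^+ (n - 2)).
    move=> h; apply: (le_trans (h _ _ _ _ _)) => {h}.
    + by rewrite divr_ge0// ltW.
    + by move=> i; have [] := hA N x i i N1.
    + by move=> i k; have [] := hA N x i k N1.
    + by move=> i; have [h _] := Fd i i; rewrite (le_trans h)// (le_trans Bb).
    + by move=> i k; have [_ h] := Fd i k; rewrite (le_trans h)// (le_trans Bb).
    + by apply: eqW; rewrite /C1; move: (N^-1) (N ^- (n - 2)) => *; ring.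
  - have := coord_le_cnorm (ut x - ui x) j => /le_trans; apply.
    rewrite (le_trans (udec x _))//; first exact: lt_le_trans Nx.
    apply: (@le_trans _ _ (`|K| * enorm x `^ (- ((n%:R + 1) / 2)))).
      by rewrite ler_wpM2r ?powR_ge0 ?ler_norm.
    by rewrite ler_wpM2l//; exact: powR_decay_le.
have H0 N x : 0 < N -> 2 * N < enorm x -> H N x = 0.
  move=> N0 xN; rewrite /H (cdot_real_field (fun x => ut x - ui x)) big1// => j _.
  by rewrite comm0// mul0r.
have iH N : 0 < N -> r0 <= N -> cintegrable (H N).
  move=> N0 _.
  have -> : H N = fun x => cdot (ut x) (real_field (comm N) x) +
      (-1)%:C * cdot (ui x) (real_field (comm N) x).
    apply/funext => x; rewrite /H /cdot mulr_sumr -big_split /=.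
    by apply: eq_bigr => j _; rewrite !mxE rmorphN1; ring.
  have icomm f : (forall j, L2loc (coord f j)) ->
      cintegrable (fun x => cdot (f x) (real_field (comm N) x)).
    move=> f2; apply: (cintegrable_cdot (r := 2 * N)) => // j x; exact: comm0.
  by apply: cintegrableD; [exact: icomm|apply: cintegrableZ; exact: icomm].
have w2 : omega ^+ 2 != 0 by rewrite gt_eqF// exprn_gt0.
(* The 2 counts real and imaginary parts, and [4 ^+ n] comes from the box of side 4N around the ball
   of radius 2N; the remaining powers of N combine to N^(-1/2). *)
pose C2 := 2 * (n%:R * (C1 * `|K|)) * 4 ^+ n.
(* The entry [r1 + 1] secures the strict inequality r1 < N required by the decay hypothesis. *)
have key N : Num.max r0 (Num.max (r1 + 1) r2) <= N -> 1 <= N ->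
    cabs ((omega ^+ 2)%:C * cintegral G) <= C2 / Num.sqrt N.
  rewrite !ge_max => /and3P[r0N r1N r2N] N1.
  have N0 : 0 < N by exact: lt_le_trans N1.
  have r1N' : r1 < N by apply: lt_le_trans r1N; rewrite ltrDl.
  rewrite (eqH N)// -mulN1r cabsM -(rmorphN1 (real_complex R)) cabs_real normrN1 mul1r.
  have N20 : 0 <= 2 * N by rewrite mulr_ge0// ltW.
  have hb x := Hb N x N1 r1N' r2N.
  have := norm_cintegral_le N20 (iH N N0 r0N) (fun x => H0 N x N0) hb.
  move=> /le_trans; apply; apply: eqW.
  rewrite /C2 (_ : N ^- (n - 2) = N ^+ 2 / N ^+ n); last first.
    have -> : N ^+ n = N ^+ 2 * N ^+ (n - 2) by rewrite -exprD subnKC.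
    by rewrite invfM mulrA divff ?mul1r// expf_neq0// gt_eqF.
  rewrite (_ : (2 * (2 * N)) ^+ n = 4 ^+ n * N ^+ n); last first.
    by rewrite -exprMn; congr (_ ^+ n); ring.
  have Nn0 : N ^+ n != 0 by rewrite expf_neq0// gt_eqF.
  have Nne0 : N != 0 by rewrite gt_eqF.
  have sN0 : Num.sqrt N != 0 by rewrite gt_eqF// sqrtr_gt0.
  move: (Num.sqrt N) (N ^+ n) (4 ^+ n) Nn0 sN0 => s p q p0 s0.
  by field; rewrite Nne0 s0 p0.
have z0 (p : R[i] -> R) : (forall z, `|p z| <= cabs z) ->
    p ((omega ^+ 2)%:C * cintegral G) = 0.
  move=> pc; apply: (eq0_of_le_div_sqrt (C := C2) (N0 := Num.max r0 (Num.max (r1 + 1) r2))).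
  move=> N hN N1.
  exact: le_trans (pc _) (key N hN N1).
have : (omega ^+ 2)%:C * cintegral G = 0.
  apply/eqP; rewrite eq_complex; apply/andP; split; apply/eqP.
  - exact: z0 (@Re_le_cabs R).
  - exact: z0 (@Im_le_cabs R).
by move/eqP; rewrite mulf_eq0 => /orP[|/eqP//]; rewrite (fmorph_eq0 (real_complex R)) (negbTE w2).
Qed.

End orthogonality.

(** * A family of pressure waves *)

Section radial_wave.
Context {R : realType} {n : nat}.
Context (n23 : n = 2%N \/ n = 3%N).
Implicit Types (x y p : 'rV[R]_n) (i j k l : 'I_n).

Let n0 : (0 < n)%N. Proof. by case: n23 => ->. Qed.

Definition sqnorm y : R := \sum_i y ord0 i * y ord0 i.

Definition radial_fun m y : R := radial n m (sqnorm y).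

Lemma elementary_radial_fun m : elementary (radial_fun m).
Proof.
have h (a : nat) x : is_derive (sqnorm x) 1 (radial n (a + m)) (radial n (a.+1 + m) (sqnorm x)).
  by rewrite addSn; exact: radial_derive.
exact: (elementary_comp (h := fun a : nat => radial n (a + m)) (@elementary_sqnorm R n) h).
Qed.

Lemma pd_sqnorm i : pd i sqnorm = fun y => 2 * y ord0 i.
Proof.
rewrite /sqnorm (pd_sum i (index_enum _)
  (fun j => elementaryM (elementary_coord j) (elementary_coord j))).
apply/funext => y; rewrite (bigD1 i)//= big1 => [|j ji].
  by rewrite addr0 (pdM i (elementary_coord i) (elementary_coord i)) pd_coord eqxx /=; ring.
rewrite (pdM i (elementary_coord j) (elementary_coord j)) pd_coord.
by rewrite eq_sym (negbTE ji) /=; ring.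
Qed.

Lemma pd_radial_fun i m :
  pd i (radial_fun m) = fun y => 2 * (y ord0 i * radial_fun m.+1 y).
Proof.
have dh x : is_derive (sqnorm x) 1 (radial n m) (radial n m.+1 (sqnorm x)).
  exact: radial_derive.
rewrite /radial_fun (pd_comp (h' := radial n m.+1) i (@elementary_sqnorm R n) dh).
by apply/funext => y; rewrite pd_sqnorm /sqnorm; move: (radial _ _ _) => *; ring.
Qed.

Lemma pd2_radial_fun i j m : pd i (pd j (radial_fun m)) = fun y =>
  2 * ((i == j)%:R * radial_fun m.+1 y + 2 * (y ord0 i * y ord0 j * radial_fun m.+2 y)).
Proof.
have em := elementary_radial_fun; have ec := @elementary_coord R n.
rewrite pd_radial_fun (pdZ i 2 (elementaryM (ec j) (em m.+1))).
rewrite (pdM i (ec j) (em m.+1)) pd_radial_fun pd_coord; apply/funext => y.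
by move: (radial_fun _ y) (radial_fun _ y) => *; ring.
Qed.

Lemma pd3_radial_fun l i j m : pd l (pd i (pd j (radial_fun m))) = fun y =>
  4 * ((i == j)%:R * (y ord0 l * radial_fun m.+2 y) +
       (l == i)%:R * (y ord0 j * radial_fun m.+2 y) +
       (l == j)%:R * (y ord0 i * radial_fun m.+2 y) +
       2 * (y ord0 l * y ord0 i * y ord0 j * radial_fun m.+3 y)).
Proof.
have em := elementary_radial_fun; have ec := @elementary_coord R n.
have e2 := elementaryM (elementaryM (ec i) (ec j)) (em m.+2).
rewrite pd2_radial_fun.
rewrite (pdZ l 2 (elementaryD (elementaryZ (i == j)%:R (em m.+1)) (elementaryZ 2 e2))).
rewrite (pdD l (elementaryZ (i == j)%:R (em m.+1)) (elementaryZ 2 e2)).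
rewrite (pdZ l _ (em m.+1)) (pdZ l 2 e2) (pdM l (elementaryM (ec i) (ec j)) (em m.+2)).
rewrite (pdM l (ec i) (ec j)) !pd_radial_fun !pd_coord; apply/funext => y.
by move: (radial_fun _ y) (radial_fun _ y) => *; ring.
Qed.

Lemma laplacian_radial_fun y :
  \sum_i pd i (pd i (radial_fun 0)) y = - radial_fun 0 y.
Proof.
rewrite (eq_bigr (fun i => 2 * radial_fun 1 y + 4 * (y ord0 i * y ord0 i) * radial_fun 2 y)).
  rewrite big_split /= sumr_const card_ord -mulr_suml -mulr_sumr -/(sqnorm y).
  have := radial_ode (sqnorm y) n0.
  rewrite -/(radial_fun 0 y) -/(radial_fun 1 y) -/(radial_fun 2 y) -mulr_natl.
  by move: (radial_fun 0 y) (radial_fun 1 y) (radial_fun 2 y) => *; lra.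
move=> i _; rewrite pd2_radial_fun eqxx /=.
by move: (radial_fun 1 y) (radial_fun 2 y) => *; ring.
Qed.

(** With w = grad (d_k phi), the Laplacian commutes with derivatives, so Delta w = - w; also div w =
    d_k (Delta phi) = - d_k phi, so grad (div w) = - w. The coefficients add up to lambda + 2 mu. *)
Lemma rnavier_hessian lambda mu (f : 'rV[R]_n -> R) k j y : elementary f ->
  (forall z, \sum_i pd i (pd i f) z = - f z) ->
  rnavier lambda mu (fun j => pd j (pd k f)) j y =
  - (lambda + 2 * mu) * pd j (pd k f) y.
Proof.
move=> ef lap_f.
have ep i := elementary_pd i ef; have epp i l := elementary_pd i (ep l).
have Lk l : (fun z => \sum_i pd i (pd i (pd l f)) z) = fun z => -1 * pd l f z.
  rewrite -(pdZ l (-1) ef).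
  have -> : (fun z => -1 * f z) = fun z => \sum_i pd i (pd i f) z.
    by apply/funext => z; rewrite lap_f mulN1r.
  rewrite (pd_sum l (index_enum _) (fun i => epp i i)); apply/funext => z.
  by apply: eq_bigr => i _; rewrite (pdC i l ef) (pdC i l (ep i)).
have Ljk : \sum_i pd i (pd i (pd j (pd k f))) y = -1 * pd j (pd k f) y.
  have /= <- := congr1 (fun g => g y) (pdZ j (-1) (ep k)); rewrite -Lk.
  rewrite (pd_sum j (index_enum _) (fun i => elementary_pd i (epp i k))).
  by apply: eq_bigr => i _; rewrite (pdC i j (ep k)) (pdC i j (epp i k)).
have Ljk2 : pd j (fun z => \sum_i pd i (pd i (pd k f)) z) y = -1 * pd j (pd k f) y.
  by rewrite Lk (pdZ j (-1) (ep k)).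
by rewrite /rnavier Ljk Ljk2; move: (pd j (pd k f) y) => a; ring.
Qed.

Lemma radial_funE m y : radial_fun m y = radial n m (sqnorm y).
Proof. by []. Qed.

Opaque radial_fun.

Lemma elementary_hessian i j : elementary (pd i (pd j (radial_fun 0))).
Proof. exact/elementary_pd/elementary_pd/elementary_radial_fun. Qed.

Definition wave (kappa : R) p k j x : R :=
  pd j (pd k (radial_fun 0)) (kappa *: (x - p)).

Lemma elementary_wave kappa p k j : elementary (wave kappa p k j).
Proof. exact/elementary_affine/elementary_hessian. Qed.

Lemma pd_affine_fun i (f : 'rV[R]_n -> R) (a c : R) p : elementary f ->
  pd i (fun x => c * f (a *: (x - p))) = fun x => c * a * pd i f (a *: (x - p)).
Proof.
move=> ef; rewrite (pdZ i c (elementary_affine a p ef)) (pd_affine i a p ef).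
by apply/funext => x; rewrite mulrA.
Qed.

Lemma rnavier_wave lambda mu kappa p k j x :
  rnavier lambda mu (wave kappa p k) j x =
  - ((lambda + 2 * mu) * kappa ^+ 2) * wave kappa p k j x.
Proof.
have eh := elementary_hessian; have eph i l m := elementary_pd i (eh l m).
have d1 i l : pd i (wave kappa p k l) = fun y =>
    kappa * pd i (pd l (pd k (radial_fun 0))) (kappa *: (y - p)).
  exact: (pd_affine i kappa p (eh l k)).
have d2 i l m : pd i (pd l (wave kappa p k m)) = fun y => kappa * kappa *
    pd i (pd l (pd m (pd k (radial_fun 0)))) (kappa *: (y - p)).
  by rewrite d1 (pd_affine_fun i kappa kappa p (eph l m k)).
have := rnavier_hessian lambda mu k j (kappa *: (x - p))
  (elementary_radial_fun 0) laplacian_radial_fun.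
rewrite /rnavier (pd_sum j (index_enum _) (fun i => eph i i k)).
rewrite (pd_sum j (index_enum _) (fun i => elementary_pd i (elementary_wave kappa p k i))).
rewrite (eq_bigr _ (fun i _ => congr1 (fun f => f x) (d2 i i j))).
rewrite (eq_bigr _ (fun i _ => congr1 (fun f => f x) (d2 j i i))) -!mulr_sumr.
rewrite /wave; move: (\sum_i _) (\sum_i _) (pd j (pd k _) _) => S2 S1 W e.
rewrite [LHS](_ : _ = kappa * kappa * (mu * S1 + (lambda + mu) * S2)); last by ring.
by rewrite e; ring.
Qed.

(** At the centre the terms y_j y_k S'' vanish, and 2 S'(0) = - 1/n remains on the diagonal. *)
Lemma wave_at_center kappa p k j : wave kappa p k j p = - n%:R^-1 * (j == k)%:R.
Proof.
rewrite /wave subrr scaler0 pd2_radial_fun !mxE !mul0r mulr0 addr0.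
rewrite radial_funE (_ : sqnorm 0 = 0); last first.
  by rewrite /sqnorm big1// => i _; rewrite !mxE mul0r.
have nn0 : n%:R != 0 :> R by rewrite pnatr_eq0 -lt0n.
by rewrite radial10; field.
Qed.

Lemma radial_lipschitz m (t T : R) : 0 <= t <= T ->
  `|radial n m t - radial n m 0| <= t * expR T.
Proof.
move=> /andP[t0 tT].
have [||c ct ->] := @MVT_segment R (radial n m) (radial n m.+1) 0 t t0.
- by move=> x _; exact: radial_derive.
- apply: derivable_within_continuous => x _.
  by have [] := radial_derive m x n0.
rewrite subr0 normrM (ger0_norm t0) mulrC ler_wpM2l//.
rewrite (le_trans (radial_le_expR _ _ n0))// ler_expR.
by move: ct; rewrite in_itv /= => /andP[c0 ct]; rewrite ger0_norm// (le_trans ct).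
Qed.

Lemma sqnorm_enorm y : sqnorm y = enorm y ^+ 2.
Proof. by rewrite enorm_sqr. Qed.

(** The deviation is quadratic because phi depends only on |y|^2. Of the constant 6, the part 2 pays
    for S'(t) - S'(0) and the part 4 for y_j y_k S''(t). *)
Lemma wave_near_center kappa p k j x (T : R) :
  (kappa * enorm (x - p)) ^+ 2 <= T ->
  `|wave kappa p k j x - wave kappa p k j p| <=
    6 * expR T * (kappa * enorm (x - p)) ^+ 2.
Proof.
set t := _ ^+ 2 => tT.
have te : sqnorm (kappa *: (x - p)) = t.
  by rewrite sqnorm_enorm enormZ exprMn real_normK ?num_real// /t exprMn.
have s0 : sqnorm (0 : 'rV[R]_n) = 0 by rewrite /sqnorm big1// => i _; rewrite mxE mul0r.
have t0 : 0 <= t by exact: sqr_ge0.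
rewrite /wave subrr scaler0 !pd2_radial_fun !radial_funE te s0.
move: (kappa *: (x - p)) te => y te.
rewrite !mxE !mul0r mulr0 addr0.
have l1 := @radial_lipschitz 1 t T; have l2 := radial_le_expR 2 t n0.
have {}l1 : `|radial n 1 t - radial n 1 0| <= t * expR T by apply: l1; rewrite t0.
have {}l2 : `|radial n 2 t| <= expR T.
  by rewrite (le_trans l2)// ler_expR ger0_norm.
have yy : `|y ord0 j * y ord0 k| <= t.
  rewrite normrM -te sqnorm_enorm expr2.
  by apply: ler_pM => //; exact: coord_le_enorm.
have l3 : `|y ord0 j * y ord0 k * radial n 2 t| <= t * expR T.
  by rewrite normrM; apply: ler_pM.
have d1 : `|(j == k)%:R * (radial n 1 t - radial n 1 0)| <= t * expR T.
  rewrite normrM normr_nat (le_trans _ l1)// ler_piMl//.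
  by case: (j == k); rewrite ?ler01.
rewrite [X in `|X|](_ : _ = 2 * ((j == k)%:R * (radial n 1 t - radial n 1 0)) +
   4 * (y ord0 j * y ord0 k * radial n 2 t)); last first.
  by move: (radial n 1 t) (radial n 1 0) (radial n 2 t) => *; ring.
rewrite (le_trans (ler_normD _ _))// [`|2 * _|]normrM [`|4 * _|]normrM !normr_nat.
lra.
Qed.

Lemma wave_decay kappa p k : 0 < kappa -> exists B r : R, forall x, r <= enorm x ->
  forall i j, `|wave kappa p k j x| <= B / enorm x ^+ (n - 2) /\
    `|pd i (wave kappa p k j) x| <= B / enorm x ^+ (n - 2).
Proof.
move=> k0; have [C C0 hC] := @radial_decay R n n23.
pose B0 := 28 * C * (1 + kappa).
(* The entry [2 * enorm p] ensures |x - p| >= |x| / 2, and [2 / kappa] then gives |y| >= 1, the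
   range of [radial_decay]. The factor 28 in [B0] dominates the 6 from second and the 20 kappa from
   third derivatives of phi. *)
exists (B0 / (kappa / 2) ^+ (n - 2)), (Num.max (2 * enorm p) (Num.max 1 (2 / kappa))).
move=> x; rewrite !ge_max => /and3P[xp x1 xk] i j.
have x0 : 0 < enorm x by exact: lt_le_trans x1.
set y := kappa *: (x - p); set r := enorm y.
have rx : kappa / 2 * enorm x <= r.
  rewrite /r /y enormZ (gtr0_norm k0) -mulrA ler_pM2l//.
  rewrite -(ler_pXn2r (n := 2)) ?nnegrE ?enorm_ge0 ?mulr_ge0//; last exact: ltW.
  have := enorm_sqrD (x - p) p; rewrite subrK.
  have : (2 * enorm p) ^+ 2 <= enorm x ^+ 2.
    by rewrite lerXn2r ?nnegrE ?mulr_ge0 ?enorm_ge0.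
  rewrite !exprMn; move: (enorm x ^+ 2) (enorm p ^+ 2) (enorm (x - p) ^+ 2) => *; nra.
have r1 : 1 <= r.
  by rewrite (le_trans _ rx)// mulrAC ler_pdivlMr// mul1r -ler_pdivrMl// mulrC.
have r0 : 0 < r by exact: lt_le_trans r1.
pose Q := (r ^+ (n - 2))^-1.
have Q0 : 0 <= Q by rewrite invr_ge0 exprn_ge0// ltW.
have Qx : B0 * Q <= B0 / (kappa / 2) ^+ (n - 2) / enorm x ^+ (n - 2).
  rewrite -mulrA -invfM -exprMn ler_wpM2l//.
    by rewrite !mulr_ge0 ?addr_ge0 ?(ltW k0) ?(ltW C0).
  have kx : 0 < kappa / 2 * enorm x by rewrite mulr_gt0 ?divr_gt0.
  by rewrite lef_pV2 ?posrE ?exprn_gt0// lerXn2r// nnegrE ltW.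
have [h1 h2 h3] := hC r r1; rewrite -/Q in h1 h2 h3.
have yr l : `|y ord0 l| <= r by exact: coord_le_enorm.
have eqy m : radial_fun m y = radial n m (r ^+ 2) by rewrite radial_funE sqnorm_enorm.
have CQ : 0 <= C * Q by rewrite mulr_ge0// ltW.
have hr2 : r * `|radial n 2 (r ^+ 2)| <= C * Q.
  by apply: le_trans h2; rewrite ler_wpM2r// expr2 ler_peMl// ltW.
have bool1 (b : bool) (a : R) : `|b%:R * a| <= `|a|.
  by rewrite normrM normr_nat ler_piMl//; case: b; rewrite ?ler01.
split; apply: le_trans Qx.
- rewrite /wave -/y pd2_radial_fun !eqy.
  have e1 : `|y ord0 j * y ord0 k * radial n 2 (r ^+ 2)| <= C * Q.
    apply: le_trans h2; rewrite normrM ler_wpM2r// normrM expr2.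
    exact: ler_pM.
  have e2 := le_trans (bool1 (j == k) _) h1.
  rewrite normrM normr_nat; apply: (@le_trans _ _ (2 * (3 * (C * Q)))).
    rewrite ler_wpM2l// (le_trans (ler_normD _ _))// [X in _ + X]normrM normr_nat; lra.
  rewrite /B0; have : 0 <= C * Q * kappa by rewrite mulr_ge0// ltW.
  lra.
- have -> : pd i (wave kappa p k j) x = kappa * pd i (pd j (pd k (radial_fun 0))) y.
    by rewrite /wave (pd_affine i kappa p (elementary_hessian j k)).
  rewrite normrM (gtr0_norm k0) pd3_radial_fun !eqy.
  have hy l : `|y ord0 l * radial n 2 (r ^+ 2)| <= C * Q.
    by rewrite normrM (le_trans _ hr2)// ler_wpM2r.
  have e1 b l := le_trans (bool1 b _) (hy l).
  have e2 : `|y ord0 i * y ord0 j * y ord0 k * radial n 3 (r ^+ 2)| <= C * Q.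
    apply: le_trans h3; rewrite normrM ler_wpM2r// !normrM !exprSr expr0 mul1r.
    by rewrite !ler_pM ?mulr_ge0.
  apply: (@le_trans _ _ (kappa * (4 * (5 * (C * Q))))); last first.
    have : 0 <= C * Q * kappa by rewrite mulr_ge0// ltW.
    by rewrite /B0; lra.
  rewrite ler_wpM2l ?(ltW k0)// normrM normr_nat ler_wpM2l//.
  rewrite (le_trans (ler_normD _ _))// [X in _ + X <= _]normrM normr_nat.
  rewrite (_ : 5 * (C * Q) = C * Q + C * Q + C * Q + 2 * (C * Q)); last by ring.
  rewrite lerD ?ler_wpM2l// (le_trans (ler_normD _ _))// lerD//.
  by rewrite (le_trans (ler_normD _ _))// lerD.
Qed.

End radial_wave.

(** * Boundary values and the final estimate *)

Section domain_geometry.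
Context {R : realType} {n : nat}.
Implicit Types (Om : set 'rV[R]_n) (x y p : 'rV[R]_n) (g : cfun R n).

Lemma coord_le_mx_norm x i : `|x ord0 i| <= `|x|.
Proof.
rewrite [leRHS]/Num.Def.normr /= mx_normrE; apply/bigmax_geP; right => /=.
by exists (ord0, i).
Qed.

Lemma bounded_enorm Om : bounded_set Om -> exists r, forall x, Om x -> enorm x <= r.
Proof.
move=> [M [_ hM]]; pose M1 := `|M| + 1.
exists (Num.sqrt (n%:R * M1 ^+ 2)) => x Ox; apply: enorm_le.
  by rewrite addr_ge0.
move=> i; rewrite (le_trans (coord_le_mx_norm x i))//; apply: hM Ox.
by rewrite /M1 (le_lt_trans (ler_norm M))// ltrDl.
Qed.

Lemma enorm_le_diam Om x y : bounded_set Om -> Om x -> Om y ->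
  enorm (x - y) <= diam Om.
Proof.
move=> /bounded_enorm[r hr] Ox Oy; apply: ub_le_sup; last by exists (x, y).
exists (2 * r) => _ [[a b] [/= Oa Ob] <-].
have r0 : 0 <= r by apply: le_trans (hr _ Ox); exact: enorm_ge0.
rewrite -(ler_pXn2r (n := 2)) ?nnegrE ?enorm_ge0 ?mulr_ge0//.
rewrite (le_trans (enorm_sqrD _ _))// enorm_opp.
have sqr_le z : Om z -> enorm z ^+ 2 <= r ^+ 2.
  by move=> Oz; apply: lerXn2r; rewrite ?nnegrE ?enorm_ge0 ?hr.
have := sqr_le _ Oa; have := sqr_le _ Ob; rewrite [X in _ -> _ -> _ <= X]exprMn.
move: (enorm a ^+ 2) (enorm b ^+ 2) (r ^+ 2) => *; lra.
Qed.

(** Two distinct points make the diameter positive and the Hoelder seminorms nonnegative; a supremum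
    over no pairs would be -oo. *)
Lemma open_two_points Om : (0 < n)%N -> open Om -> Om !=set0 ->
  exists x y, [/\ Om x, Om y & 0 < enorm (x - y)].
Proof.
move=> n0 oO [x Ox]; have [e e0 he] := open_box oO Ox.
pose i0 := Ordinal n0; pose y : 'rV[R]_n := x - (e / 2) *: delta_mx ord0 i0.
exists x, y; split=> //.
  apply: he => i; rewrite !mxE opprB addrC subrK eqxx /=.
  rewrite ger0_norm ?mulr_ge0 ?invr_ge0 ?(ltW e0)//.
  rewrite (@le_lt_trans _ _ (e / 2))// ?ler_piMr ?divr_ge0 ?(ltW e0)//.
    by case: (_ == _); rewrite ?ler01.
  by rewrite ltr_pdivrMr// ltr_pMr// ltr1n.
apply: lt_le_trans (coord_le_enorm _ i0).
rewrite !mxE opprB addrC subrK !eqxx mulr1 normr_gt0.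
by rewrite mulf_neq0// gt_eqF.
Qed.

Section boundary_limits.
Context (Om : set 'rV[R]_n) (p : 'rV[R]_n) (clp : closure Om p).
Local Notation F := (within Om (nbhs p)).

(** Properness is what makes limits from inside Om unique, hence [bdry_value] meaningful. *)
#[local] Instance within_closure_proper : ProperFilter F.
Proof.
apply: Build_ProperFilter => F0.
by have [x [Ox]] := clp F0; exact.
Qed.

Lemma enorm_closure_le_diam x : bounded_set Om -> Om x -> enorm (x - p) <= diam Om.
Proof.
move=> bO Ox.
have ct : (fun y => enorm (x - y)) @ F --> enorm (x - p).
  apply: cvg_within_filter.
  have : {for p, continuous (@enorm R n \o (fun y => x - y))}.
    apply: continuous_comp; last exact: enorm_continuous.
    by apply: continuousB; [exact: cst_continuous|exact: cvg_id].
  by [].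
apply: cvgr_to_le ct _.
by near=> y; apply: enorm_le_diam => //; near: y; exact: withinT.
Unshelve. all: by end_near. Qed.

Lemma cabs_limit_le g x (a b B : R) : 0 <= B ->
  (fun y => Re (g y)) @ F --> a -> (fun y => Im (g y)) @ F --> b ->
  (forall y, Om y -> cabs (g x - g y) <= B) -> cabs (g x - (a +i* b)) <= B.
Proof.
move=> B0 ga gb gB.
have ct : (fun y => (Re (g x) - Re (g y)) * (Re (g x) - Re (g y)) +
      (Im (g x) - Im (g y)) * (Im (g x) - Im (g y))) @ F -->
    (Re (g x) - a) * (Re (g x) - a) + (Im (g x) - b) * (Im (g x) - b).
  by apply: cvgD; apply: cvgM; apply: cvgB => //; exact: cvg_cst.
have eqc z w : cabs (z - w) ^+ 2 = (Re z - Re w) * (Re z - Re w) +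
    (Im z - Im w) * (Im z - Im w) :> R.
  by rewrite cabs_sqr; case: z w => ? ? [? ?] /=; ring.
rewrite -(ler_pXn2r (n := 2)) ?nnegrE ?cabs_ge0// eqc /=.
apply: cvgr_to_le ct _; near=> y; rewrite -eqc.
apply: lerXn2r; rewrite ?nnegrE ?cabs_ge0//; apply: gB.
by near: y; exact: withinT.
Unshelve. all: by end_near. Qed.

(** Values near p are mutually close, so they are Cauchy along the filter and completeness yields
    the limit that [bdry_value] denotes by [lim]. *)
Lemma holder_cvg (h : 'rV[R]_n -> R) (H delta : R) : 0 < delta -> 0 <= H ->
  (forall x y, Om x -> Om y -> `|h x - h y| <= H * enorm (x - y) `^ delta) ->
  cvg (h @ F).
Proof.
move=> d0 H0 hH; apply/cauchy_cvgP; apply: cauchy_exP => e e0.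
(* With this s the increment over distance s is at most H e / (H + 1) < e; the denominator H + 1
   also covers H = 0. *)
pose s := (e / (H + 1)) `^ delta^-1.
have s0 : 0 < s by rewrite powR_gt0// divr_gt0// ltr_wpDl.
have oB : open [set y : 'rV[R]_n | enorm (y - p) < s / 2].
  have -> : [set y : 'rV[R]_n | enorm (y - p) < s / 2] =
     (@enorm R n \o (fun y => y - p)) @^-1` `]-oo, s / 2[%classic.
    by apply/seteqP; split=> y /=; rewrite in_itv.
  apply: open_comp; last exact: interval_open.
  move=> y _; apply: continuous_comp; last exact: enorm_continuous.
  by apply: continuousB; [exact: cvg_id|exact: cst_continuous].
have pB : enorm (p - p) < s / 2.
  by rewrite subrr (_ : enorm 0 = 0) ?divr_gt0// /enorm big1 ?sqrtr0// => i _; rewrite mxE expr0n.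
have nB : nbhs p [set y : 'rV[R]_n | enorm (y - p) < s / 2] by exact: open_nbhs_nbhs.
have [x0 [Ox0 x0B]] := clp nB.
exists (h x0); rewrite /fmapE /= /nbhs /=.
apply: filterS nB => y yB Oy; rewrite /ball /= .
have xy : enorm (x0 - y) <= s.
  rewrite -(ler_pXn2r (n := 2)) ?nnegrE ?enorm_ge0 ?(ltW s0)//.
  rewrite -[x0](subrK p) -addrA (le_trans (enorm_sqrD _ _))//.
  rewrite -[p - y]opprB enorm_opp.
  have sq z : enorm (z - p) < s / 2 -> enorm (z - p) ^+ 2 <= (s / 2) ^+ 2.
    by move=> zB; apply: lerXn2r; rewrite ?nnegrE ?enorm_ge0 ?divr_ge0 ?(ltW s0)// ltW.
  have := sq _ x0B; have := sq _ yB.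
  rewrite expr_div_n; move: (enorm (x0 - p) ^+ 2) (enorm (y - p) ^+ 2) (s ^+ 2) => *; lra.
apply: (@le_lt_trans _ _ (H * s `^ delta)).
  rewrite (le_trans (hH _ _ Ox0 Oy))// ler_wpM2l// 
    ge0_ler_powR ?nnegrE ?enorm_ge0 ?(ltW d0) ?(ltW s0)//.
rewrite /s -powRrM mulVf ?gt_eqF// powRr1; last by rewrite divr_ge0 ?addr_ge0 ?(ltW e0).
rewrite mulrA ltr_pdivrMr ?ltr_wpDl// mulrC ltr_pM2l// ltrDl//.
Qed.

End boundary_limits.

Lemma cabs_holder (g : cfun R n) Om (delta : R) x y : 0 < delta ->
  holder_semi delta Om g \is a fin_num -> Om x -> Om y ->
  cabs (g x - g y) <= fine (holder_semi delta Om g) * enorm (x - y) `^ delta.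
Proof.
move=> d0 hfin Ox Oy; have [->|xy] := eqVneq x y.
  have e0 : enorm (y - y) = 0.
    by rewrite subrr /enorm big1 ?sqrtr0// => i _; rewrite mxE expr0n.
  by rewrite e0 subrr cabs0 powR0 ?gt_eqF// mulr0.
have pos : 0 < enorm (x - y).
  rewrite lt_neqAle enorm_ge0 andbT eq_sym; apply/eqP => h.
  move/eqP: xy; apply; apply/rowP => i; apply/eqP; rewrite -subr_eq0 -normr_le0.
  by have := coord_le_enorm (x - y) i; rewrite h !mxE.
rewrite -ler_pdivrMr ?powR_gt0// -lee_fin fineK//.
apply: ereal_sup_ubound; exists (x, y) => //; split=> //; split=> //=.
exact/eqP.
Qed.

End domain_geometry.

(** * Freezing factors at the boundary point *)

Section final_estimates.
Context {R : realType} {n : nat}.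
Implicit Types (Om : set 'rV[R]_n) (x p : 'rV[R]_n) (V : cfun R n).

(** Telescoping replaces one factor at a time: the potential, the incident field, the wave, and
    finally incident by total field. The first three errors carry [e], which will be eps^delta; the
    last is left for averaging. *)
Lemma cdot_difference (V0 Vx : R[i]) (w0 wx tx : 'rV[R[i]]_n) (F0 Fx : 'I_n -> R)
    (v q e a E W : R) : 0 <= v -> 0 <= q -> 0 <= e ->
  cabs (V0 - Vx) <= v * e -> cabs Vx <= v ->
  (forall j, cabs (w0 ord0 j) <= q * a) -> (forall j, cabs (wx ord0 j) <= q) ->
  (forall j, cabs (w0 ord0 j - wx ord0 j) <= q * e) ->
  (forall j, `|F0 j| <= 1) -> (forall j, `|F0 j - Fx j| <= E * e) ->
  (forall j, `|Fx j| <= W) ->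
  cabs (V0 * (\sum_j (F0 j)%:C * w0 ord0 j) - Vx * (\sum_j (Fx j)%:C * tx ord0 j)) <=
  n%:R * (v * q * e * (a + 1 + E)) + n%:R * (v * W * cnorm (tx - wx)).
Proof.
move=> v0 q0 e0 hV hVx hw0 hwx hd hF0 hFd hFx.
rewrite !mulr_sumr -sumrB (le_trans (cabs_sum _ _))// -mulrDr.
have sumE (c : R) : n%:R * c = \sum_(j < n) c by rewrite sumr_const card_ord mulr_natl.
rewrite sumE; apply: ler_sum => j _.
have -> : V0 * ((F0 j)%:C * w0 ord0 j) - Vx * ((Fx j)%:C * tx ord0 j) =
    (V0 - Vx) * ((F0 j)%:C * w0 ord0 j) +
    Vx * ((F0 j)%:C * (w0 ord0 j - wx ord0 j)) +
    Vx * ((F0 j - Fx j)%:C * wx ord0 j) - Vx * ((Fx j)%:C * (tx - wx) ord0 j).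
  by rewrite !mxE rmorphB; ring.
have ab (r s c d : R) : 0 <= r -> 0 <= s -> r <= c -> s <= d -> r * s <= c * d.
  by move=> *; exact: ler_pM.
have c0 := @cabs_ge0 R.
have h1 : cabs ((V0 - Vx) * ((F0 j)%:C * w0 ord0 j)) <= v * e * (1 * (q * a)).
  by rewrite !cabsM cabs_real !ab ?mulr_ge0.
have h2 : cabs (Vx * ((F0 j)%:C * (w0 ord0 j - wx ord0 j))) <= v * (1 * (q * e)).
  by rewrite !cabsM cabs_real !ab ?mulr_ge0.
have h3 : cabs (Vx * ((F0 j - Fx j)%:C * wx ord0 j)) <= v * (E * e * q).
  by rewrite !cabsM cabs_real !ab ?mulr_ge0.
have h4 : cabs (Vx * ((Fx j)%:C * (tx - wx) ord0 j)) <= v * (W * cnorm (tx - wx)).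
  by rewrite !cabsM cabs_real !ab ?mulr_ge0 ?coord_le_cnorm.
rewrite (le_trans (cabsB _ _))//.
have h5 := cabsD ((V0 - Vx) * ((F0 j)%:C * w0 ord0 j))
  (Vx * ((F0 j)%:C * (w0 ord0 j - wx ord0 j))).
have h6 := cabsD ((V0 - Vx) * ((F0 j)%:C * w0 ord0 j) +
  Vx * ((F0 j)%:C * (w0 ord0 j - wx ord0 j))) (Vx * ((F0 j - Fx j)%:C * wx ord0 j)).
lra.
Qed.

(** Pairing the far field with the direction annihilates the transversal part, so the longitudinal
    and then the transversal amplitude vanish and only the remainder of the expansion is left. *)
Lemma zero_far_field_decay (lambda mu omega : R) (u uinf : cfield R n) :
  far_field_pattern lambda mu omega u uinf ->
  (forall x, enorm x = 1 -> uinf x = 0) ->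
  exists K r : R, forall x, r < enorm x ->
    cnorm (u x) <= K * enorm x `^ (- ((n%:R + 1) / 2)).
Proof.
move=> [up [us [hpat [K [r hK]]]]] uinf0; exists K, (Num.max r 0) => x.
rewrite gt_max => /andP[rx x0]; have := hK x rx; cbv zeta.
set xh := _ *: x; have xh1 : enorm xh = 1.
  by rewrite /xh enormZ ger0_norm ?invr_ge0 ?(ltW x0)// mulVf// gt_eqF.
have [h1 h2] := hpat xh xh1; rewrite (uinf0 _ xh1) in h2.
have up0 : up xh = 0.
  have : cdot (up xh *: toC xh + us xh) (toC xh) = up xh * (enorm xh ^+ 2)%:C.
    have -> : cdot (up xh *: toC xh + us xh) (toC xh) =
        up xh * cdot (toC xh) (toC xh) + cdot (us xh) (toC xh).
      rewrite /cdot mulr_sumr -big_split /=; apply: eq_bigr => j _.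
      by rewrite !mxE; ring.
    rewrite h1 addr0 enorm_sqr -real_complex_sum; congr (_ * _).
    by apply: eq_bigr => j _; rewrite !mxE -rmorphM.
  rewrite -h2 xh1 expr1n mulr1 => <-.
  by rewrite /cdot big1// => j _; rewrite mxE mul0r.
have us0 : us xh = 0 by move: h2; rewrite up0 scale0r add0r.
by rewrite up0 us0 mulr0 scale0r scaler0 addr0 subr0.
Qed.

(** The weight is strictly positive, so an infinite seminorm could not be hidden by the product. *)
Lemma fin_num_Ctilde (omega delta : R) (L H : \bar R) : 0 < omega -> (0 <= L)%E ->
  (L + (omega `^ (- delta))%:E * H)%E \is a fin_num ->
  L \is a fin_num /\ H \is a fin_num.
Proof.
move=> o0 L0; rewrite fin_numD => /andP[-> hH]; split=> //.
have w0 : 0 < omega `^ (- delta) by exact: powR_gt0.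
case: H hH => [r _| |]; first by [].
- by rewrite mulry gtr0_sg// mul1e.
- by rewrite mulrNy gtr0_sg// mul1e.
Qed.

Lemma holder_semi_ge0 (delta : R) Om (g : cfun R n) x y : Om x -> Om y ->
  0 < enorm (x - y) -> (0 <= holder_semi delta Om g)%E.
Proof.
move=> Ox Oy xy.
apply: (@le_trans _ _ ((cabs (g x - g y) / enorm (x - y) `^ delta)%:E)).
  by rewrite lee_fin divr_ge0 ?cabs_ge0 ?powR_ge0.
apply: ereal_sup_ubound; exists (x, y) => //; split=> //; split=> //= xy'.
by move: xy; rewrite xy' subrr /enorm big1 ?sqrtr0 ?ltxx// => i _; rewrite mxE expr0n.
Qed.

Lemma Linf_norm_medium Om V : medium Om V ->
  Linf_norm Om (fun x => cabs (V x)) = Linf_norm setT (fun x => cabs (V x)).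
Proof.
move=> [_ _ V0]; rewrite /Linf_norm; congr Lnorm; apply/funext => x.
rewrite !patchE in_setT; case: ifPn => // /negP xO.
by rewrite V0 ?cabs0// => Ox; apply: xO; exact: mem_set.
Qed.

End final_estimates.

(** * The bound at a boundary point when the far field vanishes *)

Section nonradiating.
Context {R : realType} {n : nat}.
Implicit Types (Om : set 'rV[R]_n) (x p : 'rV[R]_n) (V : cfun R n).

Lemma powR_le_max (eps M t : R) : 0 <= eps -> eps <= M -> 0 <= t <= 1 ->
  eps `^ t <= 1 + M.
Proof.
move=> e0 eM /andP[t0 t1]; have M0 : 0 <= M by exact: le_trans eM.
have [e1|e1] := leP eps 1.
  apply: (@le_trans _ _ (1 `^ t)); first by rewrite ge0_ler_powR ?nnegrE.
  by rewrite powR1 lerDl.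
apply: (@le_trans _ _ (eps `^ 1)); first by apply: ler_powR => //; exact: ltW.
by rewrite powRr1// (le_trans eM)// lerDr.
Qed.

Lemma bdry_value_holder Om V p (delta B : R) : 0 < delta -> 0 <= B ->
  closure Om p -> bounded_set Om -> holder_semi delta Om V \is a fin_num ->
  (forall x y, Om x -> Om y -> fine (holder_semi delta Om V) * enorm (x - y) `^ delta <= B) ->
  0 <= fine (holder_semi delta Om V) ->
  forall x, Om x -> cabs (V x - bdry_value Om V p) <= B.
Proof.
move=> d0 B0 clp bO hfin hB h0 x Ox.
have hol a b : Om a -> Om b -> cabs (V a - V b) <=
    fine (holder_semi delta Om V) * enorm (a - b) `^ delta by exact: cabs_holder.
have ReB (z w : R[i]) : Re (z - w) = Re z - Re w by case: z w => ? ? [].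
have ImB (z w : R[i]) : Im (z - w) = Im z - Im w by case: z w => ? ? [].
apply: (cabs_limit_le clp B0).
- apply: (holder_cvg clp d0 h0) => a b Oa Ob; rewrite -ReB.
  exact: le_trans (Re_le_cabs _) (hol _ _ Oa Ob).
- apply: (holder_cvg clp d0 h0) => a b Oa Ob; rewrite -ImB.
  exact: le_trans (Im_le_cabs _) (hol _ _ Oa Ob).
- by move=> y Oy; exact: le_trans (hol _ _ Ox Oy) (hB _ _ Ox Oy).
Qed.

Lemma continuous_value_holder Om (g : cfun R n) p (delta B : R) : 0 < delta -> 0 <= B ->
  closure Om p -> contC_at g p -> holder_semi delta Om g \is a fin_num ->
  (forall x y, Om x -> Om y -> fine (holder_semi delta Om g) * enorm (x - y) `^ delta <= B) ->
  forall x, Om x -> cabs (g x - g p) <= B.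
Proof.
move=> d0 B0 clp [cr ci] hfin hB x Ox; rewrite [g p]complexE.
have -> : (Re (g p))%:C + 'i * (Im (g p))%:C = Re (g p) +i* Im (g p).
  by rewrite -complexE; case: (g p).
apply: (cabs_limit_le clp B0).
- exact: cvg_within_filter cr.
- exact: cvg_within_filter ci.
- move=> y Oy; exact: le_trans (cabs_holder d0 hfin Ox Oy) (hB _ _ Ox Oy).
Qed.

End nonradiating.

(** The quantitative contrapositive: the decay hypothesis is what a vanishing far field leaves. [C]
    is produced before [omega], [Om], [V] and [ui], so the auxiliary constants may depend only on
    the a-priori data and [s]. *)
Lemma nonradiating_bound (R : realType) (n : nat) (lambda mu s delta Mmax epsmax : R) :
  n = 2%N \/ n = 3%N -> 0 < mu -> 0 < n%:R * lambda + 2 * mu ->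
  stability_constant n lambda mu s -> 0 < delta -> delta <= 1 ->
  0 < Mmax -> 0 < epsmax -> epsmax * Mmax < s ->
  exists2 C : R, 0 < C &
  forall (omega K r1 : R) (Om : set 'rV[R]_n) (V : cfun R n) (ui ut : cfield R n)
    (p : 'rV[R]_n),
  0 < omega -> lipschitz_domain Om -> connected (~` Om) -> medium Om V ->
  (Ctilde_norm omega delta Om V <= Mmax%:E)%E ->
  diam Om * omega <= epsmax ->
  incident_wave lambda mu omega ui ->
  total_field lambda mu omega Om V ui ut ->
  (forall x, r1 < enorm x ->
    cnorm (scattered ui ut x) <= K * enorm x `^ (- ((n%:R + 1) / 2))) ->
  boundary Om p ->
  Ctilde_norm omega delta Om V \is a fin_num ->
  Ctilde_norm_field omega delta Om ui \is a fin_num ->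
  fine (Ctilde_norm omega delta Om V) != 0 ->
  fine (Ctilde_norm_field omega delta Om ui) != 0 ->
  cnorm (bdry_value Om V p *: ui p) <= C * (diam Om * omega) `^ delta *
    (fine (Ctilde_norm omega delta Om V) * fine (Ctilde_norm_field omega delta Om ui)).
Proof.
move=> n23 mu0 lame0 [s0 hs] delta0 delta1 M0 eps0 Us.
have n0 : (0 < n)%N by case: n23 => ->.
have nR : 1 <= n%:R :> R by rewrite ler1n.
pose L := lambda + 2 * mu.
have L0 : 0 < L by rewrite /L; move: lame0; case: n23 => -> ?; lra.
(* With e = eps^delta, this [a] bounds 1 + e, eps / e and eps; it lets powers of eps be traded for
   eps^delta. *)
pose a := 2 + epsmax; have a1 : 1 <= a by rewrite /a; lra.
pose T := epsmax ^+ 2 / L.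
have T0 : 0 <= T by rewrite divr_ge0 ?sqr_ge0 ?(ltW L0).
pose E1 := 6 * expR T / L.
have E10 : 0 <= E1 by rewrite divr_ge0 ?mulr_ge0 ?expR_ge0 ?(ltW L0).
(* Bounds the wave on Om: its value at p is at most 1 and its variation at most 6 e^T T. *)
pose W := 1 + 6 * expR T * T.
have W0 : 0 < W by rewrite /W ltr_pwDl//; apply: mulr_ge0 => //; rewrite mulr_ge0 ?expR_ge0.
(* Chosen so that Upsilon(eps, |V|) <= U0 eps^delta. *)
pose U0 := a * (Mmax / (s - epsmax * Mmax)).
have sU : 0 < s - epsmax * Mmax by rewrite subr_gt0.
have U00 : 0 < U0 by rewrite /U0 mulr_gt0 ?divr_gt0// (lt_le_trans _ a1).
pose E := E1 * a ^+ 2.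
have E0 : 0 <= E by rewrite mulr_ge0 ?sqr_ge0.
(* The first summand collects the freezing errors. The factor 2 of the second arises from the
   inequality z <= c1 + z^2 / c1 when the mean of z^2 is at most c1^2. *)
pose C3 := n%:R * (a + 1 + E) + 2 * (n%:R * (W * U0)).
have C30 : 0 < C3.
  apply: ltr_pwDl.
    apply: mulr_gt0; first exact: lt_le_trans nR.
    by move: (E) E0 => E' E'0; lra.
  by rewrite mulr_ge0// mulr_ge0// mulr_ge0// ltW.
(* One n undoes the 1/n in the value of the wave at p, the other passes from components to the norm;
   the 2 adds real and imaginary parts. *)
exists (2 * n%:R ^+ 2 * C3); first by rewrite !mulr_gt0 ?exprn_gt0 ?(lt_le_trans _ nR).
move=> omega K r1 Om V ui ut p omega0 lipO conO mV VM epsM hui hut udec bp finV finu v_neq0 q_neq0.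
have [ne_O oO _ bO _] := lipO; have [mVm Voo V0] := mV.
have [hui1 nui] := hui; have [hut1 nut _] := hut.
have clp : closure Om p by have [] := bp.
have [x1 [y1 [Ox1 Oy1 xy1]]] := open_two_points n0 oO ne_O.
set d := diam Om in epsM *; set eps := d * omega in epsM *; set e := eps `^ delta.
have d0 : 0 < d by apply: lt_le_trans xy1 _; exact: enorm_le_diam.
have epspos : 0 < eps by exact: mulr_gt0.
have e0 : 0 < e by exact: powR_gt0.
have ea : 1 + e <= a.
  have := @powR_le_max R eps epsmax delta (ltW epspos) epsM; rewrite (ltW delta0) delta1.
  by move=> /(_ isT); rewrite /a -/e; lra.
have epsa : eps <= a * e.
  have := @powR_le_max R eps epsmax (1 - delta) (ltW epspos) epsM.
  rewrite subr_ge0 delta1 gerBl (ltW delta0) => /(_ isT) h.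
  have <- : e * eps `^ (1 - delta) = eps.
    by rewrite -powRD ?subrKC ?powRr1 ?(ltW epspos)// (gt_eqF epspos) implybT.
  rewrite mulrC ler_wpM2r ?(ltW e0)// (le_trans h)// /a; lra.
have eps2a : eps ^+ 2 <= a ^+ 2 * e.
  rewrite expr2 expr2 -mulrA; apply: ler_pM => //; rewrite ?(ltW epspos)//.
  by rewrite (le_trans epsM)// /a; lra.
pose LV := Linf_norm Om (fun x => cabs (V x)).
pose HV := holder_semi delta Om V.
have [finLV finHV] : LV \is a fin_num /\ HV \is a fin_num.
  exact: fin_num_Ctilde omega0 (Linf_norm_ge0 _ _) finV.
have LV0 : 0 <= fine LV by rewrite fine_ge0// Linf_norm_ge0.
have HV0 : 0 <= fine HV by rewrite fine_ge0// (holder_semi_ge0 _ _ Ox1 Oy1).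
set w := omega `^ (- delta).
have w0 : 0 < w by exact: powR_gt0.
set v := fine (Ctilde_norm omega delta Om V) in v_neq0 *.
have vE : v = fine LV + w * fine HV.
  by rewrite /v /Ctilde_norm -/LV -/HV -(fineK finLV) -(fineK finHV).
have v0 : 0 < v by rewrite lt_neqAle eq_sym v_neq0 vE addr_ge0 ?mulr_ge0 ?(ltW w0).
(* The scaling identity d^delta = omega^(-delta) eps^delta explains the weight in the norm: the
   Hoelder increment over Om is at most eps^delta times the full norm. *)
have dw : d `^ delta = w * e.
  rewrite /e /eps powRM ?(ltW d0) ?(ltW omega0)// /w powRN mulrCA mulVf ?mulr1//.
  by rewrite gt_eqF// powR_gt0.
have HVd x y : enorm (x - y) <= d -> fine HV * enorm (x - y) `^ delta <= v * e.
  move=> xyd; apply: (@le_trans _ _ (fine HV * d `^ delta)).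
    by rewrite ler_wpM2l// ge0_ler_powR ?nnegrE ?enorm_ge0 ?(ltW delta0) ?(ltW d0).
  by rewrite dw vE mulrA ler_wpM2r ?(ltW e0)// mulrC lerDr.
have HVd' x y : Om x -> Om y -> fine HV * enorm (x - y) `^ delta <= v * e.
  by move=> Ox Oy; apply: HVd; exact: enorm_le_diam.
have Vp x : Om x -> cabs (bdry_value Om V p - V x) <= v * e.
  move=> Ox; have ve0 : 0 <= v * e by rewrite mulr_ge0 ?(ltW v0) ?(ltW e0).
  have := bdry_value_holder delta0 ve0 clp bO finHV HVd' HV0 Ox.
  by rewrite -opprB cabsN.
pose LU := Linf_norm Om (fun x => cnorm (ui x)).
pose HU := (\big[maxe/0]_i holder_semi delta Om (coord ui i))%E.
have [finLU finHU] : LU \is a fin_num /\ HU \is a fin_num.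
  exact: fin_num_Ctilde omega0 (Linf_norm_ge0 _ _) finu.
have LU0 : 0 <= fine LU by rewrite fine_ge0// Linf_norm_ge0.
have leHU i : (holder_semi delta Om (coord ui i) <= HU)%E.
  exact: (le_bigmax 0%E (fun i => holder_semi delta Om (coord ui i)) i).
have HUi0 i : (0 <= holder_semi delta Om (coord ui i))%E.
  exact: (holder_semi_ge0 _ _ Ox1 Oy1).
have finHUi i : holder_semi delta Om (coord ui i) \is a fin_num.
  by rewrite ge0_fin_numE// (le_lt_trans (leHU i))// -ge0_fin_numE// (le_trans (HUi0 i)).
have HU0 : 0 <= fine HU by rewrite fine_ge0// (le_trans (HUi0 (Ordinal n0)) (leHU _)).
set q := fine (Ctilde_norm_field omega delta Om ui) in q_neq0 *.
have qE : q = fine LU + w * fine HU.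
  by rewrite /q /Ctilde_norm_field -/LU -/HU -(fineK finLU) -(fineK finHU).
have q0 : 0 < q by rewrite lt_neqAle eq_sym q_neq0 qE addr_ge0 ?mulr_ge0 ?(ltW w0).
have huip j x : Om x -> cabs (ui p ord0 j - ui x ord0 j) <= q * e.
  move=> Ox; have qe0 : 0 <= q * e by rewrite mulr_ge0 ?(ltW q0) ?(ltW e0).
  rewrite -opprB cabsN; have [_ cu] := hui1 j.
  apply: (continuous_value_holder delta0 qe0 clp (cu p) (finHUi j)) Ox => x' y' Ox' Oy'.
  apply: (@le_trans _ _ (fine HU * d `^ delta)).
    apply: ler_pM; rewrite ?fine_ge0 ?powR_ge0//; first by rewrite fine_le.
    by rewrite ge0_ler_powR ?nnegrE ?enorm_ge0 ?(ltW delta0) ?(ltW d0)// enorm_le_diam.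
  by rewrite dw qE mulrA ler_wpM2r ?(ltW e0)// mulrC lerDr.
have mO : measurable Om by exact: open_measurable_rV.
have muO0 : (0 < lebesgue_rV R n Om)%E by exact: lebesgue_rV_open_gt0.
have [r0 Or0] := bounded_enorm bO.
have muOoo : (lebesgue_rV R n Om < +oo)%E.
  apply: le_lt_trans (@lebesgue_closed_ball0_lty R n r0).
  by apply: le_measure; rewrite ?inE//; exact: measurable_closed_ball0.
have ut2 j : L2loc (coord ut j) by have [] := hut1 j.
have ui2 j : L2loc (coord ui j) by have [] := hui1 j.
have LV_ae : {ae lebesgue_rV R n, forall x, Om x -> cabs (V x) <= v}.
  have LVoo : (LV < +oo)%E by rewrite -ge0_fin_numE// Linf_norm_ge0.
  apply: filterS (ae_le_Linf LVoo) => x + Ox => /(_ Ox).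
  rewrite ger0_norm ?cabs_ge0// => /le_trans; apply.
  by rewrite vE lerDl mulr_ge0// ltW.
have LU_ae : {ae lebesgue_rV R n, forall x, Om x -> cnorm (ui x) <= q}.
  have LUoo : (LU < +oo)%E by rewrite -ge0_fin_numE// Linf_norm_ge0.
  apply: filterS (ae_le_Linf LUoo) => x + Ox => /(_ Ox).
  rewrite ger0_norm ?cnorm_ge0// => /le_trans; apply.
  by rewrite qE lerDl mulr_ge0// ltW.
have int_u : (\int[lebesgue_rV R n]_(x in Om) (cnorm (scattered ui ut x) ^+ 2)%:E <=
    ((U0 * e * q) ^+ 2)%:E * lebesgue_rV R n Om)%E.
  have mui : measurable_fun Om (fun x => cnorm (ui x) ^+ 2).
    apply: measurable_funTS; apply: measurable_cnorm_sqr => j; by have [] := ui2 j.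
  (* [stability_constant] measures V over the whole space, the norm here over Om; they agree because
     V vanishes off Om. *)
  have mLV : fine (Linf_norm setT (fun x => cabs (V x))) = fine LV.
    by rewrite -(Linf_norm_medium mV).
  have LVM : fine LV <= Mmax.
    have : v <= Mmax by rewrite -lee_fin /v fineK.
    by apply: le_trans; rewrite vE lerDl mulr_ge0// ltW.
  have epsLV : eps * fine LV <= epsmax * Mmax by apply: ler_pM => //; exact: ltW.
  have hsm := hs omega Om V ui ut omega0 lipO conO mV hui hut.
  rewrite /= mLV -/d -/eps in hsm.
  have [hsc _] := hsm (le_lt_trans epsLV Us).
  apply: (L2_norm_le_sqr mO _ (ltW q0) mui _ LU_ae); first by rewrite mulr_ge0// ltW.
  apply: (le_trans hsc); rewrite lee_wpmul2r ?Lnorm_ge0// lee_fin.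
  rewrite /Upsilon (_ : U0 * e = a * e * (Mmax / (s - epsmax * Mmax))); last by rewrite /U0 mulrAC.
  have sV : 0 < s - eps * fine LV by rewrite subr_gt0 (le_lt_trans epsLV).
  rewrite -mulrA; apply: ler_pM; rewrite ?(ltW epspos) ?divr_ge0 ?(ltW sV)//.
  apply: ler_pM; rewrite ?invr_ge0 ?(ltW sV)//.
  by rewrite lef_pV2 ?posrE// lerD2l lerN2.
have mu2 : measurable_fun Om (fun x => cnorm (scattered ui ut x) ^+ 2).
  apply: measurable_funTS; apply: measurable_cnorm_sqr => j.
  have [ma _] := ut2 j; have [mb _] := ui2 j.
  have -> : coord (scattered ui ut) j = fun x => coord ut j x - coord ui j x.
    by apply/funext => x; rewrite /coord /Defs.coord /scattered !mxE.
  exact: measurable_cfunB.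
set kp := kappa_p lambda mu omega.
have kp2 : (lambda + 2 * mu) * kp ^+ 2 = omega ^+ 2.
  rewrite /kp /kappa_p exprMn exprVn sqr_sqrtr; last exact: ltW.
  by rewrite -/L mulrCA divff ?mulr1// gt_eqF.
have kp0 : 0 < kp by rewrite divr_gt0// sqrtr_gt0.
have kpO x : Om x -> (kp * enorm (x - p)) ^+ 2 <= eps ^+ 2 / L.
  move=> Ox; have xd : enorm (x - p) ^+ 2 <= d ^+ 2.
    apply: lerXn2r; rewrite ?nnegrE ?enorm_ge0 ?(ltW d0)//.
    exact: enorm_closure_le_diam.
  rewrite exprMn ler_pdivlMr// mulrAC [_ * L]mulrC kp2 /eps exprMn mulrC.
  by rewrite ler_wpM2r ?sqr_ge0.
have epsT : eps ^+ 2 / L <= T.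
  by rewrite ler_wpM2r ?invr_ge0 ?(ltW L0)// lerXn2r ?nnegrE ?(ltW epspos) ?(ltW eps0).
have coordk k : cabs (bdry_value Om V p * ui p ord0 k) <= n%:R * (2 * (C3 * (v * q * e))).
  pose F := wave (n := n) kp p k.
  have [B [r2 Fdec]] := wave_decay n23 p k kp0.
  have eF j : elementary (F j) by exact: elementary_wave.
  have Feq j x : rnavier lambda mu F j x = - omega ^+ 2 * F j x.
    by rewrite (rnavier_wave n23) kp2.
  have orth := orthogonality n23 omega0 mV Or0 ui2 ut2 nui nut udec eF Feq Fdec.
  have iG := cintegrable_medium mV Or0 ut2 eF.
  have Fp j : F j p = - n%:R^-1 * (j == k)%:R by exact: (wave_at_center n23).
  have Fnear j x : Om x -> `|F j p - F j x| <= 6 * expR T * (eps ^+ 2 / L).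
    move=> Ox; rewrite distrC.
    apply: (le_trans (wave_near_center n23 k j (le_trans (kpO x Ox) epsT))).
    by rewrite ler_wpM2l ?mulr_ge0 ?expR_ge0// kpO.
  have Fp1 j : `|F j p| <= 1.
    rewrite Fp normrM normrN normfV normr_nat normr_nat.
    apply: mulr_ile1; rewrite ?invr_ge0//; first by rewrite invf_le1 ?(lt_le_trans _ nR).
    by case: (j == k); rewrite ?ler01.
  set b0 := bdry_value Om V p.
  set c0 := b0 * (\sum_j (F j p)%:C * ui p ord0 j).
  have c0E : cabs c0 = n%:R^-1 * cabs (b0 * ui p ord0 k).
    have -> : c0 = (- n%:R^-1)%:C * (b0 * ui p ord0 k).
      rewrite /c0 (bigD1 k)//= big1 => [|j jk]; last first.
        by rewrite Fp (negbTE jk) mulr0 mul0r.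
      by rewrite Fp eqxx mulr1 addr0 mulrCA.
    by rewrite cabsM cabs_real normrN ger0_norm// invr_ge0.
  (* The root-mean-square bound of the scattered field. It balances z <= c1 + z^2 / c1, which
     replaces the Cauchy-Schwarz inequality in the average. *)
  pose c1 := U0 * e * q.
  have c10 : 0 < c1 by rewrite mulr_gt0// mulr_gt0.
  have pw : {ae lebesgue_rV R n, forall x, Om x ->
      cabs (c0 - V x * cdot (ut x) (real_field F x)) <=
      (n%:R * (v * q * e * (a + 1 + E)) + n%:R * (v * W) * c1) +
      (n%:R * (v * W) / c1) * cnorm (scattered ui ut x) ^+ 2}.
    apply: filterS2 LV_ae LU_ae => x Vx ux Ox.
    have {}Vx := Vx Ox; have {}ux := ux Ox.
    rewrite cdot_real_field.
    have uix j : cabs (ui x ord0 j) <= q by exact: le_trans (coord_le_cnorm _ _) ux.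
    have := @cdot_difference R n b0 (V x) (ui p) (ui x) (ut x) (F^~ p) (F^~ x)
      v q e a E W (ltW v0) (ltW q0) (ltW e0) (Vp x Ox) Vx.
    move=> /(_ _ uix (fun j => huip j x Ox) Fp1) h.
    apply: (le_trans (h _ _ _)) => {h}.
    (* An essential supremum over Om says nothing at the boundary point, so ui(p) is bounded through
       ui(x) and the Hoelder increment, giving q (1 + e) <= q a. *)
    - move=> j; rewrite -(subrK (ui x ord0 j) (ui p ord0 j)).
      rewrite (le_trans (cabsD _ _))// (le_trans (lerD (huip j x Ox) (uix j)))//.
      by rewrite -{2}(mulr1 q) -mulrDr ler_wpM2l ?(ltW q0)// addrC.
    - move=> j; apply: (le_trans (Fnear j x Ox)).
      rewrite /E /E1 (_ : 6 * expR T * (eps ^+ 2 / L) = 6 * expR T / L * eps ^+ 2).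
        by rewrite -[leRHS]mulrA ler_wpM2l.
      by move: (expR T) (L^-1) => *; ring.
    - move=> j; rewrite /W -(subrK (F j p) (F j x)) addrC.
      rewrite (le_trans (ler_normD _ _))// lerD// distrC (le_trans (Fnear j x Ox))//.
      by rewrite ler_wpM2l ?mulr_ge0 ?expR_ge0.
    rewrite -[leRHS]addrA lerD2l -/(scattered ui ut x).
    move: (cnorm _) (cnorm_ge0 (scattered ui ut x)) => z z0.
    have zc : z <= c1 + z ^+ 2 / c1.
      have : 0 <= (z - c1) ^+ 2 / c1 by rewrite divr_ge0 ?sqr_ge0 ?(ltW c10).
      have -> : (z - c1) ^+ 2 / c1 = z ^+ 2 / c1 + c1 - 2 * z by field; rewrite gt_eqF.
      by move: z0; move: (z ^+ 2 / c1) => t; clear; lra.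
    have k0 : 0 <= n%:R * (v * W) by rewrite mulr_ge0// mulr_ge0// ltW.
    have := ler_wpM2l k0 zc; move: (n%:R * (v * W)) (mulrA n%:R (v * W) z) => k' -> h.
    by rewrite (le_trans h)// mulrDr [k' / c1 * _]mulrAC -[k' * _ / c1]mulrA.
  have bound0 : 0 <= n%:R * (v * q * e * (a + 1 + E)) + n%:R * (v * W) * c1.
    have h1 : 0 <= v * q * e by apply: ltW; rewrite mulr_gt0// mulr_gt0.
    have h2 : 0 <= a + 1 + E by apply: addr_ge0 => //; move: a1; clear; lra.
    have h3 : 0 <= v * W by apply: ltW; rewrite mulr_gt0.
    by apply: addr_ge0; apply: mulr_ge0 => //; [exact: mulr_ge0|exact: mulr_ge0|exact: ltW].
  have b20 : 0 <= n%:R * (v * W) / c1.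
    have h3 : 0 <= v * W by apply: ltW; rewrite mulr_gt0.
    by apply: divr_ge0; [exact: mulr_ge0|exact: ltW].
  (* Averaging is done for real functions; P stands for the real or the imaginary part. *)
  have part (P : R[i] -> R) : (forall z z', P (z - z') = P z - P z') -> P 0 = 0 ->
      (forall z, `|P z| <= cabs z) ->
      (lebesgue_rV R n).-integrable setT
        (EFin \o (fun x => P (V x * cdot (ut x) (real_field F x)))) ->
      \int[lebesgue_rV R n]_x P (V x * cdot (ut x) (real_field F x)) = 0 ->
      `|P c0| <= C3 * (v * q * e).
    move=> PB P0 Pc iP intP.
    have intO : \int[lebesgue_rV R n]_(x in Om) P (V x * cdot (ut x) (real_field F x)) = 0.
      by rewrite -Rintegral_support// => x xO; rewrite V0// mul0r.
    have iPO := integrableS measurableT mO (@subsetT _ Om) iP.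
    have := @mean_value_le _ _ R (lebesgue_rV R n) Om _
      (fun x => cnorm (scattered ui ut x) ^+ 2) (P c0) _ _ (c1 ^+ 2)
      mO muO0 muOoo iPO intO mu2 (fun x => sqr_ge0 _) bound0 b20 int_u.
    move=> h; apply: (le_trans (h _)) => {h}.
      by apply: filterS pw => x hx Ox; rewrite -PB (le_trans (Pc _))// hx.
    rewrite le_eqVlt; apply/orP; left; apply/eqP.
    by rewrite /C3 /c1; field; rewrite !gt_eqF.
  have hRe : `|Re c0| <= C3 * (v * q * e).
    apply: part; [by case=> ? ? []|by []|exact: Re_le_cabs|exact: iG.1|].
    by have := congr1 (@complex.Re R) orth.
  have hIm : `|Im c0| <= C3 * (v * q * e).
    apply: part; [by case=> ? ? []|by []|exact: Im_le_cabs|exact: iG.2|].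
    by have := congr1 (@complex.Im R) orth.
  have nn0 : 0 < n%:R :> R by exact: lt_le_trans nR.
  have -> : cabs (b0 * ui p ord0 k) = n%:R * cabs c0.
    by rewrite c0E mulrA divff ?mul1r// gt_eqF.
  rewrite ler_wpM2l ?(ltW nn0)// (le_trans (cabs_le_ReIm _))//.
  by move: hRe hIm; clear; lra.
have bnd0 : 0 <= n%:R * (2 * (C3 * (v * q * e))).
  by rewrite !mulr_ge0 ?(ltW C30) ?(ltW v0) ?(ltW q0) ?(ltW e0).
have hcoord k : cabs ((bdry_value Om V p *: ui p) ord0 k) <= n%:R * (2 * (C3 * (v * q * e))).
  by rewrite mxE.
rewrite (le_trans (cnorm_le bnd0 hcoord))// le_eqVlt; apply/orP; left; apply/eqP.
by rewrite -/e; ring.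
Qed.

Theorem theorem4p1 (R : realType) (n : nat) (lambda mu s delta Mmax epsmax : R)
    (hn : n = 2%N \/ n = 3%N)
    (hmu : 0 < mu) (hlame : 0 < n%:R * lambda + 2 * mu)
    (hs : stability_constant n lambda mu s)
    (hdelta0 : 0 < delta)
    (hdelta2 : n = 2%N -> delta <= 1) (hdelta3 : n = 3%N -> delta <= 1 / 2)
    (hM : 0 < Mmax) (heps : 0 < epsmax) (hUpsilon : epsmax * Mmax < s) :
  exists C : R, 0 < C /\
  forall (omega : R) (Om : set 'rV[R]_n) (V : 'rV[R]_n -> R[i])
    (ui : 'rV[R]_n -> 'rV[R[i]]_n),
  0 < omega ->
  lipschitz_domain Om -> connected (~` Om) ->
  medium Om V ->
  (Ctilde_norm omega delta Om V <= Mmax%:E)%E ->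
  let eps := diam Om * omega in
  eps <= epsmax ->
  incident_wave lambda mu omega ui ->
  ((C * eps `^ delta *
      (1 + (1 + Upsilon s epsmax Mmax) * (1 + eps) * eps `^ (n%:R / 2)))%:E
   < ereal_sup [set (cnorm (bdry_value Om V p *: ui p) /
                     (fine (Ctilde_norm omega delta Om V) *
                      fine (Ctilde_norm_field omega delta Om ui)))%:E
               | p in boundary Om])%E ->
  radiating lambda mu omega Om V ui.
Proof.
have delta1 : delta <= 1.
  by case: hn => [/hdelta2//|/hdelta3 h]; rewrite (le_trans h)//; lra.
have [C C0 hC] := nonradiating_bound hn hmu hlame hs hdelta0 delta1 hM heps hUpsilon.
exists C; split=> // omega Om V ui omega0 lipO conO mV VM eps epsM hui hsup ut uinf hut hfar.
apply: contrapT => /forallNP nrad.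
have uinf0 x : enorm x = 1 -> uinf x = 0.
  by move=> x1; apply: contrapT => ux; apply: (nrad x).
have [K [r1 udec]] := zero_far_field_decay hfar uinf0.
move: hsup; apply/negP; rewrite -leNgt; apply: ge_ereal_sup => _ [p bp <-].
rewrite lee_fin.
have eps0 : 0 <= eps.
  have [[x Ox] _ _ bO _] := lipO; apply: mulr_ge0; last exact: ltW.
  by apply: le_trans (enorm_le_diam bO Ox Ox); exact: enorm_ge0.
have Ups0 : 0 <= Upsilon s epsmax Mmax.
  by rewrite /Upsilon divr_ge0 ?mulr_ge0 ?subr_ge0 ?ltW.
set v := fine (Ctilde_norm omega delta Om V).
set q := fine (Ctilde_norm_field omega delta Om ui).
have Ce0 : 0 <= C * eps `^ delta by rewrite mulr_ge0 ?powR_ge0// ltW.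
(* The bracket is at least 1, so a bound by C eps^delta is enough. *)
have factor1 : C * eps `^ delta <= C * eps `^ delta *
    (1 + (1 + Upsilon s epsmax Mmax) * (1 + eps) * eps `^ (n%:R / 2)).
  by rewrite ler_peMr// lerDl !mulr_ge0 ?powR_ge0 ?addr_ge0.
apply: le_trans factor1.
(* An infinite norm has [fine] equal to 0, and division by 0 yields 0, so such quotients are not
   positive. Past this case both norms are finite and nonzero. *)
have [vq0|vq0] := leP (v * q) 0.
  by apply: le_trans Ce0; rewrite mulr_ge0_le0 ?cnorm_ge0// invr_le0.
have : v * q != 0 by rewrite gt_eqF.
rewrite mulf_eq0 negb_or => /andP[v_neq0 q_neq0].
have fin_of (z : \bar R) : fine z != 0 -> z \is a fin_num.
  by case: z => //=; rewrite eqxx.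
rewrite ler_pdivrMr//.
exact: (hC omega K r1 Om V ui ut p omega0 lipO conO mV VM epsM hui hut udec bp
  (fin_of _ v_neq0) (fin_of _ q_neq0) v_neq0 q_neq0).
Qed.
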